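(* Let $X$ be a Banach space and let $\xi\geq1$ be a countable ordinal. Let $\mathcal C$ be the collection of all normalized elements of $SM_\xi^w(X)$. If $SM_\xi^w(X)$ contains a strictly increasing (with respect to domination) sequence of length $\omega$, then $\mathcal C$ contains a strictly increasing sequence of length $\omega_1$.
   Context: Notation. $\mathbb{N}=\{1,2,\dots\}$. For $M\subseteq\mathbb N$, $[M]^{\infty}$ and $[M]^{<\infty}$ denote the sets of infinite and of finite subsets of $M$. For an infinite (resp. finite) set $L\subseteq\mathbb N$, $L(k)$ is the $k$-th element of $L$ in increasing order; $|s|$ is the cardinality of $s$. Regular thin families. A family $\mathcal R$ of finite subsets of $\mathbb N$ is regular if it is compact (the characteristic functions of its members form a compact subset of $\{0,1\}^{\mathbb N}$ with the product topology), hereditary (it contains all subsets of its members) and spreading (if $s\in\mathcal R$, $t\in[\mathbb N]^{<\infty}$, $|s|=|t|=n$ and $s(i)\leq t(i)$ for $1\leq i\leq n$, then $t\in\mathcal R$). A family $\mathcal F$ is regular thin if it is the set of inclusion-maximal elements of some regular family $\mathcal R$. The order of $\mathcal R$ is $o(\mathcal R)=\rho(\emptyset)$, where $\rho(t)=\sup\{\rho(s)+1: s\in\mathcal R,\ t\subsetneq s\}$ (with $\sup\emptyset=0$), a countable ordinal; and $o(\mathcal F)=o(\mathcal R)$. Put $\mathcal F\upharpoonright L=\{s\in\mathcal F:s\subseteq L\}$, $\widehat{\mathcal F}=\{s: s\subseteq t\text{ for some }t\in\mathcal F\}$, $\widehat{\mathcal F}\upharpoonright L=\{s\in\widehat{\mathcal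 F}:s\subseteq L\}$; the latter has the subspace topology of $\{0,1\}^{\mathbb N}$ (sets identified with characteristic functions). Plegma families. An $l$-tuple $(s_j)_{j=1}^l$ of nonempty finite subsets of $\mathbb N$ is plegma if (i) $s_i(k)<s_j(k)$ whenever $1\leq i<j\leq l$ and $1\leq k\leq\min(|s_i|,|s_j|)$, and (ii) $s_i(k)<s_j(k+1)$ for all $i,j\in\{1,\dots,l\}$ and $1\leq k\leq\min(|s_i|,|s_j|-1)$. $\mathrm{Plm}_k(\mathcal F\upharpoonright L)$ is the set of plegma $k$-tuples of members of $\mathcal F\upharpoonright L$. Spreading models. An $\mathcal F$-sequence in $X$ is a family $(x_s)_{s\in\mathcal F}$ in $X$; an $\mathcal F$-subsequence is $(x_s)_{s\in\mathcal F\upharpoonright L}$ with $L\in[\mathbb N]^\infty$. Let $(e_n)_n$ be a Hamel basis of an infinite-dimensional seminormed space $(E,\|\cdot\|_* )$. $(x_s)_{s\in\mathcal F\upharpoonright M}$ generates $(e_n)_n$ as an $\mathcal F$-spreading model if there is a null sequence $(\delta_n)_n$ of positive reals such that for all $1\leq k\leq l$, all $a_1,\dots,a_k\in[-1,1]$ and all $(s_j)_{j=1}^k\in\mathrm{Plm}_k(\mathcal F\upharpoonright M)$ with $s_1(1)\geq M(l)$, $\big|\,\|\sum_{j=1}^k a_jx_{s_j}\|-\|\sum_{j=1}^k a_je_j\|_*\big|\leq\delta_l$. $(x_s)_{s\in\mathcal F\upharpoonright L}$ is subordinated if there is a map $\widehat\varphi:\widehat{\mathcal F}\upharpoonright L\to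 X$, continuous for the weak topology of $X$, with $\widehat\varphi(s)=x_s$ for all $s\in\mathcal F\upharpoonright L$. It is weakly null if for every $x^*\in X^*$ and $\varepsilon>0$ there is $n_0$ such that $|x^*(x_s)|<\varepsilon$ for every $s\in\mathcal F\upharpoonright L$ with $\min s\geq n_0$. $SM_\xi^w(X)$ is the set of all sequences $(e_n)_n$ generated as an $\mathcal F$-spreading model by some subordinated weakly null $\mathcal F$-subsequence in $X$, for some regular thin family $\mathcal F$ of order $\xi$. Normalized means $\|e_n\|=1$ for all $n$. Order: $(e^1_n)_n\preccurlyeq(e^2_n)_n$ if there is $C>0$ with $\|\sum_{i=1}^n a_ie_i^1\|\leq C\|\sum_{i=1}^n a_ie_i^2\|$ for all $n\in\mathbb N$ and all reals $a_1,\dots,a_n$ (each norm being the respective seminorm); $(e_n^1)_n\prec(e_n^2)_n$ if $(e^1_n)_n\preccurlyeq(e^2_n)_n$ but not $(e^2_n)_n\preccurlyeq(e^1_n)_n$. A strictly increasing sequence of length an ordinal $\zeta$ is a family $(a_\alpha)_{\alpha<\zeta}$ with $a_\alpha\prec a_\beta$ whenever $\alpha<\beta<\zeta$. *)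

(* Defs.v *)
From HB Require Import structures.
From mathcomp Require Import all_boot all_order all_algebra finmap.
From mathcomp Require Import all_classical all_reals all_analysis.
From mathcomp Require wochoice.
Set Implicit Arguments.
Unset Strict Implicit.
Unset Printing Implicit Defensive.
Import Order.TTheory GRing.Theory Num.Theory.
Import numFieldNormedType.Exports.

Local Open Scope classical_set_scope.

(** The ordinal omega_1: in a well-ordering of the continuum, the points
    having only countably many predecessors form a well-ordered set of order
    type omega_1, whichever well-ordering is used.  Its elements are the
    countable ordinals. *)

Definition wo_rel : rel (nat -> bool) :=
  sval (wochoice.well_ordering_principle (nat -> bool)).

Definition countable_below : pred (nat -> bool) :=
  fun x => `[< countable [set y | wo_rel y x] >].

Definition omega1 : Type := {x : nat -> bool | countable_below x}.

HB.instance Definition _ := Choice.on omega1.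

Definition omega1_le : rel omega1 := fun a b => wo_rel (val a) (val b).

Lemma wo_rel_min (A : set (nat -> bool)) : A !=set0 ->
  exists2 x, A x & forall y, A y -> wo_rel x y.
Proof.
case=> x0 Ax0.
have [|z [[zA lez] _]] :=
  svalP (wochoice.well_ordering_principle (nat -> bool)) [pred x | `[< A x >]].
  by exists x0; apply/asboolP.
exists z; first exact/asboolP.
by move=> y Ay; apply: lez; apply/asboolP.
Qed.

Lemma wo_rel_total : total wo_rel.
Proof.
move=> x y; have [|z [->|->] lez] := @wo_rel_min [set x; y].
- by exists x; left.
- by rewrite (lez y) //; right.
- by rewrite (lez x) ?orbT //; left.
Qed.

Lemma wo_rel_refl : reflexive wo_rel.
Proof. by move=> x; have := wo_rel_total x x; rewrite orbb. Qed.

Lemma wo_rel_anti : antisymmetric wo_rel.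
Proof.
move=> x y /andP[xy yx].
pose A := [pred t | (t == x) || (t == y)].
have Ax : x \in A by rewrite inE eqxx.
have Ay : y \in A by rewrite inE eqxx orbT.
have [|z [_ uz]] := svalP (wochoice.well_ordering_principle (nat -> bool)) A.
  by exists x.
have minx : wochoice.minimum_of wo_rel A x.
  split=> // t; rewrite inE => /orP[] /eqP -> //; exact: wo_rel_refl.
have miny : wochoice.minimum_of wo_rel A y.
  split=> // t; rewrite inE => /orP[] /eqP -> //; exact: wo_rel_refl.
by rewrite -(uz _ minx) -(uz _ miny).
Qed.

Lemma wo_rel_trans : transitive wo_rel.
Proof.
move=> y x z xy yz.
have [|t [[->|->]|->] le] := @wo_rel_min [set x; y; z].
- by exists x; left; left.
- by apply: le; right.
- have yx : wo_rel y x by apply: le; left; left.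
  by rewrite (@wo_rel_anti x y) // xy yx.
- have zy : wo_rel z y by apply: le; left; right.
  by rewrite -(@wo_rel_anti y z) // yz zy.
Qed.

Lemma omega1_le_refl : reflexive omega1_le.
Proof. by move=> a; exact: wo_rel_refl. Qed.
Lemma omega1_le_anti : antisymmetric omega1_le.
Proof. by move=> a b ab; apply/val_inj/wo_rel_anti. Qed.
Lemma omega1_le_trans : transitive omega1_le.
Proof. by move=> a b c; exact: wo_rel_trans. Qed.
Lemma omega1_le_total : total omega1_le.
Proof. by move=> a b; exact: wo_rel_total. Qed.

Fact omega1_display : Order.disp_t. Proof. exact: Order.default_display. Qed.

HB.instance Definition _ := @Order.Le_isPOrder.Build omega1_display omega1
  omega1_le omega1_le_refl omega1_le_anti omega1_le_trans.
HB.instance Definition _ := @Order.POrder_isTotal.Build omega1_display omega1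
  omega1_le_total.

Lemma omega1_inhabited : exists a : omega1, True.
Proof.
have [|x _ lex] := @wo_rel_min setT; first by exists xpredT.
suff cx : countable_below x by exists (exist _ x cx).
apply/asboolP; apply: (@sub_countable _ _ _ [set x]) (countable1 x).
apply: subset_card_le => y /= yx; apply: wo_rel_anti.
by rewrite yx lex.
Qed.

HB.instance Definition _ := isPointed.Build omega1 (sval (cid omega1_inhabited)).

Lemma omega1_well_founded (A : set omega1) : A !=set0 ->
  exists2 a, A a & forall b, A b -> (a <= b)%O.
Proof.
case=> a0 Aa0; have [|x [a Aa <-] lea] := @wo_rel_min (val @` A).
  by exists (val a0); exists a0.
by exists a => // b Ab; apply: lea; exists b.
Qed.

Lemma omega1_countable_below (a : omega1) : countable [set b | (b <= a)%O].
Proof.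
have /asboolP/countable_injP[f fi] := valP a.
apply/countable_injP; exists (f \o val) => b c; rewrite !inE => ba ca /= fbc.
by apply/val_inj/fi => //; rewrite inE.
Qed.

Lemma cantor_uncountable : ~ countable [set: nat -> bool].
Proof.
move=> /countable_injP[f fi].
pose d n := ~~ (xget xpredT [set g | f g = n]) n.
have fd : xget xpredT [set g | f g = f d] = d.
  by apply: xget_unique => // g fg; apply: fi; rewrite ?inE.
have : d (f d) = ~~ d (f d) by rewrite {1}/d fd.
by case: (d _).
Qed.

Lemma omega1_uncountable : ~ countable [set: omega1].
Proof.
move=> cO.
have cC : countable [set` countable_below].
  suff -> : [set` countable_below] = val @` [set: omega1].
    exact: card_le_trans (card_image_le _ _) cO.
  by apply/seteqP; split=> [x cx|_ [[x cx] _ <-] //]; exists (exist _ x cx).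
have [/= [x ncx]|/forallNP C] := pselect (exists x, ~ countable_below x); last first.
  apply: cantor_uncountable; apply: sub_countable cC.
  by apply: subset_card_le => x _; exact: contrapT (C x).
have [z nz lez] := @wo_rel_min [set x | ~ countable_below x] (ex_intro _ x ncx).
apply: nz; apply/asboolP.
have cU : countable (\bigcup_(b in [set: bool])
    if b then [set` countable_below] else [set z]).
  by apply: bigcup_countable => // -[] _ //; exact: countable1.
apply: sub_countable cU; apply: subset_card_le => y /= yz.
have [cy|ncy] := pselect (countable_below y); first by exists true.
by exists false => //=; apply: wo_rel_anti; rewrite yz lez.
Qed.

Lemma omega1_bounded (A : set omega1) : countable A -> ubound A !=set0.
Proof.
move=> cA; apply: contrapT => nub; apply: omega1_uncountable.
have -> : [set: omega1] = \bigcup_(a in A) [set b | (b <= a)%O].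
  apply/seteqP; split=> // b _; apply: contrapT => nb; apply: nub.
  exists b => a Aa; have /orP[//|ba] := omega1_le_total a b.
  by exfalso; apply: nb; exists a.
by apply: bigcup_countable => // a _; exact: omega1_countable_below.
Qed.

(** Meaningful for nonempty [A]. *)
Definition omega1_min (A : set omega1) : omega1 :=
  get [set a | A a /\ forall b, A b -> (a <= b)%O].

Definition omega1_succ (a : omega1) : omega1 := omega1_min [set b | (a < b)%O].

Definition omega1_sup (A : set omega1) : omega1 := omega1_min (ubound A).

Definition omega1_zero : omega1 := omega1_sup set0.

Definition omega1_one : omega1 := omega1_succ omega1_zero.

Lemma omega1_minP (A : set omega1) : A !=set0 ->
  A (omega1_min A) /\ forall b, A b -> (omega1_min A <= b)%O.
Proof.
move=> /omega1_well_founded[a Aa lea].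
by apply: (@getPex _ [set a | A a /\ forall b, A b -> (a <= b)%O]); exists a.
Qed.

Lemma omega1_supP (A : set omega1) : countable A ->
  ubound A (omega1_sup A) /\ forall b, ubound A b -> (omega1_sup A <= b)%O.
Proof. by move=> /omega1_bounded; exact: omega1_minP. Qed.

Lemma omega1_succP (a b : omega1) : (omega1_succ a <= b)%O = (a < b)%O.
Proof.
have [|alt lea] := @omega1_minP [set b | (a < b)%O].
  apply: contrapT => nb; apply: omega1_uncountable.
  suff -> : [set: omega1] = [set b | (b <= a)%O] by exact: omega1_countable_below.
  apply/seteqP; split=> // c _ /=; rewrite leNgt; apply/negP => ac.
  by apply: nb; exists c.
by apply/idP/idP => [|ab]; [exact: lt_le_trans | exact: lea].
Qed.

(** The type [nat] plays the role of N = {1, 2, ...}: only the order of N is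
    ever used, and k-th elements are counted from 0. *)

Definition nat_family := set {fset nat}.

Definition fset_nth (s : {fset nat}) (k : nat) : nat := nth 0 (sort leq s) k.

Definition nat_set_nth (L : set nat) (k : nat) : nat :=
  get [set n | L n /\ count (fun m => m \in L) (iota 0 n) = k].

Definition char_fset (s : {fset nat}) : cantor_space := fun n => n \in s.

Definition hereditary_family (F : nat_family) : Prop :=
  forall s t, F s -> (t `<=` s)%fset -> F t.

Definition spreading_family (F : nat_family) : Prop :=
  forall s t, F s -> #|` s| = #|` t| ->
    (forall i, i < #|` s| -> fset_nth s i <= fset_nth t i) -> F t.

Definition regular_family (F : nat_family) : Prop :=
  [/\ compact (char_fset @` F), hereditary_family F & spreading_family F].

Definition maximal_elements (F : nat_family) : nat_family :=
  [set s | F s /\ forall t, F t -> (s `<=` t)%fset -> t = s].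

(** [rho t] is the supremum of [rho s + 1] over the proper supersets [s] of [t]
    in [G]; suprema are taken in omega_1, where every countable set has one. *)
Definition is_rank (G : nat_family) (rho : {fset nat} -> omega1) : Prop :=
  forall t, rho t =
    omega1_sup [set omega1_succ (rho s) | s in [set s | G s /\ (t `<` s)%fset]].

Definition has_order (G : nat_family) (xi : omega1) : Prop :=
  exists2 rho, is_rank G rho & rho fset0 = xi.

Definition regular_thin_of_order (F : nat_family) (xi : omega1) : Prop :=
  exists G, [/\ regular_family G, F = maximal_elements G & has_order G xi].

Definition restrict_to (F : nat_family) (L : set nat) : nat_family :=
  [set s | F s /\ [set` s] `<=` L].

Definition down_closure (F : nat_family) : nat_family :=
  [set s | exists2 t, F t & (s `<=` t)%fset].

Definition plegma (l : nat) (s : 'I_l -> {fset nat}) : Prop :=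
  [/\ forall i, s i != fset0,
      forall (i j : 'I_l) k, i < j -> k < minn #|` s i| #|` s j| ->
        fset_nth (s i) k < fset_nth (s j) k
    & forall (i j : 'I_l) k, k < minn #|` s i| #|` s j|.-1 ->
        fset_nth (s i) k < fset_nth (s j) k.+1].

Local Open Scope ring_scope.

(** A sequence (e_n) that is a Hamel basis of a seminormed space, which is then
    infinite-dimensional.  These records live in too large a universe for
    [set]; collections of them are plain predicates. *)
Record seminormed_basis (R : realType) := SeminormedBasis {
  sb_space :> lmodType R;
  sb_norm : sb_space -> R;
  sb_normD : forall x y, sb_norm (x + y) <= sb_norm x + sb_norm y;
  sb_normZ : forall (a : R) x, sb_norm (a *: x) = `|a| * sb_norm x;
  sb_basis : nat -> sb_space;
  sb_free : forall n (a : 'I_n -> R),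
    \sum_(i < n) a i *: sb_basis i = 0 -> forall i, a i = 0;
  sb_span : forall x, exists n (a : 'I_n -> R),
    x = \sum_(i < n) a i *: sb_basis i }.

Definition sb_normalized (R : realType) (e : seminormed_basis R) : Prop :=
  forall n, sb_norm (sb_basis e n) = 1.

Definition sb_le (R : realType) (e1 e2 : seminormed_basis R) : Prop :=
  exists2 C : R, 0 < C & forall n (a : 'I_n -> R),
    sb_norm (\sum_(i < n) a i *: sb_basis e1 i) <=
    C * sb_norm (\sum_(i < n) a i *: sb_basis e2 i).

Definition sb_lt (R : realType) (e1 e2 : seminormed_basis R) : Prop :=
  sb_le e1 e2 /\ ~ sb_le e2 e1.

(** [S] contains a strictly increasing sequence whose length is the order type
    of [I]. *)
Definition has_increasing_seq (R : realType) (d : Order.disp_t)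
    (I : orderType d) (S : seminormed_basis R -> Prop) : Prop :=
  exists e : I -> seminormed_basis R,
    (forall i, S (e i)) /\ (forall i j, (i < j)%O -> sb_lt (e i) (e j)).

Section SpreadingModels.
Variables (R : realType) (X : completeNormedModType R).

Definition dual : Type :=
  {f : {linear X -> R^o} | continuous (f : X -> R^o)}.

Definition dual_fun (f : dual) : X -> R^o := sval f.

Definition weak_space : Type :=
  sup_topology (fun f : dual => Topological.on (initial_topology (dual_fun f))).

HB.instance Definition _ := Topological.on weak_space.

Implicit Types (F : nat_family) (x : {fset nat} -> X) (L : set nat).

(** Only the values of [x] on the restriction of [F] to [L] matter below. *)

Definition subordinated F x L : Prop :=
  exists phi : cantor_space -> weak_space,
    {within char_fset @` restrict_to (down_closure F) L, continuous phi} /\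
    (forall s, restrict_to F L s -> phi (char_fset s) = x s).

Definition weakly_null F x L : Prop :=
  forall (f : dual) (eps : R), 0 < eps -> exists n0 : nat, forall s,
    restrict_to F L s -> (n0 <= fset_nth s 0)%N -> `|dual_fun f (x s)| < eps.

(** The tuples are indexed by ['I_k.+1], so that they are nonempty, and [delta]
    by positive [l]; [nat_set_nth L l.-1] is the l-th element of [L]. *)
Definition generates F x L (e : seminormed_basis R) : Prop :=
  exists delta : nat -> R,
    [/\ forall n, 0 < delta n,
        delta @ \oo --> (0 : R)
      & forall (k l : nat) (a : 'I_k.+1 -> R) (s : 'I_k.+1 -> {fset nat}),
          (k.+1 <= l)%N -> (forall j, -1 <= a j <= 1) ->
          plegma s -> (forall j, restrict_to F L (s j)) ->
          (nat_set_nth L l.-1 <= fset_nth (s ord0) 0)%N ->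
          `| `|\sum_(j < k.+1) a j *: x (s j)| -
             sb_norm (\sum_(j < k.+1) a j *: sb_basis e j) | <= delta l].

Definition SMw (xi : omega1) (e : seminormed_basis R) : Prop :=
  exists F x L,
    [/\ regular_thin_of_order F xi, infinite_set L, subordinated F x L,
        weakly_null F x L & generates F x L e].

End SpreadingModels.

(* Main.v *)
Require Import Defs.
From HB Require Import structures.
From mathcomp Require Import all_boot all_order all_algebra finmap.
From mathcomp Require Import all_classical all_reals all_analysis.
From mathcomp Require Import zify lra.
Set Implicit Arguments.
Unset Strict Implicit.
Unset Printing Implicit Defensive.
Local Open Scope classical_set_scope.

(** The theorem rests on one construction: countably many members [es n] of
    [SMw X xi] and positive weights [w n] decreasing fast enough yield a member
    [e] of [SMw X xi] whose norm lies, up to negligible terms, between every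
    single [w n] times the norm of [es n] and the sum over [n] of these
    quantities ([realize]).  Given a strictly increasing sequence [es], let the
    weights be [u n * theta n ^+ j al n], where [theta n] is a small number, [u]
    is fixed, and [j al], for [al] below omega_1, are functions with [j al n <= n]
    such that [j be] is eventually smaller than [j al] whenever [al < be]
    ([slow_chain]).  Then for [al < be] the weights of [al] are eventually at
    most [theta n] times those of [be].  Since the [theta n] are summable, the
    norm of index [be] dominates that of index [al].  If moreover the [u n] are
    chosen one after the other, so small that a vector separating [es n.+1] from
    [es n] is not felt by the later terms ([weights_exist]), then that vector has
    index-[be] norm at least about [2 ^ n] times its index-[al] norm, so that
    the domination is strict.

    For [realize], every [es n] is first transported to a tree of finite
    increasing sequences ([tree_system], [SMw_system]): inside a sparse infinite
    set a regular family becomes a tree in which each nonterminal node has all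
    possible one-point extensions, and a subordinated weakly null sequence
    becomes a function on the nodes, weakly continuous, weakly zero at the root.
    The vector attached to a finite set [s] in the new sequence is the sum of
    [w n * Z n t] over [n < min s], where [t] is a terminal node of the [n]-th
    tree read off from [s] moved by the [n]-th of a sequence of interleaving
    shifts ([y_seq]).  Such a terminal node exists because the trees have rank at
    most [xi]: a tree embeds into every spreading family of at least its rank
    ([embed_tree]), so a maximal element of a regular family of order [xi] cannot
    correspond to a nonterminal node.  The linear combinations of the new
    sequence over a plegma tuple are therefore governed by combinations over
    larger plegma tuples, with one row for each [n] ([joint_sum]).  Their norms
    converge along a suitable infinite set by Ramsey's theorem for plegma tuples
    ([ramsey_plegma]), a consequence of Galvin's lemma ([galvin]) because a plegma
    tuple of terminal nodes can be recovered from its union ([plg_unique]).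

    The upper estimate of the limit norm is the triangle inequality.  For the
    lower estimate ([lower_array]) row [n] is fixed first, leaving free a finite
    block of integers before each of its elements, and a functional norming the
    combination of this row is chosen.  The blocks are so long that no functional
    of norm one can be bounded away from its weak limit on a block
    ([weakly_null_gap], a form of Mazur's lemma obtained from the Hahn-Banach
    theorem), so the remaining rows can be chosen inside the blocks with an
    almost nonnegative contribution to the functional. *)

(** * Increasing enumerations and diagonalization *)

Definition incr (L : nat -> nat) := forall i j, i < j -> L i < L j.

Lemma incr_leq L : incr L -> forall i j, (L i <= L j) = (i <= j).
Proof.
move=> iL i j; apply/idP/idP; last first.
  by rewrite leq_eqVlt => /orP[/eqP->//|/iL/ltnW].
by apply: contraTT; rewrite -!ltnNge; exact: iL.
Qed.

Lemma incr_ltn L : incr L -> forall i j, (L i < L j) = (i < j).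
Proof. by move=> iL i j; rewrite ltnNge incr_leq // -ltnNge. Qed.

Lemma incr_inj L : incr L -> injective L.
Proof.
move=> iL i j e; apply/eqP.
by rewrite eqn_leq -(incr_leq iL) -(incr_leq iL j i) e leqnn.
Qed.

Lemma incr_ge L : incr L -> forall i, i <= L i.
Proof.
move=> iL; elim=> // i IH; apply: leq_ltn_trans IH _; exact: iL.
Qed.

Lemma incrS L : (forall i, L i < L i.+1) -> incr L.
Proof.
move=> h i j; elim: j => // j IH; rewrite ltnS leq_eqVlt => /orP[/eqP->//|/IH ij].
exact: ltn_trans ij _.
Qed.

Lemma incr_comp L h : incr L -> incr h -> incr (L \o h).
Proof. by move=> iL ih i j ij; apply/iL/ih. Qed.

Lemma incr_sorted L s : incr L -> sorted ltn (map L s) = sorted ltn s.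
Proof.
by move=> iL; rewrite sorted_map; apply: eq_sorted => i j; exact: incr_ltn.
Qed.

Definition cofinal (A : set nat) := forall n, exists2 m, A m & n <= m.

Lemma cofinal_above A n : cofinal A -> cofinal (A `&` [set m | n < m]).
Proof.
move=> cA k; have [m Am km] := cA (maxn k n.+1).
by exists m; [split=> //=|]; lia.
Qed.

Lemma cofinal_range L : incr L -> cofinal (range L).
Proof. by move=> iL n; exists (L n); [exists n|exact: incr_ge]. Qed.

(** Diagonalization: shrink successively to sets [B_k] with [Q b_k B_k], where
    [b_k] is picked in the previous one; what follows [b_k] in the resulting set lies
    in [B_k]. *)
Lemma fusion (Q : nat -> set nat -> Prop) (A : set nat) :
  (forall m B C, B `<=` C -> Q m C -> Q m B) ->
  (forall m C, cofinal C -> C `<=` A ->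
     exists B, [/\ cofinal B, B `<=` C & Q m B]) ->
  cofinal A ->
  exists L, [/\ incr L, forall i, A (L i)
    & forall i, Q (L i) [set L j | j in [set j | i < j]]].
Proof.
move=> hQ dQ cA.
have /choice[g gP] (p : nat * set nat) : exists B, cofinal p.2 -> p.2 `<=` A ->
    [/\ cofinal B, B `<=` p.2 & Q p.1 B].
  case: p => m C /=; have [[c C']|n] := pselect (cofinal C /\ C `<=` A).
    by have [B] := dQ m C c C'; exists B.
  by exists C => c C'; case: n.
pose next (B : set nat) : nat * set nat :=
  let b := xget 0 B in (b, g (b, B `&` [set m | b < m])).
pose st k := iter k (fun p => next p.2) (next A).
have nextP B : cofinal B -> B `<=` A -> [/\ B (next B).1, cofinal (next B).2,
    (next B).2 `<=` B `&` [set m | (next B).1 < m] & Q (next B).1 (next B).2].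
  move=> cB BA; rewrite /next /=; set b := xget 0 B.
  have Bb : B b by have [m Bm _] := cB 0; exact: (xgetPex 0 (ex_intro _ m Bm)).
  have [|c s q] := gP (b, B `&` [set m | b < m]) (cofinal_above b cB).
    by move=> x [/BA].
  by split.
have stP k : [/\ A (st k).1, cofinal (st k).2,
    (st k).2 `<=` A `&` [set m | (st k).1 < m] & Q (st k).1 (st k).2].
  elim: k => [|k [Ak ck sk qk]] /=; first exact: nextP.
  have [|h1 h2 h3 h4] := nextP (st k).2 ck; first by move=> x /sk[].
  split=> //; first by have [] := sk _ h1.
  by move=> x /h3[/sk[]].
have stS k : (st k).2 (st k.+1).1 /\ (st k.+1).2 `<=` (st k).2.
  have [Ak ck sk qk] := stP k.
  have [|h1 h2 h3 h4] := nextP (st k).2 ck; first by move=> x /sk[].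
  by split=> // x /h3[].
have mono k l : (st (k + l)).2 `<=` (st k).2.
  elim: l => [|l IH]; first by rewrite addn0.
  by rewrite addnS => x /(proj2 (stS _)) /IH.
have inB i j : i < j -> (st i).2 (st j).1.
  move=> ij; rewrite -(subnK ij) addnS addnC; apply: (mono i (j - i.+1)).
  by have [] := stS (i + (j - i.+1)).
exists (fun k => (st k).1); split.
- by move=> i j /inB; have [_ _ s _] := stP i => /s[].
- by move=> i; have [] := stP i.
- move=> i; have [_ _ _ q] := stP i; apply: hQ q => _ [j /= ij <-]; exact: inB.
Qed.

Lemma dense_finite (I : eqType) (Q : I -> set nat -> Prop) (s : seq I) (A : set nat) :
  (forall i B C, B `<=` C -> Q i C -> Q i B) ->
  (forall i C, cofinal C -> C `<=` A ->
     exists B, [/\ cofinal B, B `<=` C & Q i B]) ->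
  forall C, cofinal C -> C `<=` A ->
  exists B, [/\ cofinal B, B `<=` C & forall i, i \in s -> Q i B].
Proof.
move=> hQ dQ; elim: s => [|i s IH] C cC CA; first by exists C; split.
have [B [cB BC QB]] := IH C cC CA.
have [|D [cD DB QD]] := dQ i B cB; first exact: subset_trans CA.
exists D; split=> //; first exact: subset_trans BC.
by move=> j; rewrite inE => /orP[/eqP->//|/QB]; exact: hQ.
Qed.

Fixpoint subseqs_below m : seq (seq nat) :=
  if m is n.+1 then subseqs_below n ++ [seq rcons s n | s <- subseqs_below n]
  else [:: [::]].

Lemma sorted_rcons_ltn s x :
  sorted ltn (rcons s x) = sorted ltn s && all (ltn^~ x) s.
Proof.
have tr : transitive ltn by move=> a b c; exact: ltn_trans.
rewrite -cats1 (sorted_pairwise tr) (sorted_pairwise tr) pairwise_cat /= andbT.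
rewrite andbC; congr (_ && _).
by rewrite /allrel; apply: eq_all => y /=; rewrite andbT.
Qed.

Lemma mem_subseqs_below m s :
  sorted ltn s -> all (ltn^~ m) s -> s \in subseqs_below m.
Proof.
elim: m s => [|m IH] s; first by case: s.
case/lastP: s => [|s x]; first by move=> _ _; rewrite mem_cat IH.
move=> sx'; rewrite all_rcons /= ltnS leq_eqVlt mem_cat => /andP[+ sm].
move: sx'; rewrite sorted_rcons_ltn => /andP[ss sx] /orP[/eqP e|xm].
  by rewrite -e; apply/orP; right; apply: map_f; rewrite e; apply: IH; rewrite -?e.
rewrite IH // ?sorted_rcons_ltn ?ss // all_rcons /= xm /=.
by apply: sub_all sx => y /= yx; apply: ltn_trans xm.
Qed.

(** * Galvin's lemma *)
Section Galvin.
Variable G : set (seq nat).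

(** Only the elements of [A] above [s] matter: [s] is accepted when every infinite
    set starting with [s] and continuing in [A] has an initial segment in [G] that
    contains [s]. *)
Definition accepts (s : seq nat) (A : set nat) := forall M, incr M ->
  (forall i, A (M i)) -> (forall x, x \in s -> x < M 0) ->
  exists k, G (s ++ mkseq M k).

Definition rejects s A := forall B, cofinal B -> B `<=` A -> ~ accepts s B.

Lemma accepts_sub s A B : B `<=` A -> accepts s A -> accepts s B.
Proof. by move=> BA a M iM AM; apply: a => // i; exact: BA. Qed.

Lemma rejects_sub s A B : B `<=` A -> rejects s A -> rejects s B.
Proof. by move=> BA r C cC /subset_trans/(_ BA); exact: r. Qed.

Let beyond (s : seq nat) (A : set nat) := A `&` [set m | all (ltn^~ m) s].

Lemma cofinal_beyond s A : cofinal A -> cofinal (beyond s A).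
Proof.
move=> cA; elim: s => [|x s IH].
  by move=> n; have [m] := cA n; exists m.
move=> n; have [m [Am /= sm] xm] := IH (maxn n x.+1).
by exists m; [split=> //=; rewrite sm andbT|]; lia.
Qed.

Lemma accepts_beyond s A : accepts s (beyond s A) -> accepts s A.
Proof.
move=> a M iM AM sM; apply: a => // i; split=> //=; apply/allP => x /sM xM.
by apply: leq_trans xM _; rewrite incr_leq.
Qed.

Lemma rejects_beyond s A : rejects s (beyond s A) -> rejects s A.
Proof.
move=> r B cB BA aB; apply: (r (beyond s B)); first exact: cofinal_beyond.
  by move=> x [/BA ? ?]; split.
by apply: accepts_sub aB => x [].
Qed.

(** Each finite set is decided inside some infinite subset, and being decided is
    inherited by smaller infinite sets, so the diagonalization applies. *)
Lemma galvin_decided : exists L, incr L /\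
  forall s, sorted ltn s -> (forall x, x \in s -> range L x) ->
  accepts s (range L) \/ rejects s (range L).
Proof.
pose dec s A := accepts s A \/ rejects s A.
have hdec s B C : B `<=` C -> dec s C -> dec s B.
  by move=> BC [/(accepts_sub BC)|/(rejects_sub BC)]; [left|right].
have ddec s C : cofinal C -> C `<=` setT ->
    exists B, [/\ cofinal B, B `<=` C & dec s B].
  move=> cC _; have [[B [cB BC aB]]|nB] := pselect (exists B,
      [/\ cofinal B, B `<=` C & accepts s B]).
    by exists B; split=> //; left.
  exists C; split=> //; right=> B cB BC aB; apply: nB; by exists B.
have cT : cofinal setT by move=> n; exists n.
have [A0 [cA0 _ dA0]] := ddec [::] setT cT (fun _ => id).
have [||L [iL AL QL]] := @fusion
    (fun m B => forall s, s \in subseqs_below m.+1 -> dec s B) A0 _ _ cA0.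
- by move=> m B C BC h s /h; exact: hdec.
- move=> m C cC CA.
  by apply: (@dense_finite _ dec (subseqs_below m.+1) setT) => //.
exists L; split=> // s ss; case/lastP: s ss => [_ _|s x].
  by apply: hdec dA0 => _ [i _ <-].
rewrite sorted_rcons_ltn => /andP[ss sx] sL.
have [|i _ ix] := sL x; first by rewrite mem_rcons mem_head.
have := QL i (rcons s x); rewrite ix.
case=> [||r].
- apply: mem_subseqs_below; first by rewrite sorted_rcons_ltn ss.
  rewrite all_rcons /= ltnS leqnn; apply: sub_all sx => y /=; exact: leqW.
- move=> a; left; apply: accepts_beyond; apply: accepts_sub a => y [[j _ <-]] /=.
  by rewrite all_rcons /= -ix incr_ltn // => /andP[ij _]; exists j.
- right; apply: rejects_beyond; apply: rejects_sub r => y [[j _ <-]] /=.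
  by rewrite all_rcons /= -ix incr_ltn // => /andP[ij _]; exists j.
Qed.

(** If the accepted one-point extensions of [s] were infinitely many, they would
    form a set witnessing that [s] is not rejected. *)
Lemma rejects_extend L s : incr L -> sorted ltn s ->
  (forall s, sorted ltn s -> (forall x, x \in s -> range L x) ->
    accepts s (range L) \/ rejects s (range L)) ->
  (forall x, x \in s -> range L x) -> rejects s (range L) ->
  forall C, cofinal C -> C `<=` range L -> exists B, [/\ cofinal B, B `<=` C &
    forall n, B n -> all (ltn^~ n) s -> rejects (rcons s n) (range L)].
Proof.
move=> iL ss dec sL rs C cC CL; apply: contrapT => nB.
pose B := C `&` [set n | all (ltn^~ n) s /\ accepts (rcons s n) (range L)].
have cB : cofinal B.
  apply: contrapT => /existsNP[N nN]; apply: nB.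
  exists (C `&` [set n | N < n]); split; first exact: cofinal_above.
    by move=> x [].
  move=> n [Cn /= Nn] sn; have [||a|//] := dec (rcons s n).
  - by rewrite sorted_rcons_ltn ss.
  - move=> x; rewrite mem_rcons inE => /orP[/eqP->|/sL//]; exact: CL.
  - by exfalso; apply: nN; exists n; [|exact: ltnW].
apply: (rs B cB); first by move=> x [/CL].
move=> M iM BM sM; have [_ [sM0 a]] := BM 0.
have [|||k Gk] := a (fun i => M i.+1).
- by move=> i j ij; apply: iM.
- by move=> i; have [/CL] := BM i.+1.
- move=> x; rewrite mem_rcons inE => /orP[/eqP->|/sM xM]; first exact: iM.
  by apply: ltn_trans xM _; apply: iM.
exists k.+1; rewrite cat_rcons in Gk.
suff <- : M 0 :: mkseq (fun i => M i.+1) k = mkseq M k.+1 by [].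
by rewrite /mkseq /= -[in RHS](addn0 1) iotaDl -map_comp.
Qed.

(** If the empty sequence is rejected, a second diagonalization yields an infinite
    set all of whose finite subsets are rejected; none of them is in [G] since
    members of [G] are accepted. *)
Lemma galvin : exists2 L, incr L &
  (forall h, incr h -> exists k, G (mkseq (L \o h) k)) \/
  (forall h, incr h -> forall k, ~ G (mkseq (L \o h) k)).
Proof.
have [L [iL dec]] := galvin_decided.
have nilL x : x \in [::] -> range L x by [].
have [a|r0] := dec [::] isT nilL.
  exists L => //; left=> h ih; have [||//|k Gk] := a (L \o h).
  - exact: incr_comp.
  - by move=> i; exists (h i).
  - by exists k.
have [A2 [cA2 A2L rA2]] :=
  @rejects_extend L [::] iL isT dec nilL r0 _ (cofinal_range iL) (@subset_refl _ _).
have [||L2 [iL2 AL2 QL2]] := @fusion (fun m B => forall s,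
    s \in [seq s <- subseqs_below m.+1 | `[< sorted ltn s /\
       (forall x, x \in s -> range L x) /\ rejects s (range L) >]] ->
    forall n, B n -> all (ltn^~ n) s -> rejects (rcons s n) (range L)) A2 _ _ cA2.
- by move=> m B C BC h s /h k n /BC; exact: k.
- move=> m C cC CA2.
  have [||B [cB BC QB]] := @dense_finite _ (fun s B =>
      sorted ltn s /\ (forall x, x \in s -> range L x) /\ rejects s (range L) ->
      forall n, B n -> all (ltn^~ n) s -> rejects (rcons s n) (range L))
    (subseqs_below m.+1) A2 _ _ C cC CA2.
  + by move=> s B D BD h hs n /BD; exact: h.
  + move=> s D cD DA; have [[ss [sL rs]]|n] := pselect (sorted ltn s /\
      (forall x, x \in s -> range L x) /\ rejects s (range L)).
      have [|B [cB BD rB]] := rejects_extend iL ss dec sL rs cD.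
        exact: subset_trans A2L.
      by exists B.
    by exists D; split.
  + exists B; split=> // s; rewrite mem_filter => /andP[/asboolP hs sm].
    exact: QB.
exists L2 => //; right=> h ih k Gk.
suff : rejects (mkseq (L2 \o h) k) (range L).
  move=> /(_ _ (cofinal_range iL) (@subset_refl _ _)); apply=> M _ _ _.
  by exists 0; rewrite cats0.
elim: k {Gk} => [//|k IH].
have iLh := incr_comp iL2 ih.
rewrite /mkseq -addn1 iotaD map_cat cats1 /= add0n.
have sk j : sorted ltn (mkseq (L2 \o h) j).
  by rewrite /mkseq (incr_sorted (iota 0 j) iLh) iota_ltn_sorted.
have allk j : all (ltn^~ ((L2 \o h) j)) (mkseq (L2 \o h) j).
  by apply/allP => x /mapP[i]; rewrite mem_iota add0n => /andP[_ ij] ->; exact: iLh.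
case: k IH => [|k] IH; first by apply: rA2 => //; exact: AL2.
apply: (QL2 (h k)) (allk k.+1); last by exists (h k.+1) => //; exact: ih.
rewrite mem_filter; apply/andP; split.
  apply/asboolP; split=> //; split=> // x /mapP[i _ ->].
  by apply: A2L; apply: AL2.
apply: mem_subseqs_below => //.
apply/allP => x /mapP[i]; rewrite mem_iota add0n => /andP[_ ij] ->.
by rewrite /= ltnS incr_leq // incr_leq.
Qed.
End Galvin.

(** * Ramsey's theorem for plegma tuples *)

(** Plegma tuples of finite sets, given as increasing sequences.  The tuple is a
    function on all naturals whose first [k] values matter, which makes passing
    to subtuples a composition. *)
Definition plg k (s : nat -> seq nat) :=
  [/\ forall i, i < k -> s i != [::],
      forall i j p, i < j -> j < k -> p < size (s i) -> p < size (s j) ->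
        nth 0 (s i) p < nth 0 (s j) p
    & forall i j p, i < k -> j < k -> p < size (s i) -> p.+1 < size (s j) ->
        nth 0 (s i) p < nth 0 (s j) p.+1].

Definition thin (F : set (seq nat)) :=
  forall s t, F s -> F t -> prefix s t -> s = t.

Lemma plg_ext k s t : (forall i, i < k -> s i = t i) -> plg k s -> plg k t.
Proof.
move=> st [h1 h2 h3]; split.
- by move=> i ik; rewrite -st //; exact: h1.
- move=> i j p ij jk; rewrite -!st //; first exact: h2.
  exact: ltn_trans jk.
- by move=> i j p ik jk; rewrite -!st //; exact: h3.
Qed.

Lemma plg_sorted k s i : plg k s -> i < k -> sorted ltn (s i).
Proof.
move=> [_ _ h] ik; apply/(sortedP 0) => p pi; apply: h => //; exact: ltnW.
Qed.

(** The union of a plegma tuple is enumerated by running through the first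
    elements, then the second elements, and so on. *)
Lemma plg_lt k s i j p q : plg k s -> i < k -> j < k ->
  p < size (s i) -> q < size (s j) -> (p < q) || (p == q) && (i < j) ->
  nth 0 (s i) p < nth 0 (s j) q.
Proof.
move=> ps ik jk pi qj /orP[pq|/andP[/eqP e ij]]; last first.
  by subst q; have [_ h _] := ps; exact: h.
have sj := plg_sorted ps jk; have [_ _ h] := ps.
have p1 : p.+1 < size (s j) by exact: leq_ltn_trans qj.
apply: leq_trans (h i j p ik jk pi p1) _.
rewrite leq_eqVlt in pq; have /orP[/eqP<-//|{}pq] := pq.
apply: ltnW; have tr : transitive ltn by move=> a b c; exact: ltn_trans.
by apply: (sorted_ltn_nth tr 0 sj) => //; rewrite inE.
Qed.

Lemma plg_map k L s : incr L -> plg k (map L \o s) <-> plg k s.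
Proof.
move=> iL; have hn i : (map L (s i) == [::]) = (s i == [::]) by case: (s i).
split=> -[h1 h2 h3]; split.
- by move=> i /h1; rewrite /= hn.
- move=> i j p ij jk pi pj; rewrite -(incr_ltn iL).
  by have := h2 i j p ij jk; rewrite /= !size_map !(nth_map 0) //; apply.
- move=> i j p ij jk pi pj; rewrite -(incr_ltn iL).
  by have := h3 i j p ij jk; rewrite /= !size_map !(nth_map 0) //; apply.
- by move=> i /h1; rewrite /= hn.
- move=> i j p ij jk; rewrite /= !size_map => pi pj.
  by rewrite !(nth_map 0) // incr_ltn //; exact: h2.
- move=> i j p ij jk; rewrite /= !size_map => pi pj.
  by rewrite !(nth_map 0) // incr_ltn //; exact: h3.
Qed.

Section Unique.
Variables (k : nat) (F : nat -> set (seq nat)).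
Hypothesis thF : forall i, i < k -> thin (F i).
Definition covers (s : nat -> seq nat) x := exists2 i, i < k & x \in s i.

(** If [s j] and [t j] first differed at position [p], the smaller of the two
    values would occur elsewhere in the other tuple, at a place preceding
    [(p, j)] in the order of enumeration, where both tuples agree. *)
Lemma plg_unique_step s t p j : plg k s -> plg k t -> j < k ->
  (forall x y, covers t x -> covers s y -> y <= x -> covers t y) ->
  (forall i, i < k -> take p (s i) = take p (t i)) ->
  (forall i, i < j -> take p.+1 (s i) = take p.+1 (t i)) ->
  p < size (s j) -> p < size (t j) -> ~ nth 0 (s j) p < nth 0 (t j) p.
Proof.
move=> ps pt jk cts ep ej pj pj' vw.
have [|||i ik vi] := cts (nth 0 (t j) p) (nth 0 (s j) p).
- by exists j => //; exact: mem_nth.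
- by exists j => //; exact: mem_nth.
- exact: ltnW.
have qi : index (nth 0 (s j) p) (t i) < size (t i) by rewrite index_mem.
have qe := nth_index 0 vi.
set q := index _ _ in qi qe.
have [lt|ge] := boolP ((q < p) || (q == p) && (i < j)); last first.
  have : nth 0 (t j) p <= nth 0 (t i) q.
    have [e|ne] := eqVneq (p, j) (q, i); first by case: e => -> ->.
    apply: ltnW; apply: (plg_lt pt) => //.
    by move: ge ne; rewrite xpair_eqE; lia.
  by rewrite qe leqNgt vw.
have [h1 h2] : q < size (s i) /\ nth 0 (s i) q = nth 0 (t i) q.
  have [m qm e] : exists2 m, q < m & take m (s i) = take m (t i).
    case/orP: lt => [qp|/andP[/eqP-> ij]]; first by exists p => //; exact: ep.
    by exists p.+1 => //; exact: ej.
  split; last by rewrite -(nth_take 0 qm) e nth_take.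
  have := congr1 size e; rewrite !size_take_min; lia.
have := plg_lt ps ik jk h1 pj lt.
by rewrite h2 qe ltnn.
Qed.

(** Plegma tuples of members of thin families can be read off from their union,
    even when only compared along initial segments of one infinite set. *)
Lemma plg_unique s t : plg k s -> plg k t ->
  (forall i, i < k -> F i (s i)) -> (forall i, i < k -> F i (t i)) ->
  (forall x y, covers t x -> covers s y -> y <= x -> covers t y) ->
  (forall x y, covers s x -> covers t y -> y <= x -> covers s y) ->
  forall i, i < k -> s i = t i.
Proof.
move=> ps pt Fs Ft cts cst.
suff main p i : i < k -> take p (s i) = take p (t i).
  move=> i ik; have := main (size (s i) + size (t i)) i ik.
  by rewrite !take_oversize // ?leq_addl ?leq_addr.
elim: p i => [|p IH] i ik; first by rewrite !take0.
elim/ltn_ind: i ik => j IHj jk.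
have ej i : i < j -> take p.+1 (s i) = take p.+1 (t i).
  by move=> ij; apply: IHj => //; exact: ltn_trans jk.
have no s' t' : F j s' -> F j t' -> take p s' = take p t' -> size t' <= p ->
    p < size s' -> False.
  move=> Fs' Ft' e tp ps'; rewrite (take_oversize tp) in e.
  have : t' = s' by apply: (thF jk) => //; rewrite -e; exact: prefix_take.
  by move=> e'; move: ps'; rewrite -e' ltnNge tp.
case: (ltnP p (size (s j))) => hs; case: (ltnP p (size (t j))) => ht.
- rewrite !(take_nth 0) // IH //; congr rcons.
  case: (ltngtP (nth 0 (s j) p) (nth 0 (t j) p)) => // lt; exfalso.
    exact: (plg_unique_step ps pt jk cts IH ej hs ht lt).
  apply: (plg_unique_step pt ps jk cst _ _ ht hs lt) => i ?; first by rewrite IH.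
  by rewrite ej.
- by exfalso; apply: (no (s j) (t j)); auto.
- by exfalso; apply: (no (t j) (s j)); auto; rewrite IH.
- by move: (IH j jk); rewrite !take_oversize // leqW.
Qed.

End Unique.

Definition array k (F : nat -> set (seq nat)) (B : set nat) s :=
  plg k s /\ forall i, i < k -> F i (s i) /\ forall x, x \in s i -> B x.

Lemma array_sub k F A B s : A `<=` B -> array k F A s -> array k F B s.
Proof.
by move=> AB [ps h]; split=> // i /h[Fi Ai]; split=> // x /Ai/AB.
Qed.

Definition homogeneous k F (P : (nat -> seq nat) -> Prop) B :=
  forall s t, array k F B s -> array k F B t -> P s -> P t.

Lemma sorted_extend v : sorted ltn v -> exists2 h, incr h & mkseq h (size v) = v.
Proof.
move=> sv.
have hv x : x \in v -> x <= foldr maxn 0 v.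
  elim: v {sv} => //= y v IH.
  by rewrite inE leq_max => /orP[/eqP->|/IH->]; rewrite ?leqnn ?orbT.
exists (fun r => if r < size v then nth 0 v r else (foldr maxn 0 v).+1 + r).
  move=> i j ij; case: ifP => iv; case: ifP => jv.
  - have tr : transitive ltn by move=> a b c; exact: ltn_trans.
    by apply: (sorted_ltn_nth tr 0 sv) => //; rewrite inE.
  - have le := hv _ (mem_nth 0 iv).
    by rewrite addSn ltnS (leq_trans le) ?leq_addr.
  - by exfalso; move: iv; rewrite (ltn_trans ij jv).
  - by rewrite ltn_add2l.
apply: (@eq_from_nth _ 0); rewrite size_mkseq // => i iv.
by rewrite nth_mkseq // iv.
Qed.

Lemma sorted_range L u : incr L -> sorted ltn u -> (forall x, x \in u -> range L x) ->
  exists2 v, sorted ltn v & u = map L v.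
Proof.
move=> iL su uL; suff [v e] : exists v, u = map L v.
  by exists v => //; rewrite -(incr_sorted v iL) -e.
elim: u uL {su} => [|x u IH] uL; first by exists [::].
have [i _ ix] := uL x (mem_head _ _).
have [y yu|v ->] := IH; first by apply: uL; rewrite inE yu orbT.
by exists (i :: v); rewrite /= ix.
Qed.

(** Galvin's lemma for the unions of the tuples with property [P]. If every
    infinite subset begins with such a union, a given tuple and the one obtained
    from the set continuing its union coincide by uniqueness. *)
Lemma ramsey_plegma k F (P : (nat -> seq nat) -> Prop) :
  (forall i, i < k -> thin (F i)) ->
  (forall s t, (forall i, i < k -> s i = t i) -> P s -> P t) ->
  exists2 L, incr L & homogeneous k F P (range L).
Proof.
move=> thF eP.
pose is_union (u : seq nat) s := sorted ltn u /\ forall x, x \in u <-> covers k s x.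
pose G := [set u | exists s, [/\ plg k s, forall i, i < k -> F i (s i), P s
   & is_union u s]].
have [L iL GL] := galvin G.
have read s : array k F (range L) s -> exists h m, incr h /\ is_union (mkseq (L \o h) m) s.
  move=> [ps hs].
  pose u := sort leq (undup (flatten [seq s i | i <- iota 0 k])).
  have mu x : x \in u <-> covers k s x.
    rewrite mem_sort mem_undup; split.
      move=> /flattenP[A /mapP[i]]; rewrite mem_iota add0n => /andP[_ ik] -> xi.
      by exists i.
    by move=> [i ik xi]; apply/flattenP; exists (s i) => //; apply: map_f; rewrite mem_iota.
  have su : sorted ltn u.
    by rewrite ltn_sorted_uniq_leq sort_uniq undup_uniq sort_sorted //; exact: leq_total.
  have uL x : x \in u -> range L x by move=> /mu[i ik xi]; exact: (hs i ik).2.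
  have [v sv e] := sorted_range iL su uL.
  have [h ih hv] := sorted_extend sv.
  exists h, (size v); split=> //.
  have -> : mkseq (L \o h) (size v) = u by rewrite e -[in RHS]hv /mkseq -map_comp.
  by split.
exists L => //; case: GL => [GL|GL] s t as_ at_ Ps; last first.
  have [h [m [ih us]]] := read s as_.
  case: (GL h ih m); exists s; case: as_ => ps hs; split=> // i ik.
  by case: (hs i ik).
have [h [m [ih [_ ut]]]] := read t at_.
have [m' [t' [pt' Ft' Pt' [_ ut']]]] := GL h ih.
apply: eP Pt' => i ik; symmetry.
have iLh := incr_comp iL ih.
have memh n x : reflect (exists2 i, i < n & x = L (h i)) (x \in mkseq (L \o h) n).
  apply: (iffP mapP) => -[j]; rewrite ?mem_iota => jn ->; exists j => //.
  by rewrite mem_iota.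
have init a b x y : x \in mkseq (L \o h) a -> y \in mkseq (L \o h) b -> y <= x ->
    y \in mkseq (L \o h) a.
  move=> /memh[i1 i1a ->] /memh[i2 i2b ->].
  by rewrite (incr_leq iLh) => le; apply/memh; exists i2 => //; exact: leq_ltn_trans i1a.
case: at_ => pt ht.
apply: (plg_unique thF pt pt' _ Ft' _ _ ik).
- by move=> j jk; case: (ht j jk).
- by move=> x y /ut' hx /ut hy le; apply/ut'; exact: init hx hy le.
- by move=> x y /ut hx /ut' hy le; apply/ut; exact: init hx hy le.
Qed.

Lemma cofinal_enum C : cofinal C -> exists2 M, incr M & forall i, C (M i).
Proof.
move=> cC; have [||M [iM CM _]] := @fusion (fun _ _ => True) C _ _ cC => //.
  by move=> m D cD _; exists D; split.
by exists M.
Qed.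

Lemma ramsey_dense k F (P : (nat -> seq nat) -> Prop) :
  (forall i, i < k -> thin (F i)) ->
  (forall s t, (forall i, i < k -> s i = t i) -> P s -> P t) ->
  forall C, cofinal C -> exists B, [/\ cofinal B, B `<=` C & homogeneous k F P B].
Proof.
move=> thF eP C cC; have [M iM CM] := cofinal_enum cC.
have [||L iL hL] := @ramsey_plegma k (fun i => [set s | F i (map M s)])
   (fun s => P (map M \o s)).
- move=> i ik s t Fs Ft st; apply: (inj_map (incr_inj iM)).
  apply: (thF i ik) => //; case/prefixP: st => u ->; rewrite map_cat.
  exact: prefix_prefix.
- by move=> s t st; apply: eP => i ik /=; rewrite st.
exists (range (M \o L)); split.
- exact/cofinal_range/incr_comp.
- by move=> _ [i _ <-]; exact: CM.
move=> s t as_ at_.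
have pull r : array k F (range (M \o L)) r -> exists r',
    (forall i, i < k -> r i = map M (r' i)) /\
    array k (fun i => [set s | F i (map M s)]) (range L) r'.
  move=> [pr hr].
  have /choice[r' r'P] i : exists v, i < k -> r i = map M v /\
      forall x, x \in v -> range L x.
    have [ik|_] := boolP (i < k); last by exists [::].
    have [|v sv e] := sorted_range (incr_comp iM iL) (plg_sorted pr ik).
      by have [_ h] := hr i ik.
    exists (map L v) => _; rewrite e -map_comp; split=> // x /mapP[j _ ->].
    by exists j.
  exists r'; split; first by move=> i /r'P[].
  split; first by apply/(plg_map _ _ iM)/(plg_ext _ pr) => i /r'P[].
  move=> i ik; have [e h] := r'P i ik; split=> //=; rewrite -e.
  by have [] := hr i ik.
have [s' [es as']] := pull s as_; have [t' [et at']] := pull t at_.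
move=> Ps; apply: (@eP (map M \o t')); first by move=> i ik /=; rewrite et.
apply: hL as' at' _; apply: eP Ps => i ik; exact: es.
Qed.

Import Order.TTheory GRing.Theory Num.Theory.

(** * Trees of finite increasing sequences *)

Lemma omega1_ind (P : omega1 -> Prop) :
  (forall a, (forall b, (b < a)%O -> P b) -> P a) -> forall a, P a.
Proof.
move=> h a; apply: contrapT => na.
have [b nb lb] := @omega1_well_founded [set a | ~ P a] (ex_intro _ a na).
apply: nb; apply: h => c cb; apply: contrapT => nc.
by have := lb c nc; rewrite leNgt cb.
Qed.

Lemma sorted_ltn_uniq s : sorted ltn s -> uniq s.
Proof. by rewrite ltn_sorted_uniq_leq => /andP[]. Qed.

Lemma sorted_ltn_leq s : sorted ltn s -> sorted leq s.
Proof. by rewrite ltn_sorted_uniq_leq => /andP[]. Qed.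

Definition terminal (T : set (seq nat)) u := T u /\ forall x, ~ T (rcons u x).

(** Fullness, the last clause, is what makes every infinite set of naturals
    have an initial segment that is a terminal node, provided that the tree is
    well founded. *)
Definition full_tree (T : set (seq nat)) :=
  [/\ T [::], exists x, T [:: x],
      forall u, T u -> sorted ltn u,
      forall u x, T (rcons u x) -> T u
    & forall u x y, T (rcons u x) -> sorted ltn (rcons u y) -> T (rcons u y)].

Definition ranked (T : set (seq nat)) (rk : seq nat -> omega1) :=
  forall u x, T (rcons u x) -> (rk (rcons u x) < rk u)%O.

(** For sorted [u] and prefix-closed [T] this is the longest initial segment of
    [u] in [T]; written as a filter, it visibly commutes with truncation. *)
Definition init_seg (T : set (seq nat)) (u : seq nat) :=
  [seq x <- u | `[< T [seq z <- u | z <= x] >]].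

Section Tree.
Variable T : set (seq nat).
Hypothesis fT : full_tree T.

Lemma tree_nil : T [::]. Proof. by case: fT. Qed.
Lemma tree_sorted u : T u -> sorted ltn u. Proof. by case: fT => _ _ + _ _; exact. Qed.
Lemma tree_rcons u x : T (rcons u x) -> T u. Proof. by case: fT => _ _ _ + _; exact. Qed.

Lemma tree_prefix u v : T (u ++ v) -> T u.
Proof.
elim/last_ind: v => [|v x IH]; first by rewrite cats0.
by rewrite -rcons_cat => /tree_rcons.
Qed.

Lemma terminal_thin : thin (terminal T).
Proof.
move=> s t [Ts ns] [Tt nt] /prefixP[[|x v] e]; first by rewrite e cats0.
case: (ns x); move: Tt; rewrite e -cat_rcons; exact: tree_prefix.
Qed.

Lemma terminal_nonempty u : terminal T u -> u != [::].
Proof. by case: fT => _ [x Tx] _ _ _ [_ n]; case: u n => // /(_ x). Qed.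

Lemma nonterminal_full u y : T u -> ~ terminal T u -> sorted ltn (rcons u y) ->
  T (rcons u y).
Proof.
move=> Tu nu; have /existsNP[x /contrapT Tx] : ~ forall x, ~ T (rcons u x).
  by move=> h; apply: nu.
by case: fT => _ _ _ _ h; exact: h Tx.
Qed.

Lemma init_seg_rcons u x : sorted ltn (rcons u x) ->
  init_seg T (rcons u x) = if `[< T (rcons u x) >] then rcons (init_seg T u) x else init_seg T u.
Proof.
rewrite sorted_rcons_ltn => /andP[su /allP ux]; rewrite /init_seg filter_rcons.
have -> : [seq z <- rcons u x | z <= x] = rcons u x.
  apply/all_filterP; rewrite all_rcons leqnn /=; apply/allP => y /ux /=; exact: ltnW.
have -> // : [seq y <- u | `[< T [seq z <- rcons u x | z <= y] >]] =
          [seq y <- u | `[< T [seq z <- u | z <= y] >]].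
apply: eq_in_filter => y /ux /= yx.
by rewrite filter_rcons (ltn_geF yx).
Qed.

Lemma init_seg_id u : T u -> init_seg T u = u.
Proof.
elim/last_ind: u => [//|u x IH] Tux; rewrite init_seg_rcons; last exact: tree_sorted.
by rewrite asboolT // IH //; exact: tree_rcons Tux.
Qed.

(** By fullness, the longest initial segment in the tree of a sequence outside the
    tree is terminal. *)
Lemma init_seg_cases u : sorted ltn u ->
  T (init_seg T u) /\ (T u \/ terminal T (init_seg T u)).
Proof.
elim/last_ind: u => [_|u x IH sux].
  by split; [exact: tree_nil|left; exact: tree_nil].
have [su _] := andP (etrans (esym (sorted_rcons_ltn u x)) sux).
have [Ts Tu] := IH su; rewrite init_seg_rcons //; case: asboolP => Tux.
  have Tu' := tree_rcons Tux; rewrite init_seg_id //.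
  by split=> //; left.
split=> //; right; case: Tu => // Tu; rewrite init_seg_id // in Ts *.
by apply: contrapT => nu; apply: Tux; apply: nonterminal_full.
Qed.

Lemma init_seg_prefix u : sorted ltn u -> prefix (init_seg T u) u.
Proof.
elim/last_ind: u => [//|u x IH sux]; rewrite init_seg_rcons //.
have [su _] := andP (etrans (esym (sorted_rcons_ltn u x)) sux).
case: asboolP => Tux.
  by rewrite init_seg_id ?prefix_refl //; exact: tree_rcons Tux.
by apply: prefix_trans (IH su) _; rewrite -cats1; exact: prefix_prefix.
Qed.

End Tree.

(** Closeness in the Cantor space. *)
Definition agree N (u v : seq nat) := [seq x <- u | x < N] = [seq x <- v | x < N].

Lemma agree_init_seg T N u v : agree N u v -> agree N (init_seg T u) (init_seg T v).
Proof.
have h w : [seq x <- init_seg T w | x < N] = [seq x <- [seq x <- w | x < N]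
    | `[< T [seq z <- [seq x <- w | x < N] | z <= x] >]].
  rewrite /init_seg -!filter_predI; apply: eq_in_filter => x _ /=.
  case: (ltnP x N) => //= xN; rewrite ?andbT ?andbF //.
  rewrite -filter_predI; congr `[< T _ >]; apply: eq_filter => z /=.
  by case: (leqP z x) => // zx; rewrite /= (leq_ltn_trans zx xN).
by rewrite /agree !h => ->.
Qed.

Lemma agree_map L N u v : incr L -> agree N u v -> agree N (map L u) (map L v).
Proof.
move=> iL e; rewrite /agree !filter_map; congr map.
have h w : [seq x <- w | L x < N] = [seq x <- [seq x <- w | x < N] | L x < N].
  rewrite -filter_predI; apply: eq_filter => x /=.
  case: (ltnP (L x) N) => //= xN; symmetry; exact: leq_ltn_trans (incr_ge iL x) xN.
by rewrite (h u) (h v) e.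
Qed.

Lemma agreeW M N u v : M <= N -> agree N u v -> agree M u v.
Proof.
move=> MN e; have h w : [seq x <- w | x < M] = [seq x <- [seq x <- w | x < N] | x < M].
  rewrite -filter_predI; apply: eq_filter => x /=.
  by case: (ltnP x M) => //= xM; rewrite (leq_trans xM MN).
by rewrite /agree (h u) (h v) e.
Qed.

Lemma agree_big N u v : all (leq N) v -> agree N u (u ++ v).
Proof.
move=> h; rewrite /agree filter_cat.
suff -> : [seq x <- v | x < N] = [::] by rewrite cats0.
apply/eqP; rewrite -[_ == _]negbK -has_filter -all_predC.
by apply: sub_all h => x; rewrite /= -leqNgt.
Qed.

(** Restriction of a tree to the infinite set [range P], reindexed by its
    enumeration [P]. *)
Definition pull (P : nat -> nat) (T : set (seq nat)) : set (seq nat) :=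
  [set u | sorted ltn u /\ T (map P u)].

Lemma pull_full P T : incr P -> full_tree T -> full_tree (pull P T).
Proof.
move=> iP [h1 [x Tx] h3 h4 h5]; split.
- by [].
- exists 0; split=> //=; apply: (h5 [::] x); by [].
- by move=> u [].
- move=> u y [su Tu]; split; first by move: su; rewrite sorted_rcons_ltn => /andP[].
  by move: Tu; rewrite map_rcons; exact: h4.
- move=> u y z [_ Tu] sz; split=> //; move: Tu; rewrite !map_rcons => /h5; apply.
  by rewrite -map_rcons incr_sorted.
Qed.

Lemma pull_ranked P T rk : ranked T rk -> ranked (pull P T) (rk \o map P).
Proof. by move=> h u x [_]; rewrite /= map_rcons; exact: h. Qed.

Lemma pull_terminal P T u : incr P -> full_tree T ->
  terminal (pull P T) u -> terminal T (map P u).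
Proof.
move=> iP fT [[su Tu] n]; split=> // x Tx.
(* Fullness moves the extension [x] to a point of [range P]. *)
pose y := \max_(z <- u) z.+1.
apply: (n y); have sy : sorted ltn (rcons u y).
  rewrite sorted_rcons_ltn su; apply/allP => z zu /=.
  by rewrite /y (leq_bigmax_seq _ zu).
split=> //; rewrite map_rcons; case: fT => _ _ _ _ h; apply: h Tx _.
by rewrite -map_rcons incr_sorted.
Qed.

(** * Comparison of trees by rank *)

(** A ranked tree [T] embeds into any spreading family [S] of at least the same
    rank: [L' r \in S] for all [r \in T] if [L'] grows fast enough.  Fast growth
    costs nothing because [S] is spreading. *)
Section Embed.
Variables (T S : set (seq nat)) (rk rks : seq nat -> omega1).
Hypothesis fT : forall u v, T (u ++ v) -> T u.
Hypothesis sT : forall u, T u -> sorted ltn u.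
Hypothesis rT : ranked T rk.
Hypothesis sS : forall u, S u -> sorted ltn u.
Hypothesis spS : forall u v, S u -> sorted ltn v -> all2 leq u v -> S v.
Hypothesis rS : forall u o, S u -> (o < rks u)%O -> exists m, forall x, m <= x ->
  sorted ltn (rcons u x) -> S (rcons u x) /\ (o <= rks (rcons u x))%O.

Lemma all2_leq_refl u : all2 leq u u.
Proof. by elim: u => //= x u ->; rewrite leqnn. Qed.

Lemma all2_leq_cat u v w : all2 leq v w -> all2 leq (u ++ v) (u ++ w).
Proof. by move=> vw; elim: u => //= x u ->; rewrite leqnn. Qed.

(** By induction on the rank of [u]: a child [rcons u x] has rank below that of
    [v], hence at most that of some child [rcons v m]; any larger [L' x] may
    replace [m] because [S] is spreading, so that the countably many embeddings
    of the subtrees can be combined by taking maxima. *)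
Lemma embed_tree u v : T u -> S v -> (rk u <= rks v)%O ->
  exists L : nat -> nat, forall r L', incr L' -> (forall x, x \in r -> L x <= L' x) ->
    T (u ++ r) -> S (v ++ map L' r).
Proof.
suff h o : forall u v, rk u = o -> T u -> S v -> (rk u <= rks v)%O ->
  exists L : nat -> nat, forall r L', incr L' -> (forall x, x \in r -> L x <= L' x) ->
    T (u ++ r) -> S (v ++ map L' r) by exact: h.
elim/omega1_ind: o => o IH {}u {}v eo Tu Sv uv.
have /choice[g gP] x : exists p : nat * (nat -> nat), T (rcons u x) ->
    all (ltn^~ p.1) v /\ forall r L', incr L' -> (forall x, x \in r -> p.2 x <= L' x) ->
    T (rcons u x ++ r) -> S (rcons v p.1 ++ map L' r).
  have [Tux|n] := pselect (T (rcons u x)); last by exists (0, id).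
  have lt : (rk (rcons u x) < rks v)%O by exact: lt_le_trans (rT Tux) uv.
  have [m mP] := rS Sv lt; pose m' := maxn m (\max_(z <- v) z.+1).
  have vm : all (ltn^~ m') v.
    by apply/allP => z zv; rewrite /= leq_max (leq_bigmax_seq _ zv) // orbT.
  have [|Sm le] := mP m' (leq_maxl _ _); first by rewrite sorted_rcons_ltn sS.
  have lto : (rk (rcons u x) < o)%O by rewrite -eo; exact: rT.
  have [L LP] := IH _ lto _ _ erefl Tux Sm le.
  by exists (m', L).
(* Beyond the image of [y] itself, [L y] must serve the subtrees at all [x < y]. *)
exists (fun y => maxn (g y).1 (\max_(x < y) (g x).2 y)) => -[|x r] L' iL' hL' Tr.
  by rewrite cats0.
have Tx : T (rcons u x) by apply: (fT (v := r)); rewrite cat_rcons.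
have [vg gS] := gP x Tx.
have sr : sorted ltn (x :: r).
  have := sT Tr; rewrite (sorted_pairwise (@ltn_trans)) pairwise_cat => /and3P[_ _].
  by rewrite -(sorted_pairwise (@ltn_trans)).
have xr y : y \in r -> x < y.
  by move=> yr; move: sr => /= /(order_path_min (@ltn_trans))/allP/(_ _ yr).
have S1 : S (rcons v (g x).1 ++ map L' r).
  apply: gS => //; last by rewrite cat_rcons.
  move=> y yr; apply: leq_trans (hL' y _); last by rewrite inE yr orbT.
  by rewrite leq_max; apply/orP; right; apply: (leq_bigmax (Ordinal (xr y yr))).
have gx : (g x).1 <= L' x.
  by apply: leq_trans (hL' x (mem_head _ _)); rewrite leq_maxl.
apply: spS S1 _ _.
  have sw : sorted ltn (map L' (x :: r)) by rewrite incr_sorted.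
  have := sS Sv; move: sw; rewrite !(sorted_pairwise (@ltn_trans)) pairwise_cat.
  move=> -> ->; rewrite !andbT; apply/allrelP => y z yv zr /=.
  apply: leq_trans (allP vg y yv) _; apply: leq_trans gx _.
  move: zr => /mapP[z' + ->]; rewrite incr_leq // inE => /orP[/eqP->//|/xr/ltnW//].
rewrite cat_rcons; apply: all2_leq_cat; rewrite /= gx; exact: all2_leq_refl.
Qed.
End Embed.

Lemma tree_ind (T : set (seq nat)) rk (Pr : seq nat -> Prop) : ranked T rk ->
  (forall u, terminal T u -> Pr u) ->
  (forall u, T u -> ~ terminal T u -> (forall x, T (rcons u x) -> Pr (rcons u x)) -> Pr u) ->
  forall u, T u -> Pr u.
Proof.
move=> rT ht hn u; move e: (rk u) => o; elim/omega1_ind: o u e => o IH u e Tu.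
have [/ht//|nu] := pselect (terminal T u).
apply: hn => // x Tx; apply: (IH (rk (rcons u x))) => //.
by rewrite -e; exact: rT.
Qed.

(** * Finite sets as increasing sequences *)

Definition fs (u : seq nat) : {fset nat} := [fset x in u]%fset.

Lemma in_fs u x : (x \in fs u) = (x \in u).
Proof. by rewrite !inE. Qed.

Lemma sort_fs u : sorted ltn u -> sort leq (fs u) = u.
Proof.
move=> su; apply: (sorted_eq leq_trans anti_leq).
- by apply: sort_sorted; exact: leq_total.
- exact: sorted_ltn_leq.
rewrite perm_sort; apply: uniq_perm; first exact: fset_uniq.
  exact: sorted_ltn_uniq.
by move=> x; rewrite in_fs.
Qed.

Lemma sort_fset_sorted (s : {fset nat}) : sorted ltn (sort leq s).
Proof.
by rewrite ltn_sorted_uniq_leq sort_uniq fset_uniq sort_sorted //; exact: leq_total.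
Qed.

Lemma fs_sort (s : {fset nat}) : fs (sort leq s) = s.
Proof. by apply/fsetP => x; rewrite in_fs mem_sort. Qed.

Lemma fset_nth_fs u k : sorted ltn u -> fset_nth (fs u) k = nth 0 u k.
Proof. by move=> su; rewrite /fset_nth sort_fs. Qed.

Lemma size_sort_fset (s : {fset nat}) : size (sort leq s) = #|` s|%fset.
Proof. by rewrite size_sort. Qed.

Lemma card_fs u : sorted ltn u -> #|` fs u|%fset = size u.
Proof. by move=> su; rewrite -size_sort_fset sort_fs. Qed.

Lemma fs_nil : fs [::] = fset0.
Proof. by apply/fsetP => x; rewrite in_fs inE. Qed.

Lemma sorted_nth_le u i j : sorted ltn u -> i <= j -> j < size u -> nth 0 u i <= nth 0 u j.
Proof.
move=> su ij ju; move: ij; rewrite leq_eqVlt => /orP[/eqP->//|ij].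
by apply/ltnW/(sorted_ltn_nth ltn_trans 0 su); rewrite ?inE //; exact: ltn_trans ju.
Qed.

Lemma subset_nth_le c a i : sorted ltn c -> sorted ltn a -> {subset a <= c} ->
  i < size a -> nth 0 c i <= nth 0 a i.
Proof.
move=> sc sa ac ia; have cai := ac _ (mem_nth 0 ia).
have jc : index (nth 0 a i) c < size c by rewrite index_mem.
have ce := nth_index 0 cai; set j := index _ c in jc ce.
rewrite -ce; apply: sorted_nth_le => //.
rewrite -ltnS -(size_takel ia) -(size_takel jc).
apply: uniq_leq_size; first exact/take_uniq/sorted_ltn_uniq.
move=> x xa; have xc := ac _ (mem_take xa).
have /(nthP 0)[p pa xe] := xa; rewrite size_takel // in pa.
rewrite nth_take // in xe.
have xle : x <= nth 0 c j.
  by rewrite ce -xe; apply: sorted_nth_le.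
have qc : index x c < size c by rewrite index_mem.
have qe := nth_index 0 xc; rewrite -qe.
rewrite -(@nth_take j.+1); last first.
  rewrite ltnS leqNgt; apply/negP => jq; move: xle; rewrite leqNgt -qe.
  by rewrite (sorted_ltn_nth ltn_trans 0 sc).
apply: mem_nth; rewrite size_takel // ltnS leqNgt; apply/negP => jq; move: xle.
by rewrite leqNgt -qe (sorted_ltn_nth ltn_trans 0 sc).
Qed.

(** * Ranks of spreading families *)
Section Rank.
Variables (G : nat_family) (rho : {fset nat} -> omega1).
Hypotheses (hG : hereditary_family G) (spG : spreading_family G).
Hypothesis rkG : is_rank G rho.

Let rank_set t := [set omega1_succ (rho s) | s in [set s | G s /\ (t `<` s)%fset]].

Lemma rank_set_countable t : countable (rank_set t).
Proof. by apply: card_le_trans (card_image_le _ _) (countableP _). Qed.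

Lemma rank_lt t s : G s -> (t `<` s)%fset -> (rho s < rho t)%O.
Proof.
move=> Gs ts; rewrite -omega1_succP (rkG t).
by have [h _] := omega1_supP (rank_set_countable t); apply: h; exists s.
Qed.

Lemma rank_le t s : G s -> (t `<=` s)%fset -> (rho s <= rho t)%O.
Proof.
move=> Gs; rewrite fsubEproper => /orP[/eqP->//|ts].
exact/ltW/rank_lt.
Qed.

Lemma rank_leP t o : (forall s, G s -> (t `<` s)%fset -> (rho s < o)%O) -> (rho t <= o)%O.
Proof.
move=> h; rewrite (rkG t); have [_ l] := omega1_supP (rank_set_countable t).
by apply: l => _ [s [Gs ts] <-]; rewrite omega1_succP; exact: h.
Qed.

Lemma rank_gt t o : (o < rho t)%O -> exists s, [/\ G s, (t `<` s)%fset & (o <= rho s)%O].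
Proof.
move=> ot; apply: contrapT => n; move: ot; rewrite ltNge => /negP; apply.
apply: rank_leP => s Gs ts; rewrite ltNge; apply/negP => os; apply: n.
by exists s.
Qed.

Lemma spread_fs a b : sorted ltn a -> sorted ltn b -> size a = size b ->
  (forall i, i < size a -> nth 0 a i <= nth 0 b i) -> G (fs a) -> G (fs b).
Proof.
move=> sa sb ab h Ga; apply: (spG Ga); first by rewrite !card_fs.
by move=> i; rewrite card_fs // => ia; rewrite !fset_nth_fs //; exact: h.
Qed.

(** Any superset of [a] is pointwise below some superset of [b] of the same size,
    obtained by sending the remaining elements beyond everything else. *)
Lemma spread_rank a b : sorted ltn a -> sorted ltn b -> size a = size b ->
  (forall i, i < size a -> nth 0 a i <= nth 0 b i) -> (rho (fs a) <= rho (fs b))%O.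
Proof.
move e: (rho (fs a)) => o; elim/omega1_ind: o a b e => o IH a b eo sa sb ab h.
rewrite -eo; apply: rank_leP => s Gs as_.
pose c := sort leq s; have sc : sorted ltn c := sort_fset_sorted s.
have ac : {subset a <= c}.
  move=> x xa; rewrite mem_sort; move/fproper_sub/fsubsetP: as_; apply.
  by rewrite in_fs.
have sac : size a < size c.
  by rewrite size_sort_fset -(card_fs sa); exact: fproper_ltn_card.
pose D := (foldr maxn 0 (b ++ c)).+1.
have hD x : x \in b ++ c -> x < D.
  rewrite /D ltnS; elim: (b ++ c) => //= y w IHw.
  by rewrite inE leq_max => /orP[/eqP->|/IHw->]; rewrite ?leqnn ?orbT.
pose d := b ++ iota D (size c - size a).
have szd : size d = size c by rewrite size_cat size_iota -ab subnKC // ltnW.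
have sd : sorted ltn d.
  have := iota_ltn_sorted D (size c - size a); move: sb.
  rewrite /d !(sorted_pairwise ltn_trans) pairwise_cat => -> ->; rewrite !andbT.
  apply/allrelP => x y xb; rewrite mem_iota => /andP[Dy _].
  by apply: leq_trans Dy; apply: hD; rewrite mem_cat xb.
have cd i : i < size c -> nth 0 c i <= nth 0 d i.
  move=> ic; rewrite /d nth_cat -ab; case: ltnP => ia.
    exact: leq_trans (subset_nth_le sc sa ac ia) (h i ia).
  rewrite nth_iota; last by lia.
  apply: leq_trans (leq_addr _ _); apply/ltnW/hD.
  by rewrite mem_cat mem_nth ?orbT.
have Gd : G (fs d) by apply: (@spread_fs c) => //; rewrite fs_sort.
have lt : (rho s < o)%O by rewrite -eo; exact: rank_lt.
apply: (@le_lt_trans _ _ (rho (fs d))).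
  exact: IH (rho s) lt c d (congr1 rho (fs_sort s)) sc sd (esym szd) cd.
apply: rank_lt => //; rewrite fproperEcard; apply/andP; split.
  by apply/fsubsetP => x; rewrite !in_fs mem_cat => ->.
by rewrite !card_fs // szd -ab.
Qed.

(** Ranks over supersets and over one-point end extensions agree for spreading
    families: a point of [t] outside [u] may be moved to any later position. *)
Lemma rank_grow u t : sorted ltn u -> G t -> (fs u `<` t)%fset ->
  exists y, forall x, y <= x -> sorted ltn (rcons u x) ->
    G (fs (rcons u x)) /\ (rho t <= rho (fs (rcons u x)))%O.
Proof.
move=> su Gt ut; have /fsubsetPn[y yt yu] : ~~ (t `<=` fs u)%fset.
  by move: ut; rewrite fproperE => /andP[].
exists y => x yx sux; pose s := (y |` fs u)%fset.
have st : (s `<=` t)%fset.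
  by rewrite fsubUset fsub1set yt fproper_sub.
have Gs : G s := hG Gt st.
pose c := sort leq s; have sc : sorted ltn c := sort_fset_sorted s.
have cx : size c = size (rcons u x).
  by rewrite size_sort_fset cardfsU1 yu card_fs // size_rcons.
have le i : i < size c -> nth 0 c i <= nth 0 (rcons u x) i.
  move=> ic; rewrite nth_rcons; case: ltnP => iu.
    apply: subset_nth_le => // z zu; rewrite mem_sort.
    by rewrite in_fset1U in_fs zu orbT.
  have -> : i == size u by rewrite eqn_leq iu -ltnS -(size_rcons u x) -cx ic.
  have : nth 0 c i \in s by rewrite -(mem_sort leq) mem_nth.
  rewrite in_fset1U in_fs => /orP[/eqP->//|zu].
  move: sux; rewrite sorted_rcons_ltn => /andP[_ /allP/(_ _ zu)] /=.
  exact: ltnW.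
have sG : fs c = s := fs_sort s.
split; first by apply: (spread_fs sc sux cx le); rewrite sG.
apply: le_trans (spread_rank sc sux cx le); rewrite sG.
exact: rank_le.
Qed.

Definition stree : set (seq nat) := [set u | sorted ltn u /\ G (fs u)].

Lemma stree_prefix u v : stree (u ++ v) -> stree u.
Proof.
move=> [s Gs]; split.
  by move: s; rewrite !(sorted_pairwise ltn_trans) pairwise_cat => /and3P[].
by apply: hG Gs _; apply/fsubsetP => x; rewrite !in_fs mem_cat => ->.
Qed.

Lemma stree_spread u v : stree u -> sorted ltn v -> all2 leq u v -> stree v.
Proof.
move=> [su Gu] sv uv; split=> //.
have [suv h] : size u = size v /\ forall i, i < size u -> nth 0 u i <= nth 0 v i.
  elim: u v uv {su Gu sv} => [|x u IH] [|y v] //= /andP[xy /IH[-> h]].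
  by split=> // -[|i] //=; exact: h.
exact: (spread_fs su sv suv h).
Qed.

Lemma stree_rank u o : stree u -> (o < rho (fs u))%O -> exists m, forall x, m <= x ->
  sorted ltn (rcons u x) -> stree (rcons u x) /\ (o <= rho (fs (rcons u x)))%O.
Proof.
move=> [su Gu] /rank_gt[t [Gt ut ot]].
have [m hm] := rank_grow su Gt ut; exists m => x mx sx.
by have [h1 h2] := hm x mx sx; split; [split|exact: le_trans h2].
Qed.

Lemma fproper_rcons u x : sorted ltn (rcons u x) -> (fs u `<` fs (rcons u x))%fset.
Proof.
move=> sx; have su : sorted ltn u by move: sx; rewrite sorted_rcons_ltn => /andP[].
rewrite fproperEcard !card_fs // size_rcons leqnn andbT.
by apply/fsubsetP => z; rewrite !in_fs mem_rcons inE => ->; rewrite orbT.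
Qed.

Lemma stree_ranked : ranked stree (rho \o fs).
Proof. by move=> u x [sx Gx]; apply: rank_lt => //; exact: fproper_rcons. Qed.

Lemma in_down_closure s : G s -> down_closure (maximal_elements G) s.
Proof.
move e: (rho s) => o; elim/omega1_ind: o s e => o IH s e Gs.
have [ms|] := pselect (forall t, G t -> (s `<=` t)%fset -> t = s).
  by exists s; rewrite ?fsubset_refl.
move=> /existsNP[t /not_implyP[Gt /not_implyP[st ts]]].
have {}st : (s `<` t)%fset.
  by rewrite fproperEneq st andbT; apply/eqP => e'; apply: ts.
have [|//|t' Ft' tt'] := IH (rho t) _ t erefl; first by rewrite -e; exact: rank_lt.
by exists t' => //; apply: fsubset_trans tt'; exact: fproper_sub.
Qed.

(** A nonmaximal member of [G] can be extended by all sufficiently large points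
    ([rank_grow]); the range of [M] is diagonal for the thresholds. *)
Lemma sparse_full (A : set nat) : cofinal A -> (omega1_zero < rho fset0)%O ->
  exists M, [/\ incr M, forall i, A (M i), full_tree (pull M stree) &
    forall u, terminal (pull M stree) u -> maximal_elements G (fs (map M u))].
Proof.
move=> cA r0.
pose nonmax u := exists2 t, G t & (fs u `<` t)%fset.
have step u C : cofinal C -> exists B, [/\ cofinal B, B `<=` C &
    stree u -> nonmax u -> forall x, B x -> all (ltn^~ x) u -> stree (rcons u x)].
  move=> cC; have [[[su Gu] [t Gt ut]]|n] := pselect (stree u /\ nonmax u); last first.
    by exists C; split=> // h1 h2; case: n.
  have [y hy] := rank_grow su Gt ut.
  exists (C `&` [set m | y < m]); split; first exact: cofinal_above.
    by move=> x [].
  move=> _ _ x [_ /= yx] ux; have sx : sorted ltn (rcons u x).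
    by rewrite sorted_rcons_ltn su.
  by have [] := hy x (ltnW yx) sx.
have [B0 [cB0 B0A hB0]] := step [::] A cA.
have [||M [iM BM QM]] := @fusion (fun m B => forall u, u \in subseqs_below m.+1 ->
  stree u -> nonmax u -> forall x, B x -> all (ltn^~ x) u -> stree (rcons u x)) B0 _ _ cB0.
- by move=> m B C BC h u um su nu x /BC; exact: h.
- move=> m C cC CB0; apply: (@dense_finite _ (fun u B => stree u -> nonmax u ->
    forall x, B x -> all (ltn^~ x) u -> stree (rcons u x)) _ setT) => //.
  + by move=> u B D BD h su nu x /BD; exact: h.
  + by move=> u D cD _; exact: step.
have grow u i : sorted ltn (rcons u i) -> stree (map M u) -> nonmax (map M u) ->
    stree (map M (rcons u i)).
  move=> sui su nu; rewrite map_rcons.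
  have ui : all (ltn^~ (M i)) (map M u).
    rewrite all_map; move: sui; rewrite sorted_rcons_ltn => /andP[_].
    by apply: sub_all => x /= xi; rewrite incr_ltn.
  case/lastP: u su nu ui sui => [|u j] su nu ui sui; first by apply: hB0.
  have ji : j < i by move: sui; rewrite sorted_rcons_ltn all_rcons => /and3P[].
  apply: (QM j) => //; last by exists i.
  have sMu : sorted ltn (rcons (map M u) (M j)) by rewrite -map_rcons; case: su.
  rewrite map_rcons; apply: mem_subseqs_below => //.
  move: sMu; rewrite sorted_rcons_ltn all_rcons /= ltnSn => /andP[_].
  by apply: sub_all => x /= /ltnW.
have [t0 [Gt0 t00 _]] := rank_gt r0.
have G0 : stree [::] by split=> //; rewrite fs_nil; apply: hG Gt0 _; exact: fsub0set.
have nm0 : nonmax [::] by exists t0 => //; rewrite fs_nil.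
exists M; split=> //; first by move=> i; apply: B0A.
  split.
  - by split=> //; case: G0.
  - by exists 0; split=> //; exact: (@grow [::] 0).
  - by move=> u [].
  - move=> u x [sx]; rewrite map_rcons -cats1 => /stree_prefix Su; split=> //.
    by move: sx; rewrite sorted_rcons_ltn => /andP[].
  - move=> u x y [sx Sx] sy; split=> //; apply: grow => //.
      by move: Sx; rewrite map_rcons -cats1 => /stree_prefix.
    exists (fs (map M (rcons u x))); first by case: Sx.
    by rewrite map_rcons; apply: fproper_rcons; rewrite -map_rcons incr_sorted.
move=> u [[su Su] nu]; split; first by case: Su.
move=> t Gt; rewrite fsubEproper => /orP[/eqP//|ut]; exfalso.
pose y := \max_(z <- u) z.+1.
have sy : sorted ltn (rcons u y).
  rewrite sorted_rcons_ltn su; apply/allP => z zu /=.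
  by rewrite /y (leq_bigmax_seq _ zu).
apply: (nu y); split=> //; apply: grow => //.
by exists t.
Qed.

End Rank.

Import numFieldNormedType.Exports.
Local Open Scope ring_scope.

(** * Norming and separating functionals *)
Section HahnBanach.
Variables (R : realType) (X : lmodType R).

Definition sublinear (p : X -> R) :=
  (forall x y, p (x + y) <= p x + p y) /\
  (forall t x, 0 < t -> p (t *: x) = t * p x).

Lemma sublinear0 p : sublinear p -> p 0 = 0.
Proof.
move=> [_ h]; have := h 2 0 (ltr0n _ 2); rewrite scaler0; lra.
Qed.

Lemma sublinear_opp p x : sublinear p -> - p (- x) <= p x.
Proof.
move=> sp; have [h _] := sp; have := h x (- x).
by rewrite subrr (sublinear0 sp); lra.
Qed.

Definition finf (S : set (X -> R)) (x : X) : R := inf [set g x | g in S].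

Section Inf.
Variables (S : set (X -> R)) (b : X -> R).
Hypothesis S0 : S !=set0.
Hypothesis Sb : forall g x, S g -> b x <= g x.

Lemma finf_le g x : S g -> finf S x <= g x.
Proof.
move=> Sg; apply: ge_inf; last by exists g.
by exists (b x) => _ [h Sh <-]; exact: Sb.
Qed.

Lemma finf_adh x e : 0 < e -> exists2 g, S g & g x < finf S x + e.
Proof.
move=> e0; have [|_ [g Sg <-] ?] := @inf_adherent _ [set g x | g in S] e e0.
  split; first by case: S0 => g Sg; exists (g x), g.
  by exists (b x) => _ [h Sh <-]; exact: Sb.
by exists g.
Qed.

(** This covers the three infima needed below: over a chain of sublinear
    functionals, over the translates in direction [y], and over a cone. *)
Lemma sublinear_finf :
  (forall g h x y, S g -> S h -> exists2 k, S k & k (x + y) <= g x + h y) ->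
  (forall g t x, S g -> 0 < t -> exists2 k, S k & k (t *: x) <= t * g x) ->
  sublinear (finf S).
Proof.
move=> hD hZ.
have le t x : 0 < t -> finf S (t *: x) <= t * finf S x.
  move=> t0; apply/ler_addgt0Pl => e e0.
  have [g Sg gx] := finf_adh x (divr_gt0 e0 t0).
  have [k Sk kx] := hZ g t x Sg t0.
  apply: le_trans (finf_le _ Sk) _; apply: le_trans kx _.
  by rewrite addrC -ler_pdivlMl // mulrDr mulKf ?gt_eqF // mulrC ltW.
split=> [x y|t x t0].
  apply/ler_addgt0Pl => e e0; have e2 : 0 < e / 2 by lra.
  have [g Sg gx] := finf_adh x e2; have [h Sh hy] := finf_adh y e2.
  have [k Sk kx] := hD g h x y Sg Sh.
  by apply: le_trans (finf_le _ Sk) _; lra.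
apply/eqP; rewrite eq_le le //=.
have := le t^-1 (t *: x); rewrite invr_gt0 => /(_ t0).
by rewrite scalerA mulVf ?gt_eqF // scale1r ler_pdivlMl.
Qed.
End Inf.

(** A minimal sublinear functional [q] is additive, because the functional
    [x |-> inf_(t > 0) (q (x + t y) - t q y)] is sublinear and below [q]. *)
Lemma hahn_banach (p : X -> R) : sublinear p ->
  exists f : {linear X -> R^o}, forall x, (f x : R) <= p x.
Proof.
move=> sp.
pose T := {q : X -> R | sublinear q /\ forall x, q x <= p x}.
pose Rr (q r : T) := `[< forall x, sval r x <= sval q x >].
have [| | | |[q [sq qp]] qmax] := @Zorn T Rr.
- by move=> t; apply/asboolP.
- by move=> r s t /asboolP rs /asboolP st; apply/asboolP => x; exact: le_trans (rs x).
- move=> [s hs] [t ht] /asboolP /= st /asboolP /= ts; apply: eq_exist => /=.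
  by apply/funext => x; apply/eqP; rewrite eq_le st ts.
- move=> A tA; have [[q0 Aq0]|nA] := pselect (A !=set0); last first.
    by exists (exist _ p (conj sp (fun x => lexx _))) => s As; case: nA; exists s.
  pose S := [set sval q | q in A].
  have Sb g x : S g -> - p (- x) <= g x.
    move=> [[r [sr rp]] Ar <-] /=; apply: le_trans (sublinear_opp x sr).
    by rewrite lerN2.
  have S0 : S !=set0 by exists (sval q0), q0.
  have sS : sublinear (finf S).
    apply: (sublinear_finf S0 Sb).
      move=> _ _ x y [g Ag <-] [h Ah <-].
      have [/asboolP gh|/asboolP gh] := tA _ _ Ag Ah.
        exists (sval h); first by exists h.
        by apply: le_trans ((svalP h).1.1 x y) _; rewrite lerD2r.
      exists (sval g); first by exists g.
      by apply: le_trans ((svalP g).1.1 x y) _; rewrite lerD2l.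
    move=> _ t x [g Ag <-] t0; exists (sval g); first by exists g.
    by rewrite (svalP g).1.2.
  have Sp x : finf S x <= p x.
    apply: le_trans (finf_le Sb (g := sval q0) _ _) _; first by exists q0.
    exact: (svalP q0).2.
  exists (exist (fun q => sublinear q /\ forall x, q x <= p x) _ (conj sS Sp)).
  move=> s As; apply/asboolP => x /=.
  by apply: (finf_le Sb); exists s.
have qmin r : sublinear r -> (forall x, r x <= q x) -> r = q.
  move=> sr rq.
  have rp x : r x <= p x by exact: le_trans (rq x) _.
  have := qmax (exist _ r (conj sr rp)).
  move=> /(_ (introT (asboolP _) rq)) e.
  exact: (congr1 sval e).
have addge x y : q x + q y <= q (x + y).
  pose S := [set (fun x => q (x + t *: y) - t * q y) | t in [set t | 0 < t]].
  have Sb g z : S g -> - q (- z) <= g z.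
    move=> [t /= t0 <-]; have := sq.1 (z + t *: y) (- z).
    by rewrite addrAC subrr add0r sq.2 //; lra.
  have S0 : S !=set0 by exists (fun x => q (x + 1 *: y) - 1 * q y), 1 => /=.
  have sS : sublinear (finf S).
    apply: (sublinear_finf S0 Sb).
      move=> _ _ u v [s /= s0 <-] [t /= t0 <-].
      exists (fun x => q (x + (s + t) *: y) - (s + t) * q y).
        by exists (s + t) => //=; lra.
      have := sq.1 (u + s *: y) (v + t *: y).
      by rewrite addrACA -scalerDl; lra.
    move=> _ t u [s /= s0 <-] t0.
    exists (fun x => q (x + (t * s) *: y) - (t * s) * q y).
      by exists (t * s) => //=; rewrite mulr_gt0.
    by rewrite -scalerA -scalerDr sq.2 // mulrBr mulrA.
  have Sq : finf S = q.
    apply: qmin => // z; have := finf_le Sb z (ex_intro2 _ _ 1 (@ltr01 R) erefl).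
    by move=> /le_trans; apply; have := sq.1 z (1 *: y); rewrite (sq.2 1) //; lra.
  have := finf_le Sb x (ex_intro2 _ _ 1 (@ltr01 R) erefl).
  by rewrite Sq /= scale1r; lra.
have qD x y : q (x + y) = q x + q y by apply/eqP; rewrite eq_le sq.1 addge.
have q0 := sublinear0 sq.
have qN x : q (- x) = - q x by have := qD x (- x); rewrite subrr q0; lra.
have lq : linear (q : X -> R^o).
  move=> a x y; rewrite qD; congr (_ + _).
  have [a0|a0|->] := ltgtP a 0; last by rewrite !scale0r q0.
    rewrite -[a]opprK scaleNr qN sq.2 ?oppr_gt0 //.
    by rewrite scaleNr.
  by rewrite sq.2.
pose f : {linear X -> R^o} := HB.pack (q : X -> R^o) (GRing.isLinear.Build R X R^o *:%R q lq).
by exists f.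
Qed.
End HahnBanach.

Section Functionals.
Variables (R : realType) (X : completeNormedModType R).

Definition contractive (f : dual X) := forall x, dual_fun f x <= `|x|.

Lemma dualD (f : dual X) x y : dual_fun f (x + y) = dual_fun f x + dual_fun f y :> R.
Proof. by case: f => f cf; rewrite /dual_fun /= linearD. Qed.
Lemma dualZ (f : dual X) a x : dual_fun f (a *: x) = a * dual_fun f x :> R.
Proof. by case: f => f cf; rewrite /dual_fun /= linearZ. Qed.
Lemma dual0 (f : dual X) : dual_fun f 0 = 0 :> R.
Proof. by case: f => f cf; rewrite /dual_fun /= linear0. Qed.
Lemma dualN (f : dual X) x : dual_fun f (- x) = - dual_fun f x :> R.
Proof. by rewrite -scaleN1r dualZ mulN1r. Qed.
Lemma dual_sum (f : dual X) I (r : seq I) P (F : I -> X) :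
  dual_fun f (\sum_(i <- r | P i) F i) = \sum_(i <- r | P i) dual_fun f (F i) :> R.
Proof. by case: f => f cf; rewrite /dual_fun /= linear_sum. Qed.

Lemma dual_bounded (f : dual X) : exists2 C : R, 0 < C &
  forall x, `|dual_fun f x : R| <= C * `|x|.
Proof.
case: f => f cf; rewrite /dual_fun /=.
have /linear_boundedP := continuous_linear_bounded 0 (cf 0).
by move=> /pinfty_ex_gt0[C C0 h]; exists C.
Qed.

Lemma mk_contractive (f : {linear X -> R^o}) : (forall x, (f x : R) <= `|x|) ->
  exists2 g : dual X, contractive g & forall x, dual_fun g x = f x.
Proof.
move=> fn.
have fa x : `|f x| <= `|x|.
  suff : `|f x : R| <= `|x| by [].
  by rewrite ler_norml fn andbT lerNl; have := fn (- x); rewrite linearN normrN.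
suff cf : continuous (f : X -> R^o) by exists (exist _ f cf).
apply/linear_bounded_continuous/linear_boundedP.
near=> r => x; move: (fa x) => /le_trans; apply.
by rewrite ler_peMl //; near: r; apply: nbhs_pinfty_ge; rewrite num_real.
Unshelve. all: by end_near. Qed.

(** Hahn-Banach for the sublinear functional [x |-> inf (|x + c| - s)], the
    infimum being over [K c s]. *)
Lemma separation (K : X -> R -> Prop) : K 0 0 ->
  (forall c s d t, K c s -> K d t -> K (c + d) (s + t)) ->
  (forall c s t, K c s -> 0 < t -> K (t *: c) (t * s)) ->
  (forall c s, K c s -> s <= `|c|) ->
  exists2 f : dual X, contractive f & forall c s, K c s -> s <= dual_fun f c.
Proof.
move=> K0 KD KZ Kn.
pose S := [set g | exists c s, K c s /\ g = (fun x : X => `|x + c| - s)].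
have S0 : S !=set0 by exists (fun x : X => `|x + 0| - 0), 0, 0.
have Sb g x : S g -> - `|x| <= g x.
  move=> [c [s [Kc ->]]]; have := Kn _ _ Kc.
  have := ler_normB (x + c) x; rewrite addrAC subrr add0r; lra.
have sS : sublinear (finf S).
  apply: (sublinear_finf S0 Sb).
    move=> _ _ x y [c [s [Kc ->]]] [d [t [Kd ->]]].
    exists (fun x => `|x + (c + d)| - (s + t)).
      by exists (c + d), (s + t); split=> //; exact: KD.
    have := ler_normD (x + c) (y + d); rewrite addrACA; lra.
  move=> _ t x [c [s [Kc ->]]] t0; exists (fun x => `|x + t *: c| - t * s).
    by exists (t *: c), (t * s); split=> //; exact: KZ.
  by rewrite -scalerDr normrZ gtr0_norm // mulrBr.
have [f fS] := hahn_banach sS.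
have [|g cg gf] := @mk_contractive f.
  move=> x; apply: le_trans (fS x) _.
  have := finf_le Sb x (ex_intro _ 0 (ex_intro _ 0 (conj K0 erefl))).
  by rewrite addr0 subr0.
exists g => // c s Kc; rewrite gf -lerN2 -linearN; apply: le_trans (fS (- c)) _.
have := finf_le Sb (- c) (ex_intro _ c (ex_intro _ s (conj Kc erefl))).
by rewrite addNr normr0 sub0r.
Qed.

Lemma norming (x : X) : exists2 f : dual X, contractive f & dual_fun f x = `|x| :> R.
Proof.
have [||||f cf fK] := @separation (fun c s => exists2 t, 0 <= t & c = t *: x /\ s = t * `|x|).
- by exists 0 => //; rewrite scale0r mul0r.
- move=> _ _ _ _ [t t0 [-> ->]] [s s0 [-> ->]]; exists (t + s); first exact: addr_ge0.
  by rewrite scalerDl mulrDl.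
- move=> _ _ s [t t0 [-> ->]] s0; exists (s * t); first by rewrite mulr_ge0 // ltW.
  by rewrite scalerA mulrA.
- by move=> _ _ [t t0 [-> ->]]; rewrite normrZ ger0_norm.
exists f => //; apply/eqP; rewrite eq_le cf /=; apply: fK; exists 1 => //.
by rewrite scale1r mul1r.
Qed.

(** The pairs [(\sum_i t_i d_i, e * \sum_i t_i)] with finitely many nonzero
    [t_i >= 0]. *)
Inductive cone (d : nat -> X) (e : R) : X -> R -> Prop :=
| cone0 : cone d e 0 0
| coneD c s i t : cone d e c s -> 0 <= t -> cone d e (c + t *: d i) (s + t * e).

(** Mazur's lemma in dual form.  If no [i1] were good, the cone spanned by the
    [d i] with [i0 <= i] would stay away from the origin, and one functional would
    be at least [e] on all these [d i]. *)
Lemma weakly_null_gap (d : nat -> X) (i0 : nat) (e : R) : 0 < e ->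
  (forall f : dual X, contractive f -> exists2 i, (i0 <= i)%N & dual_fun f (d i) < e) ->
  exists2 i1, (i0 < i1)%N & forall f : dual X, contractive f ->
    exists2 i, (i0 <= i < i1)%N & dual_fun f (d i) < e.
Proof.
move=> e0 wd; apply: contrapT => no.
have bad i1 : exists2 f : dual X, contractive f &
    forall i, (i0 <= i < i1)%N -> e <= dual_fun f (d i).
  apply: contrapT => nf; apply: no; exists (maxn i1 i0.+1); first by rewrite leq_max ltnSn orbT.
  move=> f cf; apply: contrapT => ni; apply: nf; exists f => // i /andP[ii0 ii1].
  rewrite leNgt; apply/negP => lt; apply: ni; exists i => //.
  by rewrite ii0 leq_max ii1.
pose d' i := d (i0 + i)%N.
have coneDD c s c' s' : cone d' e c s -> cone d' e c' s' -> cone d' e (c + c') (s + s').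
  move=> h; elim=> [|? ? i t _ IH t0]; first by rewrite !addr0.
  by rewrite !addrA; exact: coneD.
have coneZ c s t : cone d' e c s -> 0 < t -> cone d' e (t *: c) (t * s).
  move=> h t0; elim: h => [|? ? i r _ IH r0]; first by rewrite scaler0 mulr0; exact: cone0.
  rewrite scalerDr mulrDr scalerA mulrA; apply: coneD => //.
  by rewrite mulr_ge0 // ltW.
have conen c s : cone d' e c s -> s <= `|c|.
  suff h : cone d' e c s -> exists n, forall f : dual X,
      (forall i, (i0 <= i < n)%N -> e <= dual_fun f (d i)) -> s <= dual_fun f c.
    by move=> /h[n hn]; have [f cf /hn] := bad n; move=> /le_trans; apply; exact: cf.
  elim=> [|c' s' i t _ [n IH] t0]; first by exists 0%N => f _; rewrite dual0.
  exists (maxn n (i0 + i).+1) => f hf; rewrite dualD dualZ; apply: lerD.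
    by apply: IH => j /andP[j0 jn]; apply: hf; rewrite j0 leq_max jn.
  by apply: ler_wpM2l => //; apply: hf; rewrite leq_addr leq_max ltnSn orbT.
have [f cf fK] := separation (cone0 d' e) coneDD coneZ conen.
have [i ii0] := wd f cf; apply/negP; rewrite -leNgt.
have := fK _ _ (coneD (i - i0)%N (cone0 d' e) (@ler01 R)).
by rewrite !add0r mul1r scale1r /d' subnKC.
Qed.
End Functionals.

(** * Weak continuity on families of finite sets *)

Lemma nbhs_cantor (x : cantor_space) (A : set cantor_space) :
  nbhs x A <-> exists N, forall y, (forall i, (i < N)%N -> y i = x i) -> A y.
Proof.
split; last first.
  move=> [N hN]; apply: filterS hN _.
  have h M : nbhs x [set y : cantor_space | forall i, (i < M)%N -> y i = x i].
    elim: M => [|M IH]; first by apply: filterS filterT => y _ i.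
    have := @proj_continuous nat (fun _ => bool) M x [set x M] (discrete_set1 _).
    move=> hM; apply: filterS (filterI IH hM) => y [/= h1 h2] i.
    by rewrite ltnS leq_eqVlt => /orP[/eqP->|/h1].
  exact: h.
pose F : set_system (forall _ : nat, bool) :=
  filter_from setT (fun N => [set y | forall i, (i < N)%N -> y i = x i]).
have FF : Filter F.
  apply: filter_from_filter; first by exists 0%N.
  move=> M N _ _; exists (maxn M N) => // y /= h; split=> i iM; apply: h.
    by rewrite leq_max iM.
  by rewrite leq_max iM orbT.
have : F --> (x : product_topology_def (fun _ : nat => bool)).
  apply/cvg_sup => i B [_ [[C oC <-] Cx] CB].
  exists i.+1 => // y /= h; apply: CB => /=.
  by rewrite h.
by move=> /(_ A) FA /FA [N _ hN]; exists N => y h; exact: hN.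
Qed.

Lemma within_weakP (R : realType) (X : completeNormedModType R)
  (A : nat_family) (phi : cantor_space -> weak_space X) :
  {within char_fset @` A, continuous phi} <->
  forall s (f : dual X) (e : R), A s -> 0 < e -> exists N, forall s', A s' ->
    (forall i, (i < N)%N -> (i \in s') = (i \in s)) ->
    `|dual_fun f (phi (char_fset s')) - dual_fun f (phi (char_fset s)) : R| < e.
Proof.
rewrite subspace_continuousP; split=> [cphi s f e As e0|h].
- have Is : (char_fset @` A) (char_fset s) by exists s.
  have fcs : (dual_fun f \o phi) @ within (char_fset @` A) (nbhs (char_fset s))
      --> dual_fun f (phi (char_fset s)).
    apply: (@cvg_comp _ _ _ phi (dual_fun f) _ (nbhs (phi (char_fset s)))).
      exact: cphi.
    have /cvg_sup/(_ f) cf : nbhs (phi (char_fset s) : weak_space X)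
      --> (phi (char_fset s) : weak_space X) by exact: cvg_id.
    move=> B /initial_continuous hB; exact: cf hB.
  have /cvgrPdist_lt/(_ e e0) := fcs.
  move=> /nbhs_cantor[N hN]; exists N => s' As' ss'.
  by rewrite distrC; apply: hN; [move=> i /ss'|exists s'].
move=> _ [s As <-].
apply/cvg_sup => f B [_ [[C oC <-] Cx] CB].
have [e e0 eC] : exists2 e : R, 0 < e &
    forall y : R, `|y - dual_fun f (phi (char_fset s))| < e -> C y.
  have : nbhs (dual_fun f (phi (char_fset s))) C by apply: open_nbhs_nbhs.
  move=> /nbhs_ballP[e /= e0 eC]; exists e => // y ye; apply: eC.
  by rewrite -ball_normE /= distrC.
have [N hN] := h s f e As e0.
apply/nbhs_cantor; exists N => y ys [s' As' e'] /=; subst y.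
by apply: CB; apply: eC; apply: hN.
Qed.

(** * Spreading models carried by full trees *)

Section System.
Variables (R : realType) (X : completeNormedModType R).

(** [V k a] is the norm of the combination of the first [k] basis vectors with
    coefficients [a] in a spreading model generated by [Z] on the terminal nodes.
    The last three clauses are what subordination and weak nullity become. *)
Record tree_system (xi : omega1) (T : set (seq nat)) (rk : seq nat -> omega1)
    (Z : seq nat -> X) (V : nat -> (nat -> R) -> R) (K : R) : Prop := TreeSystem {
  ts_full : full_tree T;
  ts_ranked : ranked T rk;
  ts_top : (rk [::] <= xi)%O;
  ts_norm : forall k e, 0 < e -> exists N, forall (a : nat -> R) s,
    (forall j, `|a j| <= 1) -> plg k s ->
    (forall j, (j < k)%N -> terminal T (s j) /\ all (leq N) (s j)) ->
    `| `|\sum_(j < k) a j *: Z (s j)| - V k a | <= e;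
  ts_cont : forall (f : dual X) e t, 0 < e -> T t -> exists N, forall t', T t' ->
    agree N t t' -> `|dual_fun f (Z t') - dual_fun f (Z t) : R| < e;
  ts_nil : forall f : dual X, dual_fun f (Z [::]) = 0 :> R;
  ts_bound : forall t, T t -> `|Z t| <= K }.

Lemma pull_system P xi T rk Z V K : incr P -> tree_system xi T rk Z V K ->
  tree_system xi (pull P T) (rk \o map P) (Z \o map P) V K.
Proof.
move=> iP [h1 h2 h3 h4 h5 h6 h7]; split => //.
- exact: pull_full.
- exact: pull_ranked.
- move=> k e e0; have [N hN] := h4 k e e0; exists N => a s ha ps hs.
  apply: (hN a (map P \o s)) => //; first exact/(plg_map _ _ iP).
  move=> j jk; have [tj aj] := hs j jk; split; first exact: pull_terminal.
  rewrite /= all_map; apply: sub_all aj => x /= Nx.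
  exact: leq_trans (incr_ge iP x).
- move=> f e t e0 [_ Tt]; have [N hN] := h5 f e _ e0 Tt; exists N => t' [_ Tt'] tt'.
  by apply: hN => //; exact: agree_map.
- by move=> t [_ Tt]; exact: h7.
Qed.

Lemma terminal_extension T rk u N : full_tree T -> ranked T rk -> T u ->
  exists v, terminal T (u ++ v) /\ all (leq N) v.
Proof.
move=> fT rT; move: u; apply: (tree_ind rT) => [u tu|u Tu nu IH].
  by exists [::]; rewrite cats0.
pose y := maxn N (\max_(z <- u) z.+1).
have sy : sorted ltn (rcons u y).
  rewrite sorted_rcons_ltn (tree_sorted fT Tu); apply/allP => z zu /=.
  by rewrite /y leq_max (leq_bigmax_seq _ zu) // orbT.
have [v [tv Nv]] := IH y (nonterminal_full fT Tu nu sy).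
exists (y :: v); rewrite -cat_rcons; split=> //=.
by rewrite Nv andbT leq_maxl.
Qed.

Lemma infinite_cofinal (A : set nat) : infinite_set A -> cofinal A.
Proof.
move=> iA n; apply: contrapT => h; apply: iA.
apply: (@sub_finite_set _ _ `I_n); last exact: finite_II.
by move=> x Ax /=; rewrite ltnNge; apply/negP => nx; apply: h; exists x.
Qed.

(** The tree is the regular family restricted to a sparse subset of [L]; [Z] is the
    weakly continuous extension.  It vanishes weakly at the root, being there the
    limit of values at terminal nodes with large minimum, and the bound spreads
    from the terminal nodes to all nodes by weak limits. *)
Lemma SMw_system (xi : omega1) (e : seminormed_basis R) :
  (omega1_one <= xi)%O -> SMw X xi e -> exists T rk Z K,
  tree_system xi T rk Z (fun k a => sb_norm (\sum_(j < k) a j *: sb_basis e j)) K.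
Proof.
rewrite omega1_succP => xi0.
move=> [F [x [L [[G [regG FG [rho rkG rxi]]] iL [phi [cphi phix]] wx [delta [d0 dl gen]]]]]].
subst F; have [_ hG spG] := regG.
pose n0 := nat_set_nth L 0.
have [||M [iM LM fT tT]] := @sparse_full G rho hG spG rkG (L `&` [set m | (n0 < m)%N]).
- exact/cofinal_above/infinite_cofinal.
- by rewrite rxi.
set T := pull M (stree G) in fT tT.
pose rk := (rho \o fs) \o map M.
have rT : ranked T rk by exact/pull_ranked/stree_ranked.
pose Z u := phi (char_fset (fs (map M u))).
have mS u : (forall z, z \in fs (map M u) -> L z).
  by move=> z; rewrite in_fs => /mapP[i _ ->]; have [] := LM i.
have ter u : terminal T u -> restrict_to (maximal_elements G) L (fs (map M u)).
  by move=> tu; split; [exact: tT|exact: mS].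
have Zx u : terminal T u -> Z u = x (fs (map M u)).
  by move=> /ter/phix.
have sM u : sorted ltn u -> sorted ltn (map M u) by rewrite incr_sorted.
have dc u : T u -> restrict_to (down_closure (maximal_elements G)) L (fs (map M u)).
  by move=> [su [_ Gu]]; split; [exact: in_down_closure|exact: mS].
have cont (f : dual X) (eps : R) t : 0 < eps -> T t -> exists N, forall t', T t' ->
    agree N t t' -> `|dual_fun f (Z t') - dual_fun f (Z t) : R| < eps.
  move=> eps0 Tt; have /within_weakP/(_ _ f eps (dc t Tt) eps0)[N hN] := cphi.
  exists N => t' Tt' tt'; apply: hN => [|i iN]; first exact: dc.
  have /(congr1 (fun s => i \in s)) := agree_map iM tt'.
  by rewrite !mem_filter iN /= !in_fs.
(* The case [k = l = 1] of generation bounds the sequence. *)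
pose K := sb_norm (\sum_(j < 1) (1 : R) *: sb_basis e j) + delta 1%N.
have boundT t : terminal T t -> `|Z t| <= K.
  move=> tt; have st := (tree_sorted fT tt.1).
  have tn := terminal_nonempty fT tt.
  have pl : plegma (fun _ : 'I_1 => fs (map M t)).
    split.
    - by move=> _; rewrite -cardfs_eq0 card_fs ?sM // size_map size_eq0.
    - by move=> i j; rewrite !ord1.
    - move=> i j k; rewrite !card_fs ?sM // leq_min => /andP[h1 h2].
      rewrite !fset_nth_fs ?sM //.
      by apply: (sorted_ltn_nth ltn_trans 0 (sM _ st)); rewrite ?inE //; lia.
  have c1 (j : 'I_1) : -1 <= (1 : R) <= 1 by lra.
  have n0t : (nat_set_nth L 1.-1 <= fset_nth (fs (map M t)) 0)%N.
    rewrite fset_nth_fs ?sM //; case: (t) tn => // i t' _ /=.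
    by have [_ /=] := LM i; exact: ltnW.
  have := gen 0%N 1%N (fun=> 1) (fun=> fs (map M t)) isT c1 pl (fun=> ter t tt) n0t.
  rewrite big_ord1 scale1r -Zx // ler_norml => /andP[_]; rewrite /K lerBlDl.
  by rewrite addrC.
exists T, rk, Z, K; split=> //.
- by rewrite /rk /= fs_nil rxi.
- move=> k eps eps0; have /cvgrPdist_le/(_ eps eps0)[l0 _ hl0] := dl.
  have [l lk hl] : exists2 l, (k <= l)%N & delta l <= eps.
    exists (maxn l0 k); first exact: leq_maxr.
    have := hl0 _ (leq_maxl l0 k); rewrite /= sub0r normrN ger0_norm //.
    exact: ltW.
  exists (nat_set_nth L l.-1) => a s a1 ps hs.
  case: k ps hs lk => [|k] ps hs lk.
    rewrite !big_ord0 normr0 (_ : sb_norm _ = 0) ?subr0 ?normr0; first exact: ltW.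
    have := sb_normZ (0 : R) (0 : sb_space e); rewrite scaler0 normr0 mul0r.
    exact.
  have st j : (j < k.+1)%N -> sorted ltn (map M (s j)).
    by move=> /hs[[/(tree_sorted fT)/sM]].
  have psM : plg k.+1 (map M \o s) by apply/plg_map.
  have pl : plegma (fun j : 'I_k.+1 => fs (map M (s j))).
    have [p1 p2 p3] := psM; split.
    + move=> i; rewrite -cardfs_eq0 card_fs ?st // size_eq0; exact: p1.
    + move=> i j p ij; rewrite !card_fs ?st // leq_min => /andP[h1 h2].
      by rewrite !fset_nth_fs ?st //; exact: p2.
    + move=> i j p; rewrite !card_fs ?st // leq_min => /andP[h1 h2].
      rewrite !fset_nth_fs ?st //; apply: p3 => //=; move: h2 => /=; lia.
  have -> : \sum_(j < k.+1) a j *: Z (s j) =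
      \sum_(j < k.+1) a j *: x (fs (map M (s j))).
    by apply: eq_bigr => j _; rewrite Zx //; have [] := hs j (ltn_ord j).
  apply: le_trans (gen k l (fun j => a j) (fun j => fs (map M (s j))) lk _ pl _ _) _.
  + by move=> j; rewrite -ler_norml.
  + by move=> j; apply: ter; have [] := hs j (ltn_ord j).
  + have [t0 /allP N0] := hs 0%N (ltn0Sn k).
    rewrite fset_nth_fs ?st //=.
    have := terminal_nonempty fT t0; case: (s 0%N) N0 => // i t' N0 _ /=.
    by apply: leq_trans (incr_ge iM i); apply: N0; rewrite mem_head.
  + exact: hl.
- move=> f; apply/eqP; rewrite -normr_eq0; apply/eqP/le_anti; rewrite normr_ge0 andbT.
  apply/ler_addgt0Pl => eps eps0; rewrite addr0.
  have e2 : 0 < eps / 2 by lra.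
  have [N1 hN1] := cont f _ _ e2 (tree_nil fT).
  have [N2 hN2] := wx f _ e2.
  have [t [tt Nt]] := terminal_extension (maxn N1 N2) fT rT (tree_nil fT).
  have Nt1 : all (leq N1) t by apply: sub_all Nt => z /=; rewrite geq_max => /andP[].
  have := hN1 t tt.1 (agree_big [::] Nt1).
  have := hN2 _ (ter t tt); rewrite -Zx // => h1'.
  have h1 : `|dual_fun f (Z t) : R| < eps / 2.
    apply: h1'; rewrite fset_nth_fs ?sM ?(tree_sorted fT tt.1) //.
    have := terminal_nonempty fT tt; case: (t) Nt => // i t' /= /andP[Ni _] _.
    apply: leq_trans (incr_ge iM i); move: Ni; rewrite geq_max => /andP[] //.
  move=> h2; rewrite -[dual_fun f (Z [::])](subrK (dual_fun f (Z t))).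
  apply: le_trans (ler_normD _ _) _; rewrite distrC.
  have := ltW h1; have := ltW h2; lra.
- move=> t Tt; have [f cf <-] := norming (Z t).
  move: t Tt; apply: (tree_ind rT) => [t tt|t Tt nt IH].
    by apply: le_trans (cf _) _; exact: boundT.
  apply/ler_addgt0Pl => eps eps0; have [N hN] := cont f _ _ eps0 Tt.
  pose y := maxn N (\max_(z <- t) z.+1).
  have sy : sorted ltn (rcons t y).
    rewrite sorted_rcons_ltn (tree_sorted fT Tt); apply/allP => z zu /=.
    by rewrite /y leq_max (leq_bigmax_seq _ zu) // orbT.
  have Ty := nonterminal_full fT Tt nt sy.
  have ay : agree N t (rcons t y).
    by rewrite -cats1; apply: agree_big; rewrite /= leq_maxl.
  have := hN _ Ty ay; rewrite ltr_norml => /andP[h _].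
  have := IH y Ty; lra.
Qed.
End System.

(** * Joint arrays and their stabilization *)

Section JointArrays.
Variables (R : realType) (X : completeNormedModType R).
Implicit Types (T : nat -> set (seq nat)) (Z : nat -> seq nat -> X) (w a b : nat -> R).

(** A [k * l] array of nodes, one column for each of [k] coefficients and one row
    for each of the first [l] trees, is a single plegma tuple of length [k * l];
    its entry in column [j] and row [n] has index [j * l + n]. *)
Definition row_nodes T l c : set (seq nat) := terminal (T (c %% l)%N).

Definition joint_sum Z w k l a (s : nat -> seq nat) : X :=
  \sum_(c < k * l) (a (c %/ l)%N * w (c %% l)%N) *: Z (c %% l)%N (s c).

Lemma sum_mul (W : nmodType) k l (F : nat -> W) :
  \sum_(c < k * l) F c = \sum_(j < k) \sum_(n < l) F (j * l + n)%N.
Proof.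
elim: k => [|k IH]; first by rewrite !big_ord0.
by rewrite big_ord_recr mulSnr big_split_ord /= IH.
Qed.

Lemma joint_sumE Z w k l a s : joint_sum Z w k l a s =
  \sum_(j < k) \sum_(n < l) (a j * w n) *: Z n (s (j * l + n)%N).
Proof.
rewrite /joint_sum (sum_mul k l (fun c =>
  (a (c %/ l)%N * w (c %% l)%N) *: Z (c %% l)%N (s c))).
apply: eq_bigr => j _; apply: eq_bigr => n _.
have l0 : (0 < l)%N := leq_ltn_trans (leq0n n) (ltn_ord n).
by rewrite divnMDl // divn_small // addn0 modnMDl modn_small.
Qed.

Definition stable T Z w k l (e : R) (B : set nat) := forall a s t,
  (forall j, `|a j| <= 1) ->
  array (k * l) (row_nodes T l) B s -> array (k * l) (row_nodes T l) B t ->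
  `| `|joint_sum Z w k l a s| - `|joint_sum Z w k l a t| | <= e.

Variables (xi : omega1) (T : nat -> set (seq nat)) (rk : nat -> seq nat -> omega1).
Variables (Z : nat -> seq nat -> X) (V : nat -> nat -> (nat -> R) -> R) (K w : nat -> R).
Hypothesis sys : forall n, tree_system xi (T n) (rk n) (Z n) (V n) (K n).
Hypothesis w0 : forall n, 0 < w n.
Hypothesis wK : forall n, w n * K n <= 1.

Lemma row_nodes_thin l c : thin (row_nodes T l c).
Proof. exact: terminal_thin (ts_full (sys _)). Qed.

Lemma joint_sum_bound k l a d B s : (forall j, (j < k)%N -> `|a j| <= d) ->
  array (k * l) (row_nodes T l) B s -> `|joint_sum Z w k l a s| <= (k * l)%:R * d.
Proof.
move=> ad [_ hs]; apply: le_trans (ler_norm_sum _ _ _) _.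
apply: le_trans (_ : \sum_(c < k * l) d <= _); last first.
  by rewrite sumr_const card_ord mulr_natl.
apply: ler_sum => c _; have := leq_ltn_trans (leq0n c) (ltn_ord c); rewrite muln_gt0 => /andP[_ l0].
have [tc _] := hs c (ltn_ord c).
have ca : `|a (c %/ l)%N| <= d by apply: ad; rewrite ltn_divLR.
rewrite normrZ normrM (gtr0_norm (w0 _)) -mulrA.
rewrite -[leRHS]mulr1; apply: ler_pM => //.
  by rewrite mulr_ge0 // ltW.
apply: le_trans (wK (c %% l)%N); apply: ler_wpM2l; first exact: ltW.
by apply: (ts_bound (sys _)); exact: tc.1.
Qed.

Lemma joint_sumB k l a b s :
  joint_sum Z w k l a s - joint_sum Z w k l b s = joint_sum Z w k l (fun j => a j - b j) s.
Proof.
by rewrite -sumrB; apply: eq_bigr => c _; rewrite -scalerBl mulrBl.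
Qed.

Lemma joint_sum_ext k l a s t : (forall c, (c < k * l)%N -> s c = t c) ->
  joint_sum Z w k l a s = joint_sum Z w k l a t.
Proof. by move=> h; apply: eq_bigr => c _; rewrite h. Qed.

Lemma grid_approx (q : nat) (x : R) : (0 < q)%N -> `|x| <= 1 ->
  exists i : 'I_(2 * q).+1, `|x - (i%:R / q%:R - 1)| <= q%:R^-1.
Proof.
move=> q0; rewrite ler_norml => /andP[x1 x2].
have qR : 0 < q%:R :> R by rewrite ltr0n.
have y0 : 0 <= (x + 1) * q%:R by rewrite mulr_ge0 ?ler0n //; lra.
have /andP[h1 h2] := truncn_itv y0.
set i := Num.truncn _ in h1 h2.
have i2 : (i < (2 * q).+1)%N.
  rewrite ltnS -(ler_nat R) (le_trans h1) // natrM ler_pM2r //; lra.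
exists (Ordinal i2) => /=.
have e : x = ((x + 1) * q%:R) / q%:R - 1 by rewrite mulfK ?gt_eqF // addrK.
rewrite {1}e opprB addrACA addrA addrK -mulrBl normrM.
rewrite (@gtr0_norm _ q%:R^-1) ?invr_gt0 // -[leRHS]mul1r ler_pM2r ?invr_gt0 //.
rewrite ger0_norm ?subr_ge0 //; move: h2; rewrite -natr1; lra.
Qed.

Lemma stable_sub k l e A B : A `<=` B -> stable T Z w k l e B -> stable T Z w k l e A.
Proof. by move=> AB h a s t a1 /(array_sub AB) sB /(array_sub AB) tB; exact: h. Qed.

(** Ramsey's theorem for plegma tuples is applied to the finitely many
    properties comparing the norm with a multiple of [1/q], for coefficients on
    a grid of mesh [1/q]. *)
Lemma stable_dense k l (e : R) C : 0 < e -> cofinal C ->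
  exists B, [/\ cofinal B, B `<=` C & stable T Z w k l e B].
Proof.
move=> e0 cC; pose c := (k * l)%:R : R.
have c0 : 0 <= c by rewrite ler0n.
have [q q0 qe] : exists2 q : nat, (0 < q)%N & (2 * c + 1) / q%:R <= e.
  pose q := (Num.truncn ((2 * c + 1) / e)).+1; exists q => //.
  have y0 : 0 <= (2 * c + 1) / e by apply: divr_ge0; [lra|exact: ltW].
  have /andP[_ h] := truncn_itv y0.
  by rewrite ler_pdivrMr ?ltr0n // [e * _]mulrC -ler_pdivrMr //; exact: ltW.
have qR : 0 < q%:R :> R by rewrite ltr0n.
(* The norms compared are at most [k * l], hence at most [(k * l * q) / q]. *)
pose M := (k * l * q).+2.
pose I : finType := ({ffun 'I_k -> 'I_(2 * q).+1} * 'I_M)%type.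
pose co (g : {ffun 'I_k -> 'I_(2 * q).+1}) (j : nat) : R :=
  if insub j is Some i then (g i)%:R / q%:R - 1 else 0.
pose P (p : I) s := `|joint_sum Z w k l (co p.1) s| < p.2%:R / q%:R.
have [||B [cB BC hB]] := @dense_finite I (fun p B => homogeneous (k * l) (row_nodes T l) (P p) B)
   (enum I) setT _ _ C cC (fun _ _ => Logic.I).
- by move=> p A B AB h s t /(array_sub AB) sB /(array_sub AB) tB; exact: h.
- move=> p D cD _; apply: ramsey_dense => // [i _|s t st].
    exact: row_nodes_thin.
  by rewrite /P (joint_sum_ext _ st).
exists B; split=> // a s t a1 sB tB.
have /choice[g hg] (j : 'I_k) := grid_approx q0 (a1 j).
pose G := co [ffun j => g j].
have aG j : (j < k)%N -> `|a j - G j| <= q%:R^-1.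
  by move=> jk; rewrite /G /co insubT /= ffunE; exact: (hg (Ordinal jk)).
have G1 j : (j < k)%N -> `|G j| <= 1.
  move=> jk; rewrite /G /co insubT ffunE ler_norml.
  have := ltn_ord (g (Ordinal jk)); rewrite ltnS -(ler_nat R) natrM => h.
  have h1 : 0 <= (g (Ordinal jk))%:R / q%:R :> R by rewrite divr_ge0.
  have h2 : (g (Ordinal jk))%:R / q%:R <= 2 :> R by rewrite ler_pdivrMr.
  by apply/andP; split; lra.
have close r : array (k * l) (row_nodes T l) B r ->
    `| `|joint_sum Z w k l a r| - `|joint_sum Z w k l G r| | <= c / q%:R.
  move=> rB; apply: le_trans (ler_dist_dist _ _) _; rewrite joint_sumB.
  exact: joint_sum_bound aG rB.
have one r r' : array (k * l) (row_nodes T l) B r -> array (k * l) (row_nodes T l) B r' ->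
    `|joint_sum Z w k l G r'| <= `|joint_sum Z w k l G r| + q%:R^-1.
  move=> rB rB'; set v := `|joint_sum Z w k l G r|.
  have y0 : 0 <= v * q%:R by apply: mulr_ge0; [exact: normr_ge0|exact: ltW].
  have /andP[h1 h2] := truncn_itv y0.
  set i := Num.truncn _ in h1 h2.
  have iM : (i.+1 < M)%N.
    rewrite !ltnS -(ler_nat R) (le_trans h1) // natrM ler_pM2r //.
    by have := joint_sum_bound G1 rB; rewrite mulr1.
  have Pr : P ([ffun j => g j], Ordinal iM) r.
    by rewrite /P /= ltr_pdivlMr.
  have := hB _ (mem_enum _ _) r r' rB rB' Pr; rewrite /P /= => /ltW /le_trans; apply.
  by rewrite -natr1 mulrDl div1r lerD2r ler_pdivrMr.
have := close s sB; have := close t tB; have := one s t sB tB; have := one t s tB sB.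
rewrite !ler_norml.
have E : (2 * c + 1) / q%:R = c / q%:R + c / q%:R + q%:R^-1.
  by rewrite mulrDl div1r -mulrDl; congr (_ / _ + _); lra.
rewrite E in qe; move=> h1 h2 /andP[h3 h4] /andP[h5 h6]; apply/andP; split; lra.
Qed.

(** The diagonal set for all sizes at once; reindexing by its enumeration turns
    lying in its [m]-th tail into being above [m]. *)
Lemma stabilize : exists2 P, incr P & forall m k l, (k <= m)%N -> (l <= m)%N ->
  stable (fun n => pull P (T n)) (fun n => Z n \o map P) w k l (2 ^- m) [set x | (m < x)%N].
Proof.
have e0 m : 0 < 2 ^- m :> R by rewrite invr_gt0 exprn_gt0.
have [||P [iP _ hP]] := @fusion (fun m B => forall p : nat * nat,
    p \in [seq (k, l) | k <- iota 0 m.+1, l <- iota 0 m.+1] ->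
    stable T Z w p.1 p.2 (2 ^- m) B) setT _ _ (fun n => ex_intro2 _ _ n Logic.I (leqnn n)).
- by move=> m B C BC h p /h; exact: stable_sub.
- move=> m C cC _.
  apply: (@dense_finite _ (fun p B => stable T Z w p.1 p.2 (2 ^- m) B) _ setT) => //.
  + by move=> p A B AB; exact: stable_sub.
  + by move=> p D cD _; exact: stable_dense.
exists P => // m k l km lm a s t a1 sB tB.
have push r : array (k * l) (row_nodes (fun n => pull P (T n)) l) [set x | (m < x)%N] r ->
    array (k * l) (row_nodes T l) [set P j | j in [set j | (m < j)%N]] (map P \o r).
  move=> [pr hr]; split; first exact/plg_map.
  move=> i ik; have [ti mi] := hr i ik; split.
    by apply: pull_terminal => //; exact: ts_full (sys _).
  by move=> x /mapP[j /mi mj ->]; exists j.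
have := hP m (k, l) _ a _ _ a1 (push s sB) (push t tB).
move=> /(_ _)/le_trans; apply.
  apply/allpairsP; exists (k, l); split=> //; rewrite mem_iota add0n ltnS;
  exact: leq_trans (incr_ge iP m).
rewrite lef_pV2 ?posrE ?exprn_gt0 // ler_eXn2l //; last by lra.
exact: incr_ge.
Qed.

End JointArrays.

Lemma plg_sub k k' (s : nat -> seq nat) (phi : nat -> nat) : plg k s ->
  (forall i j, (i < j < k')%N -> (phi i < phi j)%N) ->
  (forall i, (i < k')%N -> (phi i < k)%N) -> plg k' (s \o phi).
Proof.
move=> [h1 h2 h3] mono lt; split.
- by move=> i ik; apply: h1; exact: lt.
- by move=> i j p ij jk; apply: h2; [apply: mono; rewrite ij|exact: lt].
- by move=> i j p ik jk; apply: h3; exact: lt.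
Qed.

Lemma contractive_opp (R : realType) (X : completeNormedModType R) (f : dual X) :
  contractive f -> exists2 g : dual X, contractive g &
    forall x, dual_fun g x = - dual_fun f x :> R.
Proof.
move=> cf; have lf : linear (fun x => - dual_fun f x : R^o).
  by move=> a x y; rewrite dualD dualZ opprD -mulrN.
pose g : {linear X -> R^o} := HB.pack (fun x => - dual_fun f x : R^o)
  (GRing.isLinear.Build R X R^o *:%R _ lf).
have [|h ch hg] := @mk_contractive _ _ g.
  by move=> x /=; rewrite -dualN; apply: le_trans (cf _) _; rewrite normrN.
by exists h => // x; rewrite hg.
Qed.

Lemma expn2_small (R : realType) (C e : R) : 0 < e ->
  exists M, forall q, (M <= q)%N -> C * 2 ^- q <= e.
Proof.
move=> e0; have C0 : 0 <= `|C| / e by apply: divr_ge0; [exact: normr_ge0|exact: ltW].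
have /andP[_ h] := truncn_itv C0; set M := (Num.truncn _).+1 in h.
exists M => q Mq; apply: le_trans (ler_wpM2r _ (ler_norm C)) _.
  by rewrite invr_ge0 exprn_ge0.
rewrite ler_pdivrMr ?exprn_gt0 // mulrC -ler_pdivrMr //.
apply: le_trans (ltW h) _; rewrite -natrX ler_nat.
by apply: leq_trans Mq _; exact/ltnW/ltn_expl.
Qed.

Lemma expn2_le (R : realType) p q : (p <= q)%N -> 2 ^- q <= 2 ^- p :> R.
Proof.
by move=> pq; rewrite lef_pV2 ?posrE ?exprn_gt0 // ler_eXn2l //; lra.
Qed.

Lemma expn2_lt (R : realType) p q : (p < q)%N -> 2 * 2 ^- q <= 2 ^- p :> R.
Proof.
move=> pq; apply: le_trans (ler_wpM2l _ (expn2_le R pq)) _; first by [].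
by rewrite exprS invfM mulVKf.
Qed.

(** * Finite blocks and the lower estimate *)

Section Blocks.
Variables (R : realType) (X : completeNormedModType R).
Variables (xi : omega1) (T : nat -> set (seq nat)) (rk : nat -> seq nat -> omega1).
Variables (Z : nat -> seq nat -> X) (V : nat -> nat -> (nat -> R) -> R) (K w : nat -> R).
Hypothesis sys : forall n, tree_system xi (T n) (rk n) (Z n) (V n) (K n).
Hypothesis w0 : forall n, 0 < w n.
Hypothesis w1 : forall n, w n <= 1.

Let fT n := ts_full (sys n).

Lemma block_gap n u b (e : R) : 0 < e -> T n u -> ~ terminal (T n) u -> all (ltn^~ b) u ->
  exists2 i1, (b < i1)%N & forall f : dual X, contractive f ->
   exists2 i, (b <= i < i1)%N & T n (rcons u i) /\
     dual_fun f (Z n (rcons u i)) < dual_fun f (Z n u) + e.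
Proof.
move=> e0 Tu nu ub.
have Ti i : (b <= i)%N -> T n (rcons u i).
  move=> bi; apply: (nonterminal_full (fT n)) => //.
  rewrite sorted_rcons_ltn (tree_sorted (fT n) Tu) /=.
  by apply: sub_all ub => x /= xb; exact: leq_trans bi.
have [|i1 bi1 h] := @weakly_null_gap _ _ (fun i => Z n (rcons u i) - Z n u) b e e0.
  move=> f cf; have [N hN] := ts_cont (sys n) f e0 Tu.
  exists (maxn b N); first exact: leq_maxl.
  have := hN _ (Ti _ (leq_maxl b N)).
  rewrite -{1}cats1 dualD dualN => /(_ _)/ltr_normlW; apply.
  by apply: agree_big; rewrite /= leq_maxr.
exists i1 => // f /h[i /andP[bi ii1] fi]; exists i; first by rewrite bi.
split; first exact: Ti.
by move: fi; rewrite dualD dualN; lra.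
Qed.

(** The interval from [beta q] to [beta q.+1] is a block.  Only finitely many pairs
    [(n, u)] have to be treated before its right end is chosen. *)
Definition blocks (beta : nat -> nat) := incr beta /\
  forall q n u, (n <= q)%N -> T n u -> ~ terminal (T n) u ->
  all (ltn^~ (beta q)) u -> forall f : dual X, contractive f ->
  exists2 i, (beta q <= i < beta q.+1)%N & T n (rcons u i) /\
     dual_fun f (Z n (rcons u i)) < dual_fun f (Z n u) + 2 ^- q.

Lemma blocks_exist : exists beta, blocks beta.
Proof.
have /choice[g hg] (p : nat * seq nat * nat * nat) : exists i1,
    let: (n, u, b, q) := p in
    T n u -> ~ terminal (T n) u -> all (ltn^~ b) u ->
    forall f : dual X, contractive f ->
    exists2 i, (b <= i < i1)%N & T n (rcons u i) /\
      dual_fun f (Z n (rcons u i)) < dual_fun f (Z n u) + 2 ^- q.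
  case: p => [[[n u] b] q].
  have [[Tu [nu ub]]|no] := pselect (T n u /\ ~ terminal (T n) u /\ all (ltn^~ b) u).
    have e0 : 0 < 2 ^- q :> R by rewrite invr_gt0 exprn_gt0.
    by have [i1 _ h] := block_gap e0 Tu nu ub; exists i1.
  by exists 0%N => h1 h2 h3; case: no.
pose next q b := maxn b.+1 (\max_(n < q.+1) \max_(u <- subseqs_below b) g (val n, u, b, q)).
pose fix beta q := if q is p.+1 then next p (beta p) else 0%N.
exists beta; split; first by apply: incrS => i /=; rewrite leq_max leqnn.
move=> q n u nq Tu nu ub f cf.
have [i /andP[bi ig] hi] := hg (n, u, beta q, q) Tu nu ub f cf.
exists i => //; rewrite bi /=; apply: leq_trans ig _.
rewrite leq_max; apply/orP; right.
apply: leq_trans (leq_bigmax (Ordinal (nq : (n < q.+1)%N))) => /=.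
apply: (@leq_bigmax_seq _ _ _ (fun u => g (n, u, beta q, q)) u) => //.
apply: mem_subseqs_below => //; exact: (tree_sorted (fT n) Tu).
Qed.

Variable beta : nat -> nat.
Hypothesis hbeta : blocks beta.

Definition in_blocks (qs : nat -> nat) (m : nat) (t : seq nat) :=
  forall p, (m <= p < size t)%N -> (beta (qs p) <= nth 0%N t p < beta (qs p).+1)%N.

(** The errors [2 ^- q] of the successive extensions add up to at most twice the
    first one. *)
Lemma greedy_from n (f : dual X) qs u : contractive f -> incr qs ->
  (forall p, (n <= qs p)%N) -> T n u -> all (ltn^~ (beta (qs (size u)))) u ->
  exists t, [/\ terminal (T n) t, prefix u t, in_blocks qs (size u) t &
    dual_fun f (Z n t) <= dual_fun f (Z n u) + 2 * 2 ^- qs (size u)].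
Proof.
move=> cf iq nq; have [ib hb] := hbeta.
move: u; apply: (tree_ind (ts_ranked (sys n))) => [u tu _|u Tu nu IH ub].
  exists u; split=> //; first exact: prefix_refl.
    by move=> p /andP[h1 h2]; lia.
  by rewrite lerDl mulr_ge0 // invr_ge0 exprn_ge0.
have [i /andP[bi ib'] [Ti fi]] := hb _ _ _ (nq _) Tu nu ub f cf.
have iS : (i < beta (qs (size u).+1))%N.
  by apply: leq_trans ib' _; rewrite incr_leq // iq.
have [|t [tt ut ht ft]] := IH i Ti.
  rewrite all_rcons size_rcons /= iS /=; apply: sub_all ub => x /= xb.
  by apply: ltn_trans iS; exact: leq_trans bi.
rewrite size_rcons in ht ft.
exists t; split=> //.
- by apply: prefix_trans ut; rewrite -cats1; exact: prefix_prefix.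
- move=> p; rewrite leq_eqVlt => /andP[/orP[/eqP<- _|up pt]]; last first.
    by apply: ht; rewrite up.
  by move/prefixP: ut => [v ->]; rewrite cat_rcons nth_cat ltnn subnn /= bi.
- apply: le_trans ft _; have := ltW fi.
  have : 2 * 2 ^- qs (size u).+1 <= 2 ^- qs (size u) :> R.
    have : (qs (size u) < qs (size u).+1)%N by exact: iq.
    exact: expn2_lt.
  lra.
Qed.

Lemma greedy n (f : dual X) qs : contractive f -> incr qs ->
  (forall p, (n <= qs p)%N) ->
  exists t, [/\ terminal (T n) t, in_blocks qs 0 t &
    dual_fun f (Z n t) <= 2 * 2 ^- qs 0%N].
Proof.
move=> cf iq nq.
have [//|t [tt _ ht ft]] := @greedy_from n f qs [::] cf iq nq (tree_nil (fT n)).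
by exists t; split=> //; rewrite (ts_nil (sys n)) add0r in ft.
Qed.

(** The entry of index [c] takes its [p]-th element from block number
    [q0 + c + (k * l) * p], which makes the array a plegma tuple. *)
Lemma in_blocks_array k l q0 (B : set nat) s :
  (forall x, (beta q0 <= x)%N -> B x) ->
  (forall c, (c < k * l)%N -> terminal (T (c %% l)%N) (s c) /\
     in_blocks (fun p => q0 + c + (k * l) * p)%N 0 (s c)) ->
  array (k * l) (row_nodes T l) B s.
Proof.
move=> hB hs; have [ib hb] := hbeta; split.
  split.
  - by move=> c ck; exact: (terminal_nonempty (fT _) (hs c ck).1).
  - move=> c d p cd dk pc pd.
    have ck : (c < k * l)%N by exact: ltn_trans dk.
    have /andP[_ h1] := (hs c ck).2 p pc; have /andP[h2 _] := (hs d dk).2 p pd.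
    apply: leq_trans h1 _; apply: leq_trans h2.
    by rewrite incr_leq // ltn_add2r ltn_add2l.
  - move=> c d p ck dk pc pd.
    have /andP[_ h1] := (hs c ck).2 p pc; have /andP[h2 _] := (hs d dk).2 p.+1 pd.
    apply: leq_trans h1 _; apply: leq_trans h2.
    by rewrite incr_leq // mulnS; lia.
move=> c ck; have [tc bc] := hs c ck; split=> // x /(nthP 0%N)[p pc <-].
apply: hB; have /andP[h _] := bc p pc; apply: leq_trans h.
by rewrite incr_leq // -addnA leq_addr.
Qed.

(** The norming functional is fixed once row [n0] of the array has been chosen;
    the other rows are chosen afterwards, in the blocks left free for them, so
    that this functional is almost nonnegative on their contribution. *)
Lemma lower_array k l n0 q0 (a : nat -> R) : (n0 < l)%N -> (l <= q0)%N ->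
  (forall j, `|a j| <= 1) -> exists s,
  array (k * l) (row_nodes T l) [set x | (q0 <= x)%N] s /\
  w n0 * `|\sum_(j < k) a j *: Z n0 (s (j * l + n0)%N)| <=
  `|joint_sum Z w k l a s| + (k * l)%:R * (2 * 2 ^- q0).
Proof.
move=> n0l lq a1; have [ib hb] := hbeta.
have l0 : (0 < l)%N by exact: leq_ltn_trans n0l.
pose qs c p := (q0 + c + (k * l) * p)%N.
have choose (f : dual X) c : contractive f -> (c < k * l)%N -> exists t,
    [/\ terminal (T (c %% l)%N) t, in_blocks (qs c) 0 t &
    dual_fun f (Z (c %% l)%N t) <= 2 * 2 ^- q0].
  move=> cf ck; have [||t [tt bt ft]] := @greedy (c %% l)%N f (qs c) cf.
  - by move=> i j ij; rewrite /qs ltn_add2l ltn_pmul2l //; exact: leq_ltn_trans ck.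
  - move=> p; have := ltn_pmod c l0; rewrite /qs => h.
    by apply: leq_trans (ltnW h) _; rewrite -addnA; exact: leq_trans (leq_addr _ _).
  exists t; split=> //; apply: le_trans ft _; rewrite ler_pM2l //.
  by apply: expn2_le; rewrite /qs -addnA leq_addr.
(* The fixed row needs no functional; any one serves to run the greedy choice. *)
have [f00 cf00 _] := norming (0 : X).
have /choice[t0 ht0] c : exists t, (c < k * l)%N -> terminal (T (c %% l)%N) t /\
    in_blocks (qs c) 0 t.
  have [ck|_] := boolP (c < k * l)%N; last by exists [::].
  by have [t [h1 h2 _]] := choose f00 c cf00 ck; exists t.
pose x := \sum_(j < k) a j *: Z n0 (t0 (j * l + n0)%N).
have [f cf fx] := norming x.
have [g cg gf] := contractive_opp cf.
have /choice[t1 ht1] c : exists t, (c < k * l)%N -> [/\ terminal (T (c %% l)%N) t,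
    in_blocks (qs c) 0 t &
    - (2 * 2 ^- q0) <= a (c %/ l)%N * dual_fun f (Z (c %% l)%N t)].
  have [ck|_] := boolP (c < k * l)%N; last by exists [::].
  have e0 : 0 <= 2 * 2 ^- q0 :> R by rewrite mulr_ge0 // invr_ge0 exprn_ge0.
  have := a1 (c %/ l)%N; rewrite ler_norml => /andP[am aM].
  have [a0|/ltW a0] := leP 0 (a (c %/ l)%N).
    have [t [h1 h2 h3]] := choose g c cg ck; exists t => _; split=> //.
    by rewrite gf in h3; nra.
  by have [t [h1 h2 h3]] := choose f c cf ck; exists t => _; split=> //; nra.
pose s c := if (c %% l)%N == n0 then t0 c else t1 c.
have hs c : (c < k * l)%N -> terminal (T (c %% l)%N) (s c) /\ in_blocks (qs c) 0 (s c).
  by move=> ck; rewrite /s; case: ifP => _; [exact: ht0|case: (ht1 c ck)].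
have modE j n : (n < l)%N -> ((j * l + n) %% l = n)%N.
  by move=> nl; rewrite modnMDl modn_small.
have divE j n : (n < l)%N -> ((j * l + n) %/ l = j)%N.
  by move=> nl; rewrite divnMDl // divn_small // addn0.
exists s; split.
  apply: in_blocks_array hs => y /= h; apply: leq_trans h; exact: incr_ge.
have sn0 j : s (j * l + n0)%N = t0 (j * l + n0)%N by rewrite /s modE // eqxx.
have -> : \sum_(j < k) a j *: Z n0 (s (j * l + n0)%N) = x.
  by apply: eq_bigr => j _; rewrite sn0.
have yJ : (dual_fun f (joint_sum Z w k l a s) : R) <= `|joint_sum Z w k l a s| := cf _.
pose z (j n : nat) : R := dual_fun f (Z n (s (j * l + n)%N)).
have yE : (dual_fun f (joint_sum Z w k l a s) : R) =
    \sum_(j < k) \sum_(n < l) a j * w n * z j n.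
  rewrite joint_sumE dual_sum; apply: eq_bigr => j _; rewrite dual_sum.
  by apply: eq_bigr => n _; rewrite dualZ.
have xE : `|x| = \sum_(j < k) a j * z j n0.
  rewrite -[LHS]fx dual_sum; apply: eq_bigr => j _.
  by rewrite dualZ /z sn0.
rewrite yE in yJ; rewrite -lerBlDr; apply: le_trans yJ; rewrite xE mulr_sumr.
have -> : \sum_(j < k) w n0 * (a j * z j n0) - (k * l)%:R * (2 * 2 ^- q0) =
    \sum_(j < k) (a j * w n0 * z j n0 - l%:R * (2 * 2 ^- q0)).
  rewrite sumrB sumr_const card_ord natrM -mulrA mulr_natl; congr (_ - _).
  by apply: eq_bigr => j _; rewrite mulrCA mulrA.
apply: ler_sum => j _; rewrite (bigD1 (Ordinal n0l)) //= lerD2l.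
apply: le_trans (_ : \sum_(n < l | n != Ordinal n0l) - (2 * 2 ^- q0) <= _).
  rewrite sumrN lerN2 sumr_const -[X in X <= _]mulr_natl.
  apply: ler_wpM2r; first by rewrite mulr_ge0 // invr_ge0 exprn_ge0.
  by rewrite ler_nat -[leqRHS]card_ord max_card.
apply: ler_sum => n nn0.
have ck : (j * l + n < k * l)%N.
  apply: leq_trans (_ : j * l + l <= _)%N; first by rewrite ltn_add2l.
  by rewrite -mulSnr leq_mul2r ltn_ord orbT.
have [_ _] := ht1 _ ck; rewrite divE // modE //.
have -> : t1 (j * l + n)%N = s (j * l + n)%N.
  by rewrite /s modE //; case: eqP => // e; case/eqP: nn0; exact/val_inj.
have e0 : 0 <= 2 * 2 ^- q0 :> R by rewrite mulr_ge0 // invr_ge0 exprn_ge0.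
rewrite -/(z j n); have := w0 n; have := w1 n; rewrite mulrAC; set y := a j * _; nra.
Qed.
End Blocks.

Lemma expn4E (R : realType) n : 4 ^- n = 2 ^- n * 2 ^- n :> R.
Proof. by rewrite -invfM -exprMn; congr (_ ^- n); rewrite -natrM. Qed.

Lemma natr_expn4_le (R : realType) k m : (k <= m)%N -> k%:R * 4 ^- m <= 2 ^- m :> R.
Proof.
move=> km; rewrite expn4E mulrA ler_piMl ?invr_ge0 ?exprn_ge0 //.
rewrite ler_pdivrMr ?exprn_gt0 // mul1r -natrX ler_nat.
by apply: leq_trans km _; exact/ltnW/ltn_expl.
Qed.

Lemma geometric_tail (R : realType) (W : normedModType R) (F : nat -> W) (d : R) l l' :
  (forall n, (l <= n < l')%N -> `|F n| <= d * 4 ^- n.+1) -> 0 <= d ->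
  `|\sum_(l <= n < l') F n| <= d * 4 ^- l.
Proof.
move=> hF d0; have e0 n : 0 < 4 ^- n :> R by rewrite invr_gt0 exprn_gt0.
have [l'l|ll'] := leqP l' l.
  by rewrite big_geq // normr0 mulr_ge0 // ltW.
suff h : `|\sum_(l <= n < l') F n| <= d * (4 ^- l - 4 ^- l').
  by apply: le_trans h _; rewrite ler_wpM2l // gerBl ltW.
elim: l' ll' hF => // l' IH; rewrite ltnS => ll' hF.
rewrite big_nat_recr //=; apply: le_trans (ler_normD _ _) _.
have hl : `|F l'| <= d * 4 ^- l'.+1 by apply: hF; rewrite ll' /=.
have e4 : 4 ^- l' = 4 * 4 ^- l'.+1 :> R by rewrite exprS invfM mulVKf.
have pos := e0 l'.+1; move: ll'; rewrite leq_eqVlt => /orP[/eqP e|lt].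
  subst l'; rewrite big_geq // normr0 add0r; apply: le_trans hl _.
  by apply: ler_wpM2l => //; rewrite e4; lra.
have h' n : (l <= n < l')%N -> (l <= n < l'.+1)%N by lia.
have := IH lt (fun n h => hF n (h' n h)); rewrite !mulrBr e4 => IH'.
have : 0 <= d * 4 ^- l'.+1 by rewrite mulr_ge0 // ltW.
lra.
Qed.

(** * The limit norm *)

Section LimitNorm.
Variables (R : realType) (X : completeNormedModType R).
Variables (xi : omega1) (T : nat -> set (seq nat)) (rk : nat -> seq nat -> omega1).
Variables (Z : nat -> seq nat -> X) (V : nat -> nat -> (nat -> R) -> R) (K w : nat -> R).
Hypothesis sys : forall n, tree_system xi (T n) (rk n) (Z n) (V n) (K n).
Hypothesis w0 : forall n, 0 < w n.
Hypothesis w1 : forall n, w n <= 1.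
Hypothesis wK : forall n, w n * K n <= 4 ^- n.+1.
Hypothesis stab : forall m k l, (k <= m)%N -> (l <= m)%N ->
  stable T Z w k l (2 ^- m) [set x | (m < x)%N].
Implicit Types a b : nat -> R.

Notation J := (joint_sum Z w).
Notation arr k l m s := (array (k * l) (row_nodes T l) [set x | (m < x)%N] s).

(** Rows of index at least [l] are dropped. *)
Definition subarray l l' (s : nat -> seq nat) c := s ((c %/ l) * l' + c %% l)%N.

Lemma subarrayP k l k' l' B s : (k <= k')%N -> (l <= l')%N ->
  array (k' * l') (row_nodes T l') B s -> array (k * l) (row_nodes T l) B (subarray l l' s).
Proof.
move=> kk ll [ps hs].
have lpos c : (c < k * l)%N -> (0 < l)%N.
  by move=> ck; have := leq_ltn_trans (leq0n c) ck; rewrite muln_gt0 => /andP[].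
have lt c : (c < k * l)%N -> ((c %/ l) * l' + c %% l < k' * l')%N.
  move=> ck; have l0 := lpos c ck.
  have h1 : (c %% l < l')%N by apply: leq_trans ll; exact: ltn_pmod.
  have h2 : (c %/ l < k')%N by apply: leq_trans kk; rewrite ltn_divLR.
  apply: leq_trans (_ : (c %/ l) * l' + l' <= _)%N; first by rewrite ltn_add2l.
  by rewrite -mulSnr leq_mul2r h2 orbT.
split.
  apply: (plg_sub (phi := fun c => ((c %/ l) * l' + c %% l)%N) ps) => // i j /andP[ij jk].
  have l0 := lpos j jk; have := leq_div2r l (ltnW ij).
  rewrite leq_eqVlt => /orP[/eqP e|lt'].
    by rewrite e ltn_add2l; move: ij; rewrite {1}(divn_eq i l) {1}(divn_eq j l) e ltn_add2l.
  apply: (@leq_trans ((i %/ l).+1 * l')%N).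
    by rewrite mulSnr -addnS leq_add2l; apply: leq_trans ll; exact: ltn_pmod.
  by apply: leq_trans (leq_addr _ _); rewrite leq_mul2r lt' orbT.
move=> c ck; have [tc bc] := hs _ (lt c ck); split=> //.
move: tc; rewrite /row_nodes modnMDl modn_small //.
by apply: leq_trans ll; exact: ltn_pmod (lpos c ck).
Qed.

Lemma row_bound n u : terminal (T n) u -> `|w n *: Z n u| <= 4 ^- n.+1.
Proof.
move=> tu; rewrite normrZ gtr0_norm //; apply: le_trans (wK n).
by apply: ler_wpM2l; [exact: ltW|exact: (ts_bound (sys n)) tu.1].
Qed.

Lemma sum_support k k' (F : nat -> X) : (k <= k')%N ->
  (forall j, (k <= j)%N -> F j = 0) -> \sum_(j < k') F j = \sum_(j < k) F j.
Proof.
move=> kk F0; rewrite -!(big_mkord xpredT F) (big_cat_nat (leq0n k) kk) /=.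
rewrite [X in _ + X]big1_seq ?addr0 // => j; rewrite mem_index_iota => /andP[_ /andP[kj _]].
exact: F0.
Qed.

(** The dropped rows have total weight at most [4 ^- l] in each column. *)
Lemma subarray_close k l k' l' m a s : (k <= k')%N -> (l <= l')%N ->
  (forall j, `|a j| <= 1) -> (forall j, (k <= j)%N -> a j = 0) ->
  arr k' l' m s ->
  `|J k' l' a s - J k l a (subarray l l' s)| <= k%:R * 4 ^- l.
Proof.
move=> kk ll a1 a0 [ps hs]; rewrite !joint_sumE.
rewrite (sum_support (F := fun j =>
  \sum_(n < l') (a j * w n) *: Z n (s (j * l' + n)%N)) kk); last first.
  by move=> j kj; rewrite big1 // => n _; rewrite a0 // mul0r scale0r.
rewrite -sumrB; apply: le_trans (ler_norm_sum _ _ _) _.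
apply: le_trans (_ : \sum_(j < k) 4 ^- l <= _); last first.
  by rewrite sumr_const card_ord mulr_natl.
apply: ler_sum => j _.
pose F n := (a j * w n) *: Z n (s (j * l' + n)%N).
rewrite (eq_bigr (fun n : 'I_l => F n)); last first.
  move=> n _; rewrite /F /subarray.
  have l0 : (0 < l)%N := leq_ltn_trans (leq0n n) (ltn_ord n).
  by rewrite divnMDl // divn_small // addn0 modnMDl modn_small.
rewrite -!(big_mkord xpredT F) (big_cat_nat (leq0n l) ll) /= addrAC subrr add0r.
rewrite -[leRHS]mul1r; apply: geometric_tail => // n /andP[ln nl].
have ck : (j * l' + n < k' * l')%N.
  apply: leq_trans (_ : j * l' + l' <= _)%N; first by rewrite ltn_add2l.
  by rewrite -mulSnr leq_mul2r (leq_trans (ltn_ord j) kk) orbT.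
have [tc _] := hs _ ck; rewrite /row_nodes modnMDl modn_small // in tc.
rewrite /F -scalerA normrZ; apply: ler_pM => //; first exact: row_bound.
Qed.

Lemma array_exists k l m : exists s, arr k l m s.
Proof.
have [beta hb] := blocks_exist sys.
have [|||s [sa _]] := lower_array sys w0 w1 hb k (n0 := 0) (l := l.+1)
  (q0 := (l + m).+1) (a := fun=> 0).
- by [].
- by rewrite ltnS leq_addr.
- by move=> j; rewrite normr0.
exists (subarray l l.+1 s); apply: (@subarrayP k l k l.+1) => //.
by apply: array_sub sa => x /= h; apply: leq_ltn_trans h; rewrite leq_addl.
Qed.

Definition diag_array := projT1 (choice (fun l => array_exists l l l)).
Lemma diag_arrayP l : arr l l l (diag_array l).
Proof. exact: (projT2 (choice (fun l => array_exists l l l))). Qed.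

Definition approx l a := `|J l l a (diag_array l)|.

Lemma approx_close k m l a s : (k <= m)%N -> (m <= l)%N ->
  (forall j, `|a j| <= 1) -> (forall j, (k <= j)%N -> a j = 0) -> arr k m m s ->
  `|approx l a - `|J k m a s| | <= 2 * 2 ^- m.
Proof.
move=> km ml a1 a0 sa.
have h1 := subarray_close (leq_trans km ml) ml a1 a0 (diag_arrayP l).
have h2 := subarrayP (leq_trans km ml) ml (diag_arrayP l).
have h3 : arr k m m (subarray m l (diag_array l)).
  by apply: array_sub h2 => x /= lx; exact: leq_ltn_trans lx.
have := stab km (leqnn m) a1 h3 sa.
have := le_trans (ler_dist_dist _ _) h1.
have := natr_expn4_le R km; rewrite /approx !ler_norml.
move=> h4 /andP[h5 h6] /andP[h7 h8]; apply/andP; split; lra.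
Qed.

Definition finitely_supported a := exists k, forall j, (k <= j)%N -> a j = 0.

Lemma approxZ l c a : approx l (fun j => c * a j) = `|c| * approx l a.
Proof.
rewrite /approx -normrZ scaler_sumr; congr `|_|; apply: eq_bigr => i _.
by rewrite scalerA mulrA.
Qed.

Lemma approxD l a b : approx l (fun j => a j + b j) <= approx l a + approx l b.
Proof.
rewrite /approx; apply: le_trans (ler_normD _ _); rewrite -big_split /=.
rewrite /joint_sum; under [in leRHS]eq_bigr do rewrite -scalerDl -mulrDl.
exact: lexx.
Qed.

Lemma supported_bound a : finitely_supported a ->
  exists2 M : R, 0 < M & forall j, `|M^-1 * a j| <= 1.
Proof.
move=> [k a0]; exists (1 + \sum_(j < k) `|a j|).
  by rewrite ltr_wpDr // sumr_ge0.
move=> j; have M0 : 0 < 1 + \sum_(j < k) `|a j| by rewrite ltr_wpDr // sumr_ge0.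
rewrite normrM gtr0_norm ?invr_gt0 // ler_pdivrMl // mulr1.
have [kj|jk] := leqP k j; first by rewrite a0 // normr0 ltW.
rewrite (bigD1 (Ordinal jk)) //= addrCA lerDl addr_ge0 // sumr_ge0 //.
Qed.

Lemma approx_cvg a : finitely_supported a -> cvgn (approx^~ a).
Proof.
move=> fa; have [M M0 aM] := supported_bound fa.
have [k a0] := fa.
suff h : cvgn (approx^~ (fun j => M^-1 * a j)).
  have -> : approx^~ a = (fun l => M * approx l (fun j => M^-1 * a j)).
    apply/funext => l; rewrite -{1}(gtr0_norm M0) -approxZ; congr approx.
    by apply/funext => j; rewrite mulVKf // gt_eqF.
  exact: is_cvgMr h.
apply: cauchy_cvg; apply/cauchy_exP => e e0.
have [m0 hm0] := expn2_small 5 e0.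
pose m := maxn m0.+1 k; exists (approx m (fun j => M^-1 * a j)).
exists m => // l /= ml; rewrite -ball_normE /=.
have [s sa] := array_exists k m m.
have b0 j : (k <= j)%N -> M^-1 * a j = 0 by move=> /a0->; rewrite mulr0.
have := approx_close (leq_maxr _ _) (leqnn m) aM b0 sa.
have := approx_close (leq_maxr _ _) ml aM b0 sa.
have h4 : 0 < 2 ^- m :> R by rewrite invr_gt0 exprn_gt0.
have : 5 * 2 ^- m <= e by apply: hm0; rewrite leq_max leqnSn.
rewrite !ler_norml ltr_norml => h1 /andP[h2 h3] /andP[h5 h6].
by apply/andP; split; lra.
Qed.

Definition limit_norm a : R := limn (approx^~ a).

Lemma limit_normZ c a : finitely_supported a ->
  limit_norm (fun j => c * a j) = `|c| * limit_norm a.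
Proof.
move=> fa; rewrite /limit_norm; apply/cvg_lim => //.
under eq_cvg do rewrite approxZ.
by apply: cvgMr; exact: approx_cvg.
Qed.

Lemma limit_normD a b : finitely_supported a -> finitely_supported b ->
  limit_norm (fun j => a j + b j) <= limit_norm a + limit_norm b.
Proof.
move=> fa fb; have fab : finitely_supported (fun j => a j + b j).
  move: fa fb => [k a0] [l b0]; exists (maxn k l) => j; rewrite geq_max => /andP[kj lj].
  by rewrite a0 // b0 // addr0.
have ca := approx_cvg fa; have cb := approx_cvg fb; have cab := approx_cvg fab.
rewrite -limD //; apply: ler_lim => //; first exact: is_cvgD.
by near=> l; exact: approxD.
Unshelve. all: by end_near. Qed.

Lemma limit_norm_close k m a s : (k <= m)%N ->
  (forall j, `|a j| <= 1) -> (forall j, (k <= j)%N -> a j = 0) -> arr k m m s ->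
  `|limit_norm a - `|J k m a s| | <= 2 * 2 ^- m.
Proof.
move=> km a1 a0 sa; have fa : finitely_supported a by exists k.
have ca := approx_cvg fa.
rewrite distrC; apply/ler_addgt0Pl => e e0.
have /cvgrPdist_le/(_ e e0)[N _ hN] := ca.
have := hN (maxn N m) (leq_maxl _ _); rewrite /= -/(limit_norm a).
have := approx_close km (leq_maxr N m) a1 a0 sa.
rewrite !ler_norml => /andP[h1 h2] /andP[h3 h4]; apply/andP; split; lra.
Qed.

Let cut k a j : R := if (j < k)%N then a j else 0.

Lemma joint_sum_cut k m a s : J k m (cut k a) s = J k m a s.
Proof.
apply: eq_bigr => c _; rewrite /cut ltn_divLR ?ltn_ord //.
by have := leq_ltn_trans (leq0n c) (ltn_ord c); rewrite muln_gt0 => /andP[].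
Qed.

Lemma row_plg k m n s B : (n < m)%N -> array (k * m) (row_nodes T m) B s ->
  plg k (fun j => s (j * m + n)%N) /\ forall j, (j < k)%N ->
  terminal (T n) (s (j * m + n)%N) /\ forall x, x \in s (j * m + n)%N -> B x.
Proof.
move=> nm [ps hs]; have ck j : (j < k)%N -> (j * m + n < k * m)%N.
  move=> jk; apply: leq_trans (_ : j * m + m <= _)%N; first by rewrite ltn_add2l.
  by rewrite -mulSnr leq_mul2r jk orbT.
split; last first.
  move=> j jk; have [tj bj] := hs _ (ck j jk); split=> //.
  by rewrite /row_nodes modnMDl modn_small in tj.
apply: (plg_sub (phi := fun j => (j * m + n)%N) ps) => // i j /andP[ij _].
by rewrite ltn_add2r ltn_pmul2r //; exact: leq_ltn_trans nm.
Qed.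

Lemma limit_norm_lower n k a : (forall j, `|a j| <= 1) ->
  w n * V n k a <= limit_norm (cut k a).
Proof.
move=> a1; apply/ler_addgt0Pl => e e0; have e4 : 0 < e / 4 by lra.
have [N1 hN1] := ts_norm (sys n) k e4.
have [m0 hm0] := expn2_small 2 e4.
pose m := maxn m0 (maxn k n.+1).
have nm : (n < m)%N by rewrite !leq_max leqnn !orbT.
have km : (k <= m)%N by rewrite !leq_max leqnn !orbT.
have [q1 hq1] := expn2_small ((k * m)%:R * 2) e4.
pose q := maxn q1 (maxn m.+1 N1).
have mq : (m < q)%N by rewrite !leq_max leqnn !orbT.
have Nq : (N1 <= q)%N by rewrite !leq_max leqnn !orbT.
have [beta hb] := blocks_exist sys.
have [s [sa hs]] := lower_array sys w0 w1 hb k nm (ltnW mq) a1.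
have sm : arr k m m s by apply: array_sub sa => x /= qx; exact: leq_trans qx.
have [pr tr] := row_plg nm sa.
have h1 := hN1 a _ a1 pr (fun j jk => conj (tr j jk).1
   (introT allP (fun x xs => leq_trans Nq ((tr j jk).2 x xs)))).
have cut1 j : `|cut k a j| <= 1 by rewrite /cut; case: ifP => // _; rewrite normr0.
have cut0 j : (k <= j)%N -> cut k a j = 0 by rewrite /cut ltnNge => ->.
have h2 := limit_norm_close km cut1 cut0 sm; rewrite joint_sum_cut in h2.
have h3 : (k * m)%:R * 2 * 2 ^- q <= e / 4 by apply: hq1; rewrite leq_maxl.
have h4 : 2 * 2 ^- m <= e / 4 by apply: hm0; rewrite leq_maxl.
rewrite mulrA in hs; move: h1 h2; rewrite !ler_norml => /andP[h1 _] /andP[h2 _].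
set v := `|\sum_(j < k) _| in hs h1.
have : w n * (V n k a) <= w n * (v + e / 4) by apply: ler_wpM2l; [exact: ltW|lra].
have : w n * (e / 4) <= e / 4 by rewrite ler_piMl // ltW.
rewrite mulrDr; lra.
Qed.

Lemma limit_norm_upper p k a : (forall j, `|a j| <= 1) ->
  limit_norm (cut k a) <= \sum_(n < p) w n * V n k a + k%:R * 4 ^- p.
Proof.
move=> a1; apply/ler_addgt0Pl => e e0.
pose d := e / 2 / p.+1%:R.
have d0 : 0 < d by rewrite !divr_gt0.
have /choice[N hN] n := ts_norm (sys n) k d0.
have e2 : 0 < e / 2 by lra.
have [m0 hm0] := expn2_small 2 e2.
pose m := maxn m0 (maxn k (maxn p (\max_(n < p) N n))).
have km : (k <= m)%N by rewrite !leq_max leqnn !orbT.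
have pm : (p <= m)%N by rewrite !leq_max leqnn !orbT.
have Nm n : (n < p)%N -> (N n <= m)%N.
  move=> np; rewrite !leq_max; apply/orP; right; apply/orP; right; apply/orP; right.
  exact: (leq_bigmax (Ordinal np)).
have [s sm] := array_exists k m m.
have cut1 j : `|cut k a j| <= 1 by rewrite /cut; case: ifP => // _; rewrite normr0.
have cut0 j : (k <= j)%N -> cut k a j = 0 by rewrite /cut ltnNge => ->.
have := limit_norm_close km cut1 cut0 sm; rewrite joint_sum_cut.
have h4 : 2 * 2 ^- m <= e / 2 by apply: hm0; rewrite leq_maxl.
pose F n := \sum_(j < k) (a j * w n) *: Z n (s (j * m + n)%N).
have FE n : F n = w n *: \sum_(j < k) a j *: Z n (s (j * m + n)%N).
  by rewrite scaler_sumr; apply: eq_bigr => j _; rewrite scalerA mulrC.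
have -> : J k m a s = \sum_(0 <= n < p) F n + \sum_(p <= n < m) F n.
  by rewrite joint_sumE exchange_big /= -(big_cat_nat (leq0n p) pm) big_mkord.
have h1 : `|\sum_(p <= n < m) F n| <= k%:R * 4 ^- p.
  apply: geometric_tail => // n /andP[pn nm]; have [_ tr] := row_plg nm sm.
  apply: le_trans (ler_norm_sum _ _ _) _.
  apply: le_trans (_ : \sum_(j < k) 4 ^- n.+1 <= _); last first.
    by rewrite sumr_const card_ord mulr_natl.
  apply: ler_sum => j _; rewrite -scalerA normrZ -[leRHS]mul1r.
  by apply: ler_pM => //; apply: row_bound; exact: (tr j (ltn_ord j)).1.
have h2 : `|\sum_(0 <= n < p) F n| <= \sum_(n < p) w n * V n k a + e / 2.
  rewrite big_mkord; apply: le_trans (ler_norm_sum _ _ _) _.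
  apply: le_trans (_ : \sum_(n < p) (w n * V n k a + d) <= _); last first.
    rewrite big_split /= lerD2l sumr_const card_ord -[leLHS]mulr_natr /d.
    rewrite mulrAC ler_pdivrMr ?ltr0n //; apply: ler_wpM2l; first exact: ltW.
    by rewrite ler_nat.
  apply: ler_sum => n _; have nm : (n < m)%N := leq_trans (ltn_ord n) pm.
  have [pr tr] := row_plg nm sm.
  have Nn := Nm n (ltn_ord n).
  have := hN n a _ a1 pr (fun j jk => conj (tr j jk).1
   (introT allP (fun x xs => leq_trans Nn (ltnW ((tr j jk).2 x xs))))).
  rewrite FE normrZ gtr0_norm // ler_norml => /andP[_].
  set v := `|_|; set u := V n k a => hv.
  have : w n * v <= w n * (u + d) by apply: ler_wpM2l; [exact: ltW|lra].
  have : w n * d <= d by rewrite ler_piMl // ltW.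
  rewrite mulrDr; lra.
have := ler_normD (\sum_(0 <= n < p) F n) (\sum_(p <= n < m) F n).
rewrite ler_norml => h5 /andP[_ h6]; lra.
Qed.

(** A single column of an array is an array, so the position of the column does
    not influence the limit. *)
Lemma limit_norm_spread (i : nat) :
  limit_norm (fun j => (j == i)%:R) = limit_norm (fun j => (j == 0%N)%:R).
Proof.
have d1 (i' j : nat) : `|(j == i')%:R : R| <= 1 by case: (_ == _); rewrite ?normr0 ?normr1.
have d0 i' k j : (i' < k)%N -> (k <= j)%N -> (j == i')%:R = 0 :> R.
  by move=> ik kj; case: eqP => // e; lia.
apply/eqP; rewrite -subr_eq0 -normr_eq0; apply/eqP/le_anti; rewrite normr_ge0 andbT.
apply/ler_addgt0Pl => e e0; rewrite addr0.
have [m0 hm0] := expn2_small 4 e0.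
pose m := maxn m0 i.+1.
have im : (i.+1 <= m)%N by rewrite leq_maxr.
have h4 : 4 * 2 ^- m <= e by apply: hm0; rewrite leq_maxl.
have [s sm] := array_exists i.+1 m m.
pose s' c := s (i * m + c)%N.
have ci c : (c < 1 * m)%N -> (i * m + c < i.+1 * m)%N.
  by rewrite mul1n mulSnr ltn_add2l.
have sm' : arr 1%N m m s'.
  have [ps hs] := sm; split.
    apply: (plg_sub (phi := fun c => (i * m + c)%N) ps) => // c d /andP[cd _].
    by rewrite ltn_add2l.
  move=> c cm; have [tc bc] := hs _ (ci c cm); split=> //.
  by move: tc; rewrite /row_nodes modnMDl.
have h1 := limit_norm_close im (d1 i) (fun j => d0 i i.+1 j (ltnSn i)) sm.
have h2 := limit_norm_close (leq_trans (ltn0Sn i) im) (d1 0%N) (fun j => d0 0%N 1%N j isT) sm'.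
have E : J i.+1 m (fun j => (j == i)%:R) s = J 1 m (fun j => (j == 0%N)%:R) s'.
  rewrite !joint_sumE big_ord1 big_ord_recr /= big1 ?add0r; last first.
    move=> j _; rewrite big1 // => n _.
    by rewrite (ltn_eqF (ltn_ord j)) mul0r scale0r.
  by apply: eq_bigr => n _; rewrite !eqxx.
rewrite E in h1; move: h1 h2; rewrite !ler_norml => /andP[h1 h1'] /andP[h2 h2'].
by apply/andP; split; lra.
Qed.

(** The limit norm is a seminorm in the coefficients; polynomials, with the
    monomials as Hamel basis, are a convenient space of such coefficients. *)
Lemma limit_basis : exists e : seminormed_basis R,
  [/\ forall k m a s, (k <= m)%N -> (forall j, `|a j| <= 1) -> arr k m m s ->
        `| `|J k m a s| - sb_norm (\sum_(j < k) a j *: sb_basis e j)| <= 2 * 2 ^- m,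
      forall n k a, (forall j, `|a j| <= 1) ->
        w n * V n k a <= sb_norm (\sum_(j < k) a j *: sb_basis e j),
      forall p k a, (forall j, `|a j| <= 1) ->
        sb_norm (\sum_(j < k) a j *: sb_basis e j) <=
        \sum_(n < p) w n * V n k a + k%:R * 4 ^- p
    & forall i, sb_norm (sb_basis e i) = sb_norm (sb_basis e 0%N)].
Proof.
have fp (p : {poly R}) : finitely_supported (fun j => p`_j).
  by exists (size p) => j; exact: nth_default.
pose N (p : {poly R}) := limit_norm (fun j => p`_j).
have ND p q : N (p + q) <= N p + N q.
  rewrite /N (_ : (fun j => (p + q)`_j) = (fun j => p`_j + q`_j)); first exact: limit_normD.
  by apply/funext => j; rewrite coefD.
have NZ c p : N (c *: p) = `|c| * N p.
  rewrite /N (_ : (fun j => (c *: p)`_j) = (fun j => c * p`_j)); first exact: limit_normZ.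
  by apply/funext => j; rewrite coefZ.
have polyE n (a : nat -> R) : \sum_(i < n) a i *: 'X^i = \poly_(i < n) a i by rewrite poly_def.
have free n (a : 'I_n -> R) : \sum_(i < n) a i *: 'X^i = 0 -> forall i, a i = 0.
  move=> h i; have /(congr1 (fun p : {poly R} => p`_i)) := h.
  rewrite coef_sum coef0 (bigD1 i) //= coefZ coefXn eqxx mulr1 big1 ?addr0 //.
  move=> j ji; rewrite coefZ coefXn; case: eqP => [e|_]; last by rewrite mulr0.
  by case/eqP: ji; apply/val_inj.
have span (p : {poly R}) : exists n (a : 'I_n -> R), p = \sum_(i < n) a i *: 'X^i.
  by exists (size p), (fun i => p`_i); rewrite (polyE _ (fun i => p`_i)) coefK.
exists (SeminormedBasis ND NZ free span) => /=.
have NE k a : N (\sum_(j < k) a j *: 'X^j) = limit_norm (cut k a).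
  by rewrite /N polyE; congr limit_norm; apply/funext => j; rewrite coef_poly.
split.
- move=> k m a s km a1 sm; rewrite NE distrC -joint_sum_cut.
  apply: limit_norm_close => // j; rewrite /cut; last by rewrite ltnNge => ->.
  by case: ifP => // _; rewrite normr0.
- by move=> n k a a1; rewrite NE; exact: limit_norm_lower.
- by move=> p k a a1; rewrite NE; exact: limit_norm_upper.
have NX i : N 'X^i = limit_norm (fun j => (j == i)%:R).
  by congr limit_norm; apply/funext => j; rewrite coefXn.
by move=> i; rewrite !NX; exact: limit_norm_spread.
Qed.

End LimitNorm.

(** * A sequence generating the limit norm *)

Lemma nat_set_nth_range P k : incr P -> nat_set_nth (range P) k = P k.
Proof.
move=> iP; have cnt n : n \in range P -> exists2 i, n = P i &
    count (fun m => m \in range P) (iota 0 n) = i.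
  rewrite inE => -[i _ <-]; exists i => //.
  transitivity (size (map P (iota 0 i))); last by rewrite size_map size_iota.
  rewrite -size_filter; apply: perm_size; apply: uniq_perm.
  - by rewrite filter_uniq // iota_uniq.
  - by rewrite map_inj_uniq ?iota_uniq //; exact: incr_inj.
  move=> x; rewrite mem_filter mem_iota add0n /=; apply/andP/mapP => [[]|[j]].
    rewrite inE => -[j _ <-]; rewrite incr_ltn // => ji; exists j => //.
    by rewrite mem_iota.
  rewrite mem_iota add0n /= => ji ->; rewrite incr_ltn //; split=> //.
  by rewrite inE; exists j.
rewrite /nat_set_nth; set A := [set n | _].
have Ak : A (P k).
  split; first by exists k.
  have [|i e ->] := cnt (P k); first by rewrite inE; exists k.
  by symmetry; apply: incr_inj e.
have [h1 h2] : A (get A) by apply: getPex; exists (P k).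
have [|i e ei] := cnt (get A); first by rewrite inE.
by rewrite e; congr P; rewrite -ei h2.
Qed.

Lemma char_fset_inj : injective char_fset.
Proof. by move=> s t e; apply/fsetP => x; have := congr1 (fun f => f x) e. Qed.

Lemma agreeP N u v : sorted ltn u -> sorted ltn v ->
  (forall i, (i < N)%N -> (i \in u) = (i \in v)) -> agree N u v.
Proof.
move=> su sv h; apply: (irr_sorted_eq ltn_trans ltnn).
- by apply: sorted_filter su; exact: ltn_trans.
- by apply: sorted_filter sv; exact: ltn_trans.
by move=> i; rewrite !mem_filter; case: ltnP => //= /h.
Qed.

Lemma agree_mem N u v x : agree N u v -> (x < N)%N -> (x \in u) = (x \in v).
Proof.
by move=> a xN; have := congr1 (fun s => x \in s) a; rewrite !mem_filter xN.
Qed.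

Lemma sorted_head_le u x : sorted ltn u -> x \in u -> (head 0%N u <= x)%N.
Proof.
case: u => //= y u su; rewrite inE => /orP[/eqP->//|xu].
by apply: ltnW; move: su => /(order_path_min ltn_trans)/allP/(_ _ xu).
Qed.

(** The shifts [interleave n] interleave: the values at [i] for [n <= i] lie between
    [interleave 0 i] and [interleave 0 i.+1]. *)
Definition interleave n i := (i * i + n)%N.

Lemma interleave_incr n : incr (interleave n).
Proof. by move=> i j ij; rewrite /interleave ltn_add2r; apply: ltn_mul. Qed.

Lemma interleave_lt m n i j : (m <= i)%N -> (i < j)%N -> (interleave m i < interleave n j)%N.
Proof. by rewrite /interleave => mi ij; nia. Qed.

Section Output.
Variables (R : realType) (X : completeNormedModType R).
Variables (xi : omega1) (T : nat -> set (seq nat)) (rk : nat -> seq nat -> omega1).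
Variables (Z : nat -> seq nat -> X) (V : nat -> nat -> (nat -> R) -> R) (K w : nat -> R).
Hypothesis sys : forall n, tree_system xi (T n) (rk n) (Z n) (V n) (K n).
Hypothesis w0 : forall n, 0 < w n.
Hypothesis w1 : forall n, w n <= 1.
Hypothesis wK : forall n, w n * K n <= 4 ^- n.+1.
Variable e : seminormed_basis R.
Hypothesis limit_e : forall k m (a : nat -> R) s, (k <= m)%N ->
  (forall j, `|a j| <= 1) -> array (k * m) (row_nodes T m) [set x | (m < x)%N] s ->
  `| `|joint_sum Z w k m a s| - sb_norm (\sum_(j < k) a j *: sb_basis e j)| <= 2 * 2 ^- m.
Variables (G : nat_family) (rho : {fset nat} -> omega1).
Hypotheses (regG : regular_family G) (rkG : is_rank G rho) (rho0 : rho fset0 = xi).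
Hypothesis xi0 : (omega1_zero < xi)%O.

Let fT n := ts_full (sys n).
Let hG : hereditary_family G. Proof. by case: regG. Qed.
Let spG : spreading_family G. Proof. by case: regG. Qed.

(** The embeddings of the countably many shifted trees are combined by letting [L]
    dominate the [n]-th one from [n] on, which suffices for sequences above [n]. *)
Lemma common_embedding : exists2 L, incr L & forall n r, all (leq n) r ->
  pull (interleave n) (T n) r -> stree G (map L r).
Proof.
have S0 : stree G [::].
  split=> //; rewrite fs_nil; have := xi0; rewrite -rho0 => /(rank_gt rkG)[s [Gs _ _]].
  by apply: hG Gs _; exact: fsub0set.
have /choice[L hL] n : exists L : nat -> nat, forall r L', incr L' ->
    (forall x, x \in r -> (L x <= L' x)%N) -> pull (interleave n) (T n) r -> stree G (map L' r).
  have fTn := pull_full (@interleave_incr n) (fT n).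
  apply: (@embed_tree (pull (interleave n) (T n)) (stree G) (rk n \o map (interleave n)) (rho \o fs)
    _ _ _ _ _ _ [::] [::]).
  - by move=> u v; exact: tree_prefix.
  - by move=> u [].
  - exact/pull_ranked/(ts_ranked (sys n)).
  - by move=> u [].
  - by move=> u v; exact: stree_spread.
  - by move=> u o; exact: stree_rank.
  - exact: tree_nil.
  - by [].
  - by rewrite /= fs_nil rho0; exact: (ts_top (sys n)).
pose g x := \max_(n < x.+1) L n x.
pose L' x := (\sum_(i < x.+1) (g i).+1)%N.
have iL' : incr L'.
  by apply: incrS => i; rewrite /L' [in ltnRHS]big_ord_recr /= addnS ltnS leq_addr.
exists L' => // n r nr Tr; apply: hL Tr => // x xr.
have nx : (n < x.+1)%N by rewrite ltnS; exact: (allP nr).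
apply: (@leq_trans (g x)); first exact: (leq_bigmax (Ordinal nx)).
by rewrite /L' big_ord_recr /= addnS (leq_trans (leq_addl _ _) (leqnSn _)).
Qed.

Variable L : nat -> nat.
Hypothesis iL : incr L.
Hypothesis hL : forall n r, all (leq n) r -> pull (interleave n) (T n) r -> stree G (map L r).

Definition node n r := init_seg (T n) (map (interleave n) r).

Lemma node_tree n r : sorted ltn r -> T n (node n r).
Proof.
move=> sr; have [] // := init_seg_cases (fT n) (u := map (interleave n) r).
by rewrite incr_sorted //; exact: interleave_incr.
Qed.

(** If the shifted sequence were a nonterminal node, it would have an extension
    in the tree, and the corresponding extension of the maximal set would lie in
    [G]. *)
Lemma node_terminal n r : sorted ltn r -> all (leq n) r ->
  maximal_elements G (fs (map L r)) -> terminal (T n) (node n r).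
Proof.
move=> sr nr [_ mr]; have ssr : sorted ltn (map (interleave n) r).
  by rewrite incr_sorted //; exact: interleave_incr.
have [Ts [Tr|//]] := init_seg_cases (fT n) ssr.
rewrite /node (init_seg_id (fT n) Tr); apply: contrapT => nt.
pose x := maxn n (\max_(z <- r) z.+1).
have sx : sorted ltn (rcons r x).
  rewrite sorted_rcons_ltn sr; apply/allP => z zr /=.
  by rewrite /x leq_max (leq_bigmax_seq _ zr) // orbT.
have ssx : sorted ltn (map (interleave n) (rcons r x)).
  by rewrite incr_sorted //; exact: interleave_incr.
have Sx : stree G (map L (rcons r x)).
  apply: (hL (n := n)); first by rewrite all_rcons nr andbT /= leq_maxl.
  split=> //; rewrite map_rcons in ssx *; exact: (nonterminal_full (fT n) Tr nt ssx).
have pr : (fs (map L r) `<` fs (map L (rcons r x)))%fset.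
  by rewrite map_rcons; apply: fproper_rcons; rewrite -map_rcons incr_sorted.
have := mr _ Sx.2 (fproper_sub pr) => eq.
by move: pr; rewrite eq fproperEneq eqxx.
Qed.

(** Truncating the sum at the minimum of [r] costs nothing in the limit; it keeps
    to those [n] for which the shifts interleave and the nodes are terminal. *)
Definition y_seq r : X := \sum_(0 <= n < head 0%N r) w n *: Z n (node n r).

(** The inverse of [r |-> fs (map L r)]. *)
Definition index_seq (s : {fset nat}) : seq nat :=
  [seq get [set i | L i = x] | x <- sort leq s].

Lemma index_seqE r : sorted ltn r -> index_seq (fs (map L r)) = r.
Proof.
move=> sr; rewrite /index_seq sort_fs ?incr_sorted // -map_comp -[RHS]map_id.
apply: eq_map => i /=; apply: (incr_inj iL).
by apply: (@getPex _ [set j | L j = L i]); exists i.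
Qed.

Lemma index_seqP (s : {fset nat}) : [set` s] `<=` range L ->
  exists2 r, sorted ltn r & s = fs (map L r).
Proof.
move=> sL; have [|r sr e'] := sorted_range iL (sort_fset_sorted s).
  by move=> x; rewrite mem_sort => xs; apply: sL.
by exists r => //; rewrite -e' fs_sort.
Qed.

Lemma row_contr n u (f : dual X) (C : R) : 0 < C ->
  (forall x, `|dual_fun f x : R| <= C * `|x|) -> T n u ->
  `|w n * dual_fun f (Z n u) : R| <= C * 4 ^- n.+1.
Proof.
move=> C0 fC Tu; rewrite normrM gtr0_norm //.
apply: le_trans (_ : w n * (C * K n) <= _); last first.
  by rewrite mulrCA ler_pM2l.
apply: ler_wpM2l; first exact: ltW.
apply: le_trans (fC _) _; rewrite ler_pM2l //; exact: (ts_bound (sys n)).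
Qed.

Lemma y_seq_null (f : dual X) (d : R) : 0 < d -> exists M, forall r, sorted ltn r ->
  all (leq M) r -> `|dual_fun f (y_seq r) : R| < d.
Proof.
move=> d0; have [C C0 fC] := dual_bounded f.
have d4 : 0 < d / 4 by lra.
have [p hp] := expn2_small C d4.
pose d' := d / 4 / p.+1%:R; have d'0 : 0 < d' by rewrite !divr_gt0.
have /choice[N hN] n := ts_cont (sys n) f d'0 (tree_nil (fT n)).
exists (maxn p (\max_(n < p) N n)) => r sr Mr.
pose F n : R := w n * dual_fun f (Z n (node n r)).
have -> : dual_fun f (y_seq r) = \sum_(0 <= n < head 0%N r) F n :> R.
  by rewrite dual_sum; apply: eq_bigr => n _; rewrite dualZ.
have Fn n : (n < p)%N -> `|F n| <= d'.
  move=> np; have Nn : all (leq (N n)) (node n r).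
    have ssr : sorted ltn (map (interleave n) r).
      by rewrite incr_sorted //; exact: interleave_incr.
    apply/allP => x xn; have /prefixP[v ev] := init_seg_prefix (fT n) ssr.
    have : x \in map (interleave n) r by rewrite ev mem_cat xn.
    move=> /mapP[z zr ->]; apply: leq_trans (incr_ge (@interleave_incr n) z).
    have := allP Mr z zr; rewrite /= geq_max => /andP[_]; apply: leq_trans.
    exact: (leq_bigmax (Ordinal np)).
  have := hN n _ (node_tree n sr) (agree_big [::] Nn).
  rewrite (ts_nil (sys n)) subr0 /F normrM gtr0_norm // => h.
  by rewrite -[leRHS]mul1r; apply: ler_pM => //; [exact: ltW|exact: ltW].
case: r sr Mr @F Fn => [|h r] sr Mr F Fn.
  by rewrite big_geq // normr0.
have ph : (p <= h)%N by move: Mr => /= /andP[]; rewrite geq_max => /andP[].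
rewrite /= (big_cat_nat (leq0n p) ph) /=.
have h1 : `|\sum_(0 <= n < p) F n| <= d / 4.
  rewrite big_mkord; apply: le_trans (ler_norm_sum _ _ _) _.
  apply: le_trans (_ : \sum_(n < p) d' <= _); first by apply: ler_sum => n _; exact: Fn.
  rewrite sumr_const card_ord -[leLHS]mulr_natr /d'.
  rewrite mulrAC ler_pdivrMr ?ltr0n //; apply: ler_wpM2l; first exact: ltW.
  by rewrite ler_nat.
have h2 : `|\sum_(p <= n < h) F n| <= C * 4 ^- p.
  apply: (@geometric_tail R R^o) => [n _|]; last exact: ltW.
  exact: (row_contr C0 fC (node_tree n sr)).
have h3 : C * 4 ^- p <= d / 4.
  apply: le_trans (hp p (leqnn p)); rewrite ler_pM2l // expn4E.
  by rewrite ler_piMr ?invr_ge0 ?exprn_ge0 // invf_le1 ?exprn_gt0 // exprn_ege1 // ler1n.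
have := ler_normD (\sum_(0 <= n < p) F n) (\sum_(p <= n < h) F n); lra.
Qed.

(** A nonempty [r] and a sequence close to it have the same minimum, so that only
    finitely many terms have to be compared. *)
Lemma y_seq_cont (f : dual X) (d : R) r : 0 < d -> sorted ltn r ->
  exists M, forall r', sorted ltn r' -> agree M r r' ->
  `|dual_fun f (y_seq r') - dual_fun f (y_seq r) : R| < d.
Proof.
move=> d0; case: r => [_|h r sr].
  have [M hM] := y_seq_null f d0; exists M => r' sr' a.
  rewrite {2}/y_seq big_geq // dual0 subr0; apply: hM => //.
  apply/allP => x xr'; rewrite /= leqNgt; apply/negP => xM.
  by have := congr1 (fun s => x \in s) a; rewrite !mem_filter xM xr'.
pose d' := d / h.+1%:R; have d'0 : 0 < d' by rewrite divr_gt0.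
have /choice[N hN] n := ts_cont (sys n) f d'0 (node_tree n sr).
exists (maxn h.+1 (\max_(n < h) N n)) => r' sr' a.
have ah := agreeW (leq_maxl h.+1 _) a.
have hr' : head 0%N r' = h.
  have hin : h \in r' by rewrite -(agree_mem ah (ltnSn h)) mem_head.
  have le1 := sorted_head_le sr' hin.
  have hr : head 0%N r' \in r' by case: (r') hin => // z u _; rewrite mem_head.
  have : head 0%N r' \in h :: r by rewrite (agree_mem ah) // ltnS.
  by move=> /(sorted_head_le sr) /= le2; apply/eqP; rewrite eqn_leq le1 le2.
rewrite /y_seq hr' /= !dual_sum -sumrB; apply: le_lt_trans (ler_norm_sum _ _ _) _.
apply: le_lt_trans (_ : \sum_(0 <= n < h) d' < _).
  rewrite !big_mkord; apply: ler_sum => n _.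
  rewrite !dualZ -mulrBr normrM gtr0_norm // -[leRHS]mul1r.
  apply: ler_pM => //; first exact: ltW.
  apply/ltW/hN; first exact: node_tree.
  apply/agree_init_seg/agree_map; first exact: interleave_incr.
  apply: agreeW a; apply: leq_trans (leq_maxr _ _).
  exact: (leq_bigmax n).
rewrite sumr_const_nat subn0 -mulr_natr /d' mulrAC ltr_pdivrMr ?ltr0n //.
by rewrite ltr_pM2l // ltr_nat.
Qed.

(* The shift by two ensures that sets beyond the [l]-th element of [range P] have
   all their indices above [l]. *)
Let P i := L i.+2.
Let x s := y_seq (index_seq s).
Let F := maximal_elements G.

Let iP : incr P. Proof. by move=> i j ij; apply: iL. Qed.

Let range_P (s : {fset nat}) : [set` s] `<=` range P -> [set` s] `<=` range L.
Proof. by move=> sP z /sP[i _ <-]; exists i.+2. Qed.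

Lemma y_seq_agree (f : dual X) (d : R) (s : {fset nat}) : 0 < d -> [set` s] `<=` range P ->
  exists N, forall s' : {fset nat}, [set` s'] `<=` range P ->
    (forall i, (i < N)%N -> (i \in s') = (i \in s)) ->
    `|dual_fun f (x s') - dual_fun f (x s) : R| < d.
Proof.
move=> d0 /range_P/index_seqP[r sr ->].
have [M hM] := y_seq_cont f d0 sr; exists (L M) => s' /range_P/index_seqP[r' sr' ->] h.
rewrite /x !index_seqE //; apply: hM => //; apply: agreeP => // i iM.
have := h (L i); rewrite incr_ltn // => /(_ iM).
by rewrite !in_fs !mem_map //; exact: incr_inj.
Qed.

Lemma y_seq_subordinated : subordinated F x (range P).
Proof.
pose phi (c : cantor_space) : weak_space X := x (xget fset0 [set s | char_fset s = c]).
have phiE s : phi (char_fset s) = x s.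
  rewrite /phi; congr x; apply: char_fset_inj.
  by apply: (@xgetPex _ fset0 [set t | char_fset t = char_fset s]); exists s.
exists phi; split; last by move=> s _; rewrite phiE.
apply/within_weakP => s f d [_ sP] d0.
have [N hN] := y_seq_agree f d0 sP; exists N => s' [_ s'P] h.
by rewrite !phiE; exact: hN.
Qed.

Lemma y_seq_weakly_null : weakly_null F x (range P).
Proof.
move=> f d d0; have P0 : [set` (fset0 : {fset nat})] `<=` range P by move=> z.
have [N hN] := y_seq_agree f d0 P0; exists N.+1 => s [_ sP] Ns.
have x0 : dual_fun f (x fset0) = 0 :> R.
  by rewrite /x -fs_nil (@index_seqE [::]) // /y_seq big_geq // dual0.
rewrite -[dual_fun f (x s)]subr0 -x0; apply: hN => // i iN.
rewrite inE; apply/negP => is_; move: Ns; rewrite ltnNge => /negP; apply.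
apply: leq_trans (ltnW iN).
have := sorted_head_le (sort_fset_sorted s) (x := i).
by rewrite mem_sort => /(_ is_); rewrite /fset_nth nth0.
Qed.

Lemma shifted_array k l (r : nat -> seq nat) : plg k r ->
  (forall j, (j < k)%N -> maximal_elements G (fs (map L (r j)))) ->
  (forall j, (j < k)%N -> all (leq l.+1) (r j)) ->
  array (k * l) (row_nodes T l) [set x | (l < x)%N]
    (fun c => node (c %% l) (r (c %/ l)%N)).
Proof.
move=> pr mr lr.
have jk c : (c < k * l)%N -> (c %/ l < k)%N /\ (c %% l < l)%N.
  move=> ck; have l0 : (0 < l)%N.
    by have := leq_ltn_trans (leq0n c) ck; rewrite muln_gt0 => /andP[].
  by rewrite ltn_divLR // ltn_pmod.
have sr j : (j < k)%N -> sorted ltn (r j) by exact: plg_sorted.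
have ssr j n : (j < k)%N -> sorted ltn (map (interleave n) (r j)).
  by move=> /sr; rewrite incr_sorted //; exact: interleave_incr.
have tr c : (c < k * l)%N -> terminal (T (c %% l)%N) (node (c %% l) (r (c %/ l)%N)).
  move=> /jk[jc nc]; apply: node_terminal; [exact: sr| |exact: mr].
  by apply: sub_all (lr _ jc) => z /= h; apply: leq_trans h; exact: ltnW (ltnW _).
have nodeE c p : (c < k * l)%N -> (p < size (node (c %% l) (r (c %/ l)%N)))%N ->
    (p < size (r (c %/ l)%N))%N /\
    nth 0%N (node (c %% l) (r (c %/ l)%N)) p = interleave (c %% l) (nth 0%N (r (c %/ l)%N) p).
  move=> /jk[jc _] pn; have /prefixP[v ev] := init_seg_prefix (fT (c %% l)%N) (ssr _ (c %% l)%N jc).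
  have ps : (p < size (r (c %/ l)%N))%N.
    by rewrite -(size_map (interleave (c %% l))) ev size_cat; exact: leq_trans (leq_addr _ _).
  by split=> //; rewrite -(nth_map 0%N 0%N) // ev nth_cat pn.
have big j p : (j < k)%N -> (p < size (r j))%N -> (l < nth 0%N (r j) p)%N.
  by move=> jk' pj; apply: (allP (lr j jk')); exact: mem_nth.
have [pr1 pr2 pr3] := pr.
split.
  split.
  - by move=> c ck; exact: (terminal_nonempty (fT _) (tr c ck)).
  - move=> c d p cd dk pc pd; have ck : (c < k * l)%N by exact: ltn_trans dk.
    have [pc' ->] := nodeE c p ck pc; have [pd' ->] := nodeE d p dk pd.
    have [jc nc] := jk c ck; have [jd nd] := jk d dk.
    have := leq_div2r l (ltnW cd); rewrite leq_eqVlt => /orP[/eqP eq|lt].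
      rewrite eq /interleave ltn_add2l.
      by move: cd; rewrite {1}(divn_eq c l) {1}(divn_eq d l) eq ltn_add2l.
    apply: interleave_lt; last exact: pr2.
    by apply: ltnW; apply: ltn_trans nc _; exact: big.
  - move=> c d p ck dk pc pd.
    have [pc' ->] := nodeE c p ck pc; have [pd' ->] := nodeE d p.+1 dk pd.
    have [jc nc] := jk c ck; have [jd nd] := jk d dk.
    apply: interleave_lt; last exact: pr3.
    by apply: ltnW; apply: ltn_trans nc _; exact: big.
move=> c ck; split; first exact: tr.
move=> z /(nthP 0%N)[p pn <-] /=; have [pc' ->] := nodeE c p ck pn.
have [jc _] := jk c ck.
exact: leq_trans (big _ _ jc pc') (incr_ge (@interleave_incr _) _).
Qed.

Lemma y_seq_generates : generates F x (range P) e.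
Proof.
exists (fun l => 3 * 2 ^- l); split.
- by move=> n; rewrite mulr_gt0 // invr_gt0 exprn_gt0.
- rewrite -(mulr0 3); apply: cvgMr.
  under eq_cvg do rewrite -exprVn.
  by apply: cvg_expr; rewrite ger0_norm ?invr_ge0 // invf_lt1 // ltr1n.
move=> k l a s kl a1 ps sF hl.
have /choice[r0 hr0] (j : 'I_k.+1) : exists r, sorted ltn r /\ s j = fs (map L r).
  by have [r sr e'] := index_seqP (range_P (sF j).2); exists r.
pose r j := r0 (inord j); pose b j := a (inord j).
have b1 j : `|b j| <= 1 by rewrite ler_norml; exact: a1.
have sr j : sorted ltn (r j) by exact: (hr0 _).1.
have sE (j : 'I_k.+1) : s j = fs (map L (r j)) by rewrite /r inord_val (hr0 j).2.
have ssr j : sorted ltn (map L (r j)) by rewrite incr_sorted.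
have pr : plg k.+1 r.
  apply/(plg_map _ _ iL); have [p1 p2 p3] := ps.
  have nthE j p : (j < k.+1)%N -> nth 0%N (map L (r j)) p = fset_nth (s (inord j)) p.
    by move=> jk; rewrite sE fset_nth_fs inordK.
  have szE j : (j < k.+1)%N -> size (map L (r j)) = #|` s (inord j)|%fset.
    by move=> jk; rewrite sE card_fs inordK.
  split.
  - by move=> j jk; rewrite -size_eq0 /= szE // cardfs_eq0.
  - move=> i j p ij jk /=; have ik := ltn_trans ij jk.
    rewrite !szE // !nthE // => h1 h2; apply: p2; first by rewrite !inordK.
    by rewrite leq_min h1.
  - move=> i j p ik jk /=; rewrite !szE // !nthE // => h1 h2; apply: p3.
    by rewrite leq_min h1 -ltnS (ltn_predK h2).
have l0 : (0 < l)%N by exact: leq_trans kl.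
have lr j : (j < k.+1)%N -> all (leq l.+1) (r j).
  move=> jk; have h0 : (l.+1 <= head 0%N (r 0%N))%N.
    have n0 : r 0%N != [::] by have [h _ _] := pr; apply: h.
    move: hl; rewrite nat_set_nth_range // sE fset_nth_fs //.
    by move: n0; rewrite /=; case: (r 0%N) => //= z u _; rewrite /P prednK // incr_leq.
  have hj : (head 0%N (r 0%N) <= head 0%N (r j))%N.
    case: j jk => [//|j] jk; apply: ltnW; rewrite -!nth0.
    by have [h1 h2 _] := pr; apply: h2 => //; rewrite lt0n size_eq0; apply: h1.
  apply/allP => z /(sorted_head_le (sr j)) zh /=.
  by apply: leq_trans zh; exact: leq_trans hj.
have mr j : (j < k.+1)%N -> maximal_elements G (fs (map L (r j))).
  by move=> jk; have [] := sF (inord j); rewrite sE inordK.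
have arr := shifted_array pr mr lr.
set t := fun c => node _ _ in arr.
have lim := limit_e kl b1 arr.
have -> : \sum_(j < k.+1) a j *: sb_basis e j = \sum_(j < k.+1) b j *: sb_basis e j.
  by apply: eq_bigr => j _; rewrite /b inord_val.
have -> : \sum_(j < k.+1) a j *: x (s j) = \sum_(j < k.+1) b j *: y_seq (r j).
  by apply: eq_bigr => j _; rewrite /b inord_val /x sE index_seqE.
have close : `|\sum_(j < k.+1) b j *: y_seq (r j) - joint_sum Z w k.+1 l b t| <= 2 ^- l.
  apply: le_trans (natr_expn4_le R kl).
  rewrite joint_sumE -sumrB; apply: le_trans (ler_norm_sum _ _ _) _.
  apply: le_trans (_ : \sum_(j < k.+1) 4 ^- l <= _); last first.
    by rewrite sumr_const card_ord mulr_natl.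
  apply: ler_sum => j _.
  pose Fn n := w n *: Z n (node n (r j)).
  have lh : (l <= head 0%N (r j))%N.
    have n0 : r j != [::] by have [h _ _] := pr; apply: h.
    by move: (lr j (ltn_ord j)) n0; case: (r j) => //= z u /andP[/ltnW].
  rewrite /y_seq (big_cat_nat (leq0n l) lh) /= big_mkord scalerDr.
  have -> : \sum_(n < l) (b j * w n) *: Z n (t (j * l + n)%N) =
      b j *: \sum_(n < l) w n *: Z n (node n (r j)).
    rewrite scaler_sumr; apply: eq_bigr => n _.
    by rewrite scalerA /t divnMDl // divn_small // addn0 modnMDl modn_small.
  rewrite addrAC subrr add0r normrZ -[leRHS]mul1r; apply: ler_pM => //.
  rewrite -[leRHS]mul1r; apply: geometric_tail => // n _; rewrite mul1r normrZ gtr0_norm //.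
  apply: le_trans (wK n); apply: ler_wpM2l; first exact: ltW.
  by apply: (ts_bound (sys n)); exact: node_tree.
have := le_trans (ler_dist_dist _ _) close; move: lim; rewrite !ler_norml.
by move=> /andP[h1 h2] /andP[h3 h4]; apply/andP; split; lra.
Qed.

Lemma output_SMw : SMw X xi e.
Proof.
exists F, x, (range P); split.
- by exists G; split=> //; exists rho.
- rewrite (eq_finite_set (inj_card_eq (in2W (incr_inj iP)))).
  exact: infinite_nat.
- exact: y_seq_subordinated.
- exact: y_seq_weakly_null.
- exact: y_seq_generates.
Qed.

End Output.

(** * Upper bounds of countably many spreading models *)

Section Realize.
Variables (R : realType) (X : completeNormedModType R).
Implicit Types (e : seminormed_basis R) (a : nat -> R).

Definition basis_norm e k a := sb_norm (\sum_(j < k) a j *: sb_basis e j).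

Lemma SMw_scale xi e (c : R) : 0 < c -> SMw X xi e -> exists e', [/\ SMw X xi e',
  forall k a, basis_norm e' k a = c * basis_norm e k a &
  forall i, sb_norm (sb_basis e' i) = c * sb_norm (sb_basis e i)].
Proof.
move=> c0 [F [x [L [rF iL [phi [cphi phix]] wx [delta [d0 dl gen]]]]]].
pose N (v : sb_space e) := c * sb_norm v.
have ND u v : N (u + v) <= N u + N v by rewrite -mulrDr ler_pM2l // sb_normD.
have NZ b v : N (b *: v) = `|b| * N v by rewrite /N sb_normZ mulrCA.
exists (SeminormedBasis ND NZ (@sb_free R e) (@sb_span R e)); split=> //.
exists F, (fun s => c *: x s), L; split=> //.
- exists (fun y => c *: (phi y : X)); split; last by move=> s Fs; rewrite phix.
  apply/within_weakP => s f d As dd.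
  have dc : 0 < d / c by rewrite divr_gt0.
  have /within_weakP/(_ s f _ As dc)[M hM] := cphi; exists M => s' As' h.
  have := hM s' As' h; rewrite !dualZ -mulrBr normrM gtr0_norm //.
  by rewrite ltr_pdivlMr // mulrC.
- move=> f d dd; have dc : 0 < d / c by rewrite divr_gt0.
  have [n0 hn] := wx f _ dc; exists n0 => s Fs ns; have := hn s Fs ns.
  by rewrite dualZ normrM gtr0_norm // ltr_pdivlMr // mulrC.
exists (fun l => c * delta l); split.
- by move=> n; rewrite mulr_gt0.
- by rewrite -(mulr0 c); apply: cvgMr.
move=> k l a s kl a1 ps Fs hl; have := gen k l a s kl a1 ps Fs hl.
rewrite /= /N.
have -> : \sum_(j < k.+1) a j *: (c *: x (s j)) = c *: \sum_(j < k.+1) a j *: x (s j).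
  by rewrite scaler_sumr; apply: eq_bigr => j _; rewrite !scalerA mulrC.
by rewrite normrZ gtr0_norm // -mulrBr normrM gtr0_norm // ler_pM2l.
Qed.

(** The spreading model of the weighted sum of interleaved copies of sequences
    generating the [es n].  The bounds [K] do not depend on the weights, so that
    the weights can be chosen afterwards. *)
Lemma realize xi (es : nat -> seminormed_basis R) :
  (omega1_one <= xi)%O -> (forall n, SMw X xi (es n)) ->
  exists K : nat -> R, forall w : nat -> R, (forall n, 0 < w n) ->
    (forall n, w n <= 1) -> (forall n, w n * K n <= 4 ^- n.+1) ->
  exists e, [/\ SMw X xi e,
      forall n k a, (forall j, `|a j| <= 1) ->
        w n * basis_norm (es n) k a <= basis_norm e k a,
      forall p k a, (forall j, `|a j| <= 1) -> basis_norm e k a <=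
        \sum_(n < p) w n * basis_norm (es n) k a + k%:R * 4 ^- p
    & forall i, sb_norm (sb_basis e i) = sb_norm (sb_basis e 0%N)].
Proof.
move=> xi1 hes.
have /choice[T hT] n := SMw_system xi1 (hes n).
have /choice[rk hrk] := hT; have /choice[Z hZ] := hrk; have /choice[K sys] := hZ.
exists K => w w0 w1 wK.
have wK1 n : w n * K n <= 1.
  by apply: le_trans (wK n) _; rewrite invf_le1 ?exprn_gt0 // exprn_ege1 // ler1n.
have [P iP stab] := stabilize sys w0 wK1.
have sysP n := pull_system iP (sys n).
have [e [h1 h2 h3 h4]] := limit_basis sysP w0 w1 wK stab.
exists e; split=> //.
have [_ [_ [_ [[G [regG _ [rho rkG r0]]] _ _ _ _]]]] := hes 0%N.
have xi0 : (omega1_zero < xi)%O by rewrite -omega1_succP.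
have [L iL hL] := common_embedding sysP regG rkG r0 xi0.
exact: (output_SMw sysP w0 w1 wK h1 regG rkG r0 iL hL).
Qed.
End Realize.

(** * A decreasing omega_1-sequence of slowly growing functions *)

Definition unbounded (g : nat -> nat) := forall N, exists n0, forall n, (n0 <= n)%N -> (N <= g n)%N.

Definition slower (A : set (nat -> nat)) (h : nat -> nat) :=
  [/\ unbounded h, forall n, (h n <= n)%N &
    forall g, A g -> exists n0, forall n, (n0 <= n)%N -> (h n < g n)%N].

(** [h n] is the largest [p <= n] such that each of the first [p.+1] members of [A]
    stays above [p] from [n] on. *)
Lemma slower_exists A : countable A -> (forall g, A g -> unbounded g) ->
  exists h, slower A h.
Proof.
move=> /countable_injP[f fi] ub.
pose i k := xget (id : nat -> nat) [set g | A g /\ f g = k].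
have iub k : unbounded (i k).
  rewrite /i; case: xgetP => [g -> [Ag _]|_]; first exact: ub.
  by move=> N; exists N.
pose good p n := `[< forall k n', (k <= p)%N -> (n <= n')%N -> (p < i k n')%N >].
pose h n := \max_(p < n.+1 | good p n) p.
exists h; split.
- move=> p; have /choice[n0 hn0] k := iub k p.+1.
  exists (maxn p (\max_(k < p.+1) n0 k)) => n; rewrite geq_max => /andP[pn nn].
  have ph : (p < n.+1)%N by [].
  apply: (@leq_bigmax_cond _ (fun p : 'I_n.+1 => good p n) val (Ordinal ph)).
  apply/asboolP => k n' kp nn' /=; apply: hn0; apply: leq_trans nn'.
  by apply: leq_trans nn; exact: (leq_bigmax (Ordinal (kp : (k < p.+1)%N))).
- by move=> n; apply/bigmax_leqP => p _; rewrite -ltnS.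
move=> g Ag; have [n0 hn0] := ub g Ag (f g).+1.
exists n0 => n nn; have ig : i (f g) = g.
  rewrite /i; apply: xget_unique => // g' [Ag' e]; apply: fi => //; exact: mem_set.
have g0 : (0 < g n)%N by exact: leq_ltn_trans (hn0 n nn).
rewrite -(prednK g0) ltnS; apply/bigmax_leqP => p /asboolP hp.
rewrite -ltnS prednK //; have [pk|kp] := ltnP p (f g).
  by apply: leq_trans (hn0 n nn); exact: ltnW.
by have := hp (f g) n kp (leqnn n); rewrite ig.
Qed.

Lemma omega1_wf : well_founded (fun a b : omega1 => (a < b)%O).
Proof. by move=> a; elim/omega1_ind: a => a IH; constructor. Qed.

(** Transfinite recursion: countably many unbounded functions always have a common
    slower unbounded function. *)
Lemma slow_chain : exists j : omega1 -> nat -> nat,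
  (forall al n, (j al n <= n)%N) /\
  (forall al be, (al < be)%O -> exists n0, forall n, (n0 <= n)%N -> (j be n < j al n)%N).
Proof.
pose H A := xget (id : nat -> nat) [set h | slower A h].
pose j := Fix omega1_wf (fun _ => nat -> nat)
  (fun al rec => H [set g | exists be (lt : (be < al)%O), g = rec be lt]).
have jE al : j al = H [set j be | be in [set be | (be < al)%O]].
  rewrite /j Fix_eq; last first.
    move=> a f g fg; congr H; apply/seteqP.
    by split=> _ [be [lt ->]]; exists be, lt; rewrite fg.
  congr H; apply/seteqP; split=> [_ [be [lt ->]]|_ [be lt <-]]; first by exists be.
  by exists be, lt.
have jP al : slower [set j be | be in [set be | (be < al)%O]] (j al).
  elim/omega1_ind: al => al IH.
  have [||h hh] := @slower_exists [set j be | be in [set be | (be < al)%O]].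
  - apply: card_le_trans (card_image_le _ _) _.
    apply: sub_countable (omega1_countable_below al).
    by apply: subset_card_le => be /= /ltW.
  - by move=> _ [be lt <-]; have [] := IH be lt.
  by rewrite [X in slower _ X]jE; exact: (xgetPex (id : nat -> nat) (ex_intro _ h hh)).
exists j; split=> [al n|al be lt]; first by have [] := jP al.
by have [_ _ h] := jP be; apply: h; exists al.
Qed.

(** * Domination and weights *)

Section Domination.
Variable R : realType.
Implicit Types (e : seminormed_basis R) (a : nat -> R).

Lemma sb_norm0 e : sb_norm (0 : sb_space e) = 0.
Proof. by have := sb_normZ (0 : R) (0 : sb_space e); rewrite scaler0 normr0 mul0r. Qed.

Lemma sb_norm_ge0 e (v : sb_space e) : 0 <= sb_norm v.
Proof.
have := sb_normD v (- v); rewrite subrr sb_norm0 -scaleN1r sb_normZ normrN1 mul1r.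
lra.
Qed.

Lemma basis_norm_ge0 e k a : 0 <= basis_norm e k a.
Proof. exact: sb_norm_ge0. Qed.

Lemma basis_normZ e k c a : basis_norm e k (fun j => c * a j) = `|c| * basis_norm e k a.
Proof.
rewrite /basis_norm -sb_normZ; congr sb_norm; rewrite scaler_sumr.
by apply: eq_bigr => j _; rewrite scalerA.
Qed.

Lemma basis_norm_ext e k a b : (forall j, (j < k)%N -> a j = b j) ->
  basis_norm e k a = basis_norm e k b.
Proof. by move=> ab; congr sb_norm; apply: eq_bigr => j _; rewrite ab. Qed.

Lemma unit_coefficients k a : exists2 M : R, 0 < M & exists2 b, forall j, `|b j| <= 1 &
  forall e, basis_norm e k a = M * basis_norm e k b.
Proof.
pose c j := if (j < k)%N then a j else 0.
have [|M M0 h] := @supported_bound R c.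
  by exists k => j; rewrite /c ltnNge => ->.
exists M => //; exists (fun j => M^-1 * c j) => // e.
rewrite basis_normZ gtr0_norm ?invr_gt0 // mulVKf ?gt_eqF //.
by apply: basis_norm_ext => j jk; rewrite /c jk.
Qed.

Lemma sb_leP e1 e2 : sb_le e1 e2 <-> exists2 C : R, 0 < C &
  forall k a, (forall j, `|a j| <= 1) -> basis_norm e1 k a <= C * basis_norm e2 k a.
Proof.
split=> -[C C0 h]; exists C => //; first by move=> k a _; exact: h.
move=> n a; pose b j : R := if insub j is Some i then a i else 0.
have E e : sb_norm (\sum_(i < n) a i *: sb_basis e i) = basis_norm e n b.
  by congr sb_norm; apply: eq_bigr => i _; rewrite /b valK.
rewrite !E; have [M M0 [c c1 hc]] := unit_coefficients n b.
by rewrite !hc mulrCA ler_pM2l //; exact: h.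
Qed.

Lemma basis_norm_le e k a (d : R) : (forall j, `|a j| <= 1) ->
  (forall i, sb_norm (sb_basis e i) <= d) -> basis_norm e k a <= k%:R * d.
Proof.
move=> a1 hd; rewrite /basis_norm; elim: k => [|k IH].
  by rewrite big_ord0 sb_norm0 mul0r.
rewrite big_ord_recr /=; apply: le_trans (sb_normD _ _) _.
rewrite -natr1 mulrDl mul1r; apply: lerD IH _; rewrite sb_normZ -[leRHS]mul1r.
by apply: ler_pM => //; exact: sb_norm_ge0.
Qed.

Lemma sum_expn2 p : \sum_(n < p) 2 ^- n.+1 <= 1 :> R.
Proof.
suff -> : \sum_(n < p) 2 ^- n.+1 = 1 - 2 ^- p :> R by rewrite gerBl invr_ge0 exprn_ge0.
elim: p => [|p IH]; first by rewrite big_ord0 expr0 invr1 subrr.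
have E : 2 ^- p = 2 * 2 ^- p.+1 :> R by rewrite exprS invfM mulVKf.
by rewrite big_ord_recr /= IH E; lra.
Qed.

Lemma recursive_choice (Rel : nat -> (nat -> R) -> R -> Prop) :
  (forall n f, exists x, Rel n f x) ->
  (forall n f g x, (forall m, (m < n)%N -> f m = g m) -> Rel n f x -> Rel n g x) ->
  exists f, forall n, Rel n f (f n).
Proof.
move=> ex ext; have /choice[c hc] (p : nat * (nat -> R)) : exists x, Rel p.1 p.2 x.
  exact: ex.
pose fix hist n : seq R := if n is m.+1 then rcons (hist m) (c (m, nth 0 (hist m))) else [::].
have sz n : size (hist n) = n by elim: n => //= n IH; rewrite size_rcons IH.
pose f n := c (n, nth 0 (hist n)).
have histE n m : (m < n)%N -> nth 0 (hist n) m = f m.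
  elim: n => // n IH; rewrite ltnS leq_eqVlt => /orP[/eqP->|mn] /=.
    by rewrite nth_rcons sz ltnn eqxx.
  by rewrite nth_rcons sz mn IH.
exists f => n; apply: ext (hc (n, nth 0 (hist n))) => m mn /=.
exact: histE.
Qed.

Lemma small_weight N (v c : nat -> R) : (forall n, (n < N)%N -> 0 < c n) ->
  exists x, [/\ 0 < x, x <= 1 & forall n, (n < N)%N -> x * `|v n| <= c n].
Proof.
elim: N => [|N IH] hc; first by exists 1.
have [|x [x0 x1 hx]] := IH; first by move=> n nN; apply: hc; exact: ltnW.
have cN := hc N (ltnSn N); have v0 : 0 < 1 + `|v N| by rewrite ltr_wpDr.
pose y := c N / (1 + `|v N|); have y0 : 0 < y by rewrite divr_gt0.
exists (Num.min x y); split.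
- by rewrite lt_min x0.
- by rewrite ge_min x1.
move=> n; rewrite ltnS leq_eqVlt => /orP[/eqP->|nN].
  apply: le_trans (_ : y * (1 + `|v N|) <= _); last by rewrite divfK // gt_eqF.
  by apply: ler_pM => //; rewrite ?le_min ?ge_min ?lexx ?orbT ?(ltW x0) ?(ltW y0) // lerDr.
apply: le_trans (hx n nN); apply: ler_wpM2r => //.
by rewrite ge_min lexx.
Qed.

End Domination.

Section Final.
Variables (R : realType) (X : completeNormedModType R) (xi : omega1).
Hypothesis xi1 : (omega1_one <= xi)%O.
Variable es : nat -> seminormed_basis R.
Hypothesis hes : forall n, SMw X xi (es n).
Hypothesis inc : forall n m, (n < m)%N -> sb_lt (es n) (es m).

Local Notation V n k a := (basis_norm (es n) k a).

(** All earlier norms are dominated by that of [es n], which does not dominate the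
    norm of [es n.+1]. *)
Lemma separate n (t : R) : 0 < t -> exists p : nat * (nat -> R),
  [/\ forall j, `|p.2 j| <= 1, 0 < V n.+1 p.1 p.2 &
      \sum_(m < n.+1) V m p.1 p.2 <= t * V n.+1 p.1 p.2].
Proof.
move=> t0.
have /choice[D hD] m : exists D : R, 0 < D /\ ((m <= n)%N -> forall k a, (forall j, `|a j| <= 1) ->
    V m k a <= D * V n k a).
  have [mn|mn|->] := ltngtP m n.
  - by have [/sb_leP[C C0 h] _] := inc mn; exists C.
  - by exists 1; split=> // /leq_trans.
  - by exists 1; split=> // _ k a _; rewrite mul1r.
pose DD := 1 + \sum_(m < n.+1) D m.
have DD0 : 0 < DD by rewrite ltr_wpDr // sumr_ge0 // => m _; exact/ltW/(hD m).1.
have [_ nle] := inc (ltnSn n); apply: contrapT => no; apply: nle.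
apply/sb_leP; exists (DD / t); first by rewrite divr_gt0.
move=> k a a1; rewrite leNgt; apply/negP => lt; apply: no.
have V0 : 0 <= DD / t * V n k a by rewrite mulr_ge0 ?basis_norm_ge0 // ltW // divr_gt0.
exists (k, a); split=> //=; first exact: le_lt_trans lt.
apply: le_trans (_ : DD * V n k a <= _); last first.
  by apply/ltW; rewrite -ltr_pdivrMl // mulrA [t^-1 * _]mulrC.
apply: le_trans (_ : \sum_(m < n.+1) D m * V n k a <= _).
  by apply: ler_sum => m _; apply: (hD m).2 => //; rewrite -ltnS.
rewrite -mulr_suml; apply: ler_wpM2r; first exact: basis_norm_ge0.
by rewrite /DD lerDr.
Qed.

Let theta n : R := 2 ^- n.+1.
Let theta0 n : 0 < theta n. Proof. by rewrite invr_gt0 exprn_gt0. Qed.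
Let theta1 n : theta n <= 1.
Proof. by rewrite invf_le1 ?exprn_gt0 // exprn_ege1 // ler1n. Qed.

(** The weights [u] decrease so fast that the vector separating [es n.+1] from
    [es n] is not felt by the later terms. *)
Lemma weights_exist (K : nat -> R) : exists u : nat -> R,
  [/\ forall n, 0 < u n <= 1, forall n, u n * `|K n| <= 4 ^- n.+1 &
  forall n, exists p : nat * (nat -> R), [/\ forall j, `|p.2 j| <= 1,
      0 < V n.+1 p.1 p.2,
      \sum_(m < n.+1) V m p.1 p.2 <=
        2 ^- n * (u n.+1 * theta n.+1 ^+ n.+1) * V n.+1 p.1 p.2 &
      forall m, (n.+1 < m)%N -> u m * V m p.1 p.2 <=
        2 ^- m.+1 * (2 ^- n * (u n.+1 * theta n.+1 ^+ n.+1) * V n.+1 p.1 p.2)]].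
Proof.
pose t n x : R := 2 ^- n * (x * theta n.+1 ^+ n.+1).
have t0 n x : 0 < x -> 0 < t n x.
  by move=> x0; rewrite !mulr_gt0 // ?invr_gt0 exprn_gt0.
have /choice[p hp] (q : nat * R) : exists p : nat * (nat -> R), 0 < q.2 ->
    [/\ forall j, `|p.2 j| <= 1, 0 < V q.1.+1 p.1 p.2 &
      \sum_(m < q.1.+1) V m p.1 p.2 <= t q.1 q.2 * V q.1.+1 p.1 p.2].
  case: q => n x /=; have [x0|_] := ltP 0 x; last by exists (0%N, fun=> 0).
  by have [p hp] := separate n (t0 n x x0); exists p.
pose VV m (q : nat * R) := V m (p q).1 (p q).2.
pose Rel m (f : nat -> R) x := [/\ 0 < x <= 1, x * `|K m| <= 4 ^- m.+1 &
  forall n, (n.+1 < m)%N -> 0 < f n.+1 -> x * VV m (n, f n.+1) <=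
    2 ^- m.+1 * (t n (f n.+1) * VV n.+1 (n, f n.+1))].
have [||u hu] := @recursive_choice R Rel.
- move=> m f.
  pose v i := if i is n.+1 then VV m (n, f n.+1) else K m.
  pose c i : R := if i is n.+1 then
    (if 0 < f n.+1 then 2 ^- m.+1 * (t n (f n.+1) * VV n.+1 (n, f n.+1)) else 1)
    else 4 ^- m.+1.
  have [|x [x0 x1 hx]] := @small_weight R m.+1 v c.
    move=> [_|n _] /=; first by rewrite invr_gt0 exprn_gt0.
    case: ifP => // f0; have [_ h _] := hp (n, f n.+1) f0.
    by rewrite mulr_gt0 ?invr_gt0 ?exprn_gt0 // mulr_gt0 // t0.
  exists x; split; [by rewrite x0|exact: (hx 0%N)|].
  move=> n nm f0; have := hx n.+1 (ltnW nm); rewrite /= f0.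
  by rewrite ger0_norm //; exact: basis_norm_ge0.
- move=> m f g x fg [h1 h2 h3]; split=> // n nm; rewrite -fg //; exact: h3.
have u0 n : 0 < u n by have [/andP[]] := hu n.
exists u; split; [by move=> n; have [] := hu n|by move=> n; have [] := hu n|].
move=> n; exists (p (n, u n.+1)); have [h1 h2 h3] := hp (n, u n.+1) (u0 n.+1).
by split=> // m nm; have [_ _ h] := hu m; exact: h.
Qed.

(** On the [n]-th separating vector the terms up to [n] and those beyond [n.+1] are
    negligible by the choice of [u], and the term [n.+1] is smaller for the smaller
    index by a factor [theta n.+1]. *)
Lemma omega1_chain_of_chain : exists e : omega1 -> seminormed_basis R,
  (forall al, SMw X xi (e al) /\ sb_normalized (e al)) /\
  (forall al be, (al < be)%O -> sb_lt (e al) (e be)).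
Proof.
have [K realK] := realize xi1 hes.
have [u [u01 uK sep]] := weights_exist K.
have [j [jn jlt]] := slow_chain.
pose w al n := u n * theta n ^+ j al n.
have w0 al n : 0 < w al n by have /andP[u0 _] := u01 n; rewrite mulr_gt0 // exprn_gt0.
have wu al n : w al n <= u n.
  have /andP[u0 _] := u01 n; rewrite ger_pMr //; apply: exprn_ile1 => //; exact: ltW.
have w1 al n : w al n <= 1 by apply: le_trans (wu al n) _; have /andP[] := u01 n.
have wK al n : w al n * K n <= 4 ^- n.+1.
  apply: le_trans (uK n); apply: le_trans (_ : w al n * `|K n| <= _).
    by rewrite ler_pM2l // ler_norm.
  exact: ler_wpM2r.
have low al n : u n * theta n ^+ n <= w al n.
  have /andP[u0 _] := u01 n; rewrite ler_pM2l //.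
  by apply: ler_wiXn2l => //; exact: ltW.
have /choice[e he] al := realK (w al) (w0 al) (w1 al) (wK al).
pose lam al := sb_norm (sb_basis (e al) 0%N).
have lam0 al : 0 < lam al.
  rewrite lt_def sb_norm_ge0 andbT; apply/negP => /eqP l0.
  have [p [p1 V0 _ _]] := sep 0%N.
  have [_ h _ h4] := he al; have := h 1%N p.1 p.2 p1.
  rewrite leNgt => /negP; apply; apply: le_lt_trans (_ : p.1%:R * 0 < _).
    by apply: basis_norm_le => // i; rewrite h4 -/(lam al) l0.
  by rewrite mulr0 mulr_gt0.
have le_w al be : (al < be)%O -> exists n0, forall n, (n0 <= n)%N ->
    w al n <= theta n * w be n.
  move=> /jlt[n0 hn0]; exists n0 => // n /hn0 jj.
  have /andP[u0 _] := u01 n; rewrite /w mulrCA ler_pM2l // -exprS.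
  by apply: ler_wiXn2l => //; exact: ltW.
have upper al k a (B : R) : (forall i, `|a i| <= 1) ->
    (exists p0, forall p, (p0 <= p)%N -> \sum_(n < p) w al n * V n k a <= B) ->
    basis_norm (e al) k a <= B.
  move=> a1 [p0 hp0]; have [_ _ h _] := he al.
  apply/ler_addgt0Pl => eps eps0; have [M hM] := expn2_small 1 eps0.
  pose p := maxn p0 (maxn k M).
  apply: le_trans (h p k a a1) _; rewrite addrC; apply: lerD.
    apply: le_trans (natr_expn4_le R _) _; first by rewrite /p !leq_max leqnn orbT.
    by rewrite -[leLHS]mul1r; apply: hM; rewrite /p !leq_max leqnn !orbT.
  by apply: hp0; rewrite leq_maxl.
have dom al be : (al < be)%O -> exists2 C : R, 0 < C & forall k a, (forall i, `|a i| <= 1) ->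
    basis_norm (e al) k a <= C * basis_norm (e be) k a.
  move=> lt; have [n0 hn0] := le_w al be lt.
  (* The finitely many terms before [n0] only enlarge the constant. *)
  pose A := 1 + \sum_(n < n0) (theta n * w be n)^-1.
  have tw n : 0 < theta n * w be n by rewrite mulr_gt0.
  have S0 : 0 <= \sum_(n < n0) (theta n * w be n)^-1.
    by rewrite sumr_ge0 // => n _; rewrite invr_ge0 ltW.
  have A1 : 1 <= A by rewrite lerDl.
  have wA n : w al n <= A * (theta n * w be n).
    have [nn|nn] := leqP n0 n.
      by apply: le_trans (hn0 n nn) _; rewrite ler_peMl // ltW.
    apply: le_trans (w1 al n) _; rewrite -ler_pdivrMr // div1r /A.
    rewrite (bigD1 (Ordinal nn)) //= addrCA lerDl addr_ge0 // sumr_ge0 // => i _.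
    by rewrite invr_ge0 ltW.
  exists A; first by lra.
  move=> k a a1; apply: (upper al k a) => //; exists 0%N => p _.
  have [_ h _ _] := he be; set N := basis_norm (e be) k a.
  apply: le_trans (_ : \sum_(n < p) theta n * (A * N) <= _).
    apply: ler_sum => n _; apply: le_trans (ler_wpM2r (basis_norm_ge0 _ _ _) (wA n)) _.
    rewrite -!mulrA mulrCA ler_pM2l //; apply: ler_wpM2l; first by lra.
    by rewrite mulrA; exact: (h n k a a1).
  rewrite -mulr_suml; apply: ler_piMl; last exact: sum_expn2.
  by rewrite mulr_ge0 ?basis_norm_ge0 //; lra.
have ndom al be (C : R) : (al < be)%O -> 0 < C -> ~ forall k a, (forall i, `|a i| <= 1) ->
    basis_norm (e be) k a <= C * basis_norm (e al) k a.
  move=> lt C0 hC; have [n0 hn0] := le_w al be lt.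
  have [M hM] := expn2_small (C * 3) (e := 2^-1 : R) ltac:(lra).
  pose n := maxn n0 M.
  have nn0 : (n0 <= n.+1)%N by rewrite ltnW // ltnS leq_maxl.
  have [[k a] /= [a1 V0 S1 S2]] := sep n.
  set v := V n.+1 k a in V0 S1 S2.
  pose W := w be n.+1 * v; have W0 : 0 < W by rewrite mulr_gt0.
  have tW : u n.+1 * theta n.+1 ^+ n.+1 * v <= W by rewrite ler_pM2r.
  have e2 : 0 < 2 ^- n :> R by rewrite invr_gt0 exprn_gt0.
  have W2 : 2 ^- n * (u n.+1 * theta n.+1 ^+ n.+1) * v <= 2 ^- n * W.
    by rewrite -mulrA ler_pM2l.
  have Wbe : W <= basis_norm (e be) k a by have [_ h _ _] := he be; exact: h.
  have : basis_norm (e al) k a <= 3 * 2 ^- n * W.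
    apply: (upper al k a) => //; exists n.+2 => p np.
    pose F m := w al m * V m k a.
    rewrite -(big_mkord xpredT F) (big_cat_nat (leq0n n.+2) np) /= big_nat_recr //=.
    have h1 : \sum_(0 <= m < n.+1) F m <= 2 ^- n * W.
      apply: le_trans W2; apply: le_trans S1; rewrite big_mkord; apply: ler_sum => m _.
      by rewrite ler_piMl // basis_norm_ge0.
    have h2 : F n.+1 <= 2 ^- n * W.
      apply: le_trans (_ : theta n.+1 * w be n.+1 * v <= _).
        by rewrite ler_pM2r //; exact: hn0.
      rewrite -mulrA ler_pM2r //; apply: expn2_le; exact: ltnW (ltnW _).
    have h3 : \sum_(n.+2 <= m < p) F m <= 2 ^- n * W.
      apply: le_trans (_ : \sum_(n.+2 <= m < p) 2 ^- m.+1 * (2 ^- n * W) <= _).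
        rewrite big_nat [leRHS]big_nat; apply: ler_sum => m /andP[nm _].
        apply: le_trans (_ : u m * V m k a <= _).
          by apply: ler_wpM2r => //; exact: basis_norm_ge0.
        apply: le_trans (S2 m nm) _; apply: ler_wpM2l; last exact: W2.
        by rewrite invr_ge0 exprn_ge0.
      rewrite -mulr_suml; apply: ler_piMl; first by rewrite mulr_ge0 // ltW.
      apply: le_trans (sum_expn2 R p); rewrite -(big_mkord xpredT (fun m => 2 ^- m.+1)).
      rewrite [leRHS](big_cat_nat (leq0n n.+2) np) /= lerDr.
      by apply: sumr_ge0 => m _; rewrite invr_ge0 exprn_ge0.
    lra.
  move=> h3; have := hC k a a1; have := hM n (leq_maxr _ _) => h4 h5.
  have q1 : C * basis_norm (e al) k a <= C * (3 * 2 ^- n * W) by rewrite ler_pM2l.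
  have q2 : C * (3 * 2 ^- n * W) = C * 3 * 2 ^- n * W by rewrite !mulrA.
  have q3 : C * 3 * 2 ^- n * W <= 2^-1 * W by rewrite ler_pM2r.
  have : W <= 2^-1 * W.
    by apply: le_trans Wbe _; apply: le_trans h5 _; apply: le_trans q1 _; rewrite q2.
  by apply/negP; rewrite -ltNge gtr_pMl // invf_lt1 // ltr1n.
have /choice[e' he'] al : exists e', [/\ SMw X xi e',
    forall k a, basis_norm e' k a = (lam al)^-1 * basis_norm (e al) k a &
    forall i, sb_norm (sb_basis e' i) = (lam al)^-1 * sb_norm (sb_basis (e al) i)].
  by apply: SMw_scale; [rewrite invr_gt0|case: (he al)].
exists e'; split=> [al|al be lt].
  have [h1 _ h3] := he' al; split=> // i.
  by have [_ _ _ h4] := he al; rewrite h3 h4 mulVf // gt_eqF.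
have [_ Ea _] := he' al; have [_ Eb _] := he' be.
have la := lam0 al; have lb := lam0 be.
split.
  have [C C0 hC] := dom al be lt; apply/sb_leP; exists ((lam al)^-1 * C * lam be).
    by rewrite !mulr_gt0 // invr_gt0.
  move=> k a a1; rewrite Ea Eb -!mulrA mulVKf ?gt_eqF // ler_pM2l ?invr_gt0 //.
  exact: hC.
move=> /sb_leP[C C0 hC]; apply: (ndom al be (lam be * C * (lam al)^-1) lt).
  by rewrite !mulr_gt0 // invr_gt0.
move=> k a a1; have := hC k a a1; rewrite Ea Eb ler_pdivrMl // => /le_trans; apply.
by rewrite !mulrA.
Qed.

End Final.

Theorem corollary21 (R : realType) (X : completeNormedModType R) (xi : omega1)
    (hxi : (omega1_one <= xi)%O) :
  has_increasing_seq nat (SMw X xi) ->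
  has_increasing_seq omega1 (fun e => SMw X xi e /\ sb_normalized e).
Proof.
move=> [es [hes inc]].
exact: (omega1_chain_of_chain hxi hes inc).
Qed.
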